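(* Let $A$, $j:C\to A$, $\tau$, the GNS triple $(H_\tau,\pi_\tau,\Omega_\tau)$ of $\tau$, and the faithful representation $\Theta:A\to\mathcal B(H_\tau)$ be as in the context. Put $R=\pi_\tau(C)''\subseteq\mathcal B(H_\tau)$. Then $R$ is a hyperfinite $\mathrm{II}_1$ factor, and $$\pi_\tau(C)\subseteq\Theta(A)\subseteq R,\qquad \Theta(A)''=R.$$ Thus $A$ is isomorphic to a strongly dense unital $C^*$-subalgebra of $R$.
   Context: Conventions. Algebras and Hilbert spaces are complex; inner products are linear in the first variable; for vectors $x,y$, $\theta_{x,y}z=\langle z,y\rangle x$. Strong limits and strong density refer to the strong operator topology; $''$ denotes the bicommutant. CAR algebra. $C=\overline{\bigcup_{n\ge0}C_n}$ with $C_n=M_2(\mathbb C)^{\otimes n}$ embedded in $C_{n+1}$ by $a\mapsto a\otimes1_2$. Its unique tracial state is $\tau(a)=2^{-n}\operatorname{Tr}(a)$, $a\in C_n$. Let $e_{00}\in M_2(\mathbb C)$ be the first diagonal matrix unit, $q_n=e_{00}^{\otimes n}\in C$ (so $q_0=1$ and $q_n$ is decreasing), and let $\phi_{\mathrm r}$ be the pure product state of $C$ selecting the first coordinate in each tensor factor, i.e. the product of the vector states $a\mapsto a_{00}$ on $M_2(\mathbb C)$. Pure-state data. Choose pure states $(\phi_i)_{i\in I}$ of $C$, with GNS triples $(H_i,\pi_i,\xi_i)$, such that $(\pi_i)_{i\in I}$ contains exactly one representative of each unitary equivalence class of irreducible representations of $C$, with a distinguished index $\mathrm r\in I$ corresponding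 to $\phi_{\mathrm r}$. For each $i\in I$ choose an automorphism $\alpha_i$ of $C$ with $\phi_i\circ\alpha_i=\phi_{\mathrm r}$ and $\alpha_{\mathrm r}=\mathrm{id}_C$ which is asymptotically inner: there is a norm-continuous path $t\mapsto u_{i,t}$ ($t\ge0$) of unitaries of $C$ with $u_{i,0}=1$ and $\lim_{t\to\infty}\|\alpha_i(a)-u_{i,t}au_{i,t}^*\|=0$ for all $a\in C$. (Such $\alpha_i$ exist by the Kishimoto–Ozawa–Sakai homogeneity theorem.) Put, for $n\ge0$, $p_{i,n}=\alpha_i(q_n)$, $f_n=q_n-q_{n+1}$, $e_{i,n}=p_{i,n}-p_{i,n+1}$. Choose $w_{i,n}\in C$ with $w_{i,n}^*w_{i,n}=e_{i,n}$, $w_{i,n}w_{i,n}^*=f_n$, $w_{\mathrm r,n}=f_n$ (such elements exist), and put $s_{i,N}=\sum_{n=0}^{N-1}w_{i,n}\in C$. The algebra. Let $H=\bigoplus_{i\in I}H_i$, $\Pi=\bigoplus_{i\in I}\pi_i:C\to\mathcal B(H)$, and let $\zeta_i\in H$ be the image of $\xi_i$ under the coordinate inclusion $H_i\to H$. Let $S_i$ be the strong limit of $\Pi(s_{i,N})$ as $N\to\infty$ (which exists) and $L_i=S_i+\theta_{\zeta_{\mathrm r},\zeta_i}$, which is a unitary on $H$. Define $A=C^*(\Pi(C),\{L_i:i\in I\})\subseteq\mathcal B(H)$, and $j:C\to A$, $j(a)=\Pi(a)$. The representation $\Theta$. It is known that $\tau$ has a unique state extension $\widetilde\tau$ to $A$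 (meaning $\widetilde\tau\circ j=\tau$). Let $(K,\rho,\Omega)$ be the GNS triple of $\widetilde\tau$. The vectors $\rho(j(b))\Omega$, $b\in C$, are dense in $K$, so $T\pi_\tau(b)\Omega_\tau=\rho(j(b))\Omega$ ($b\in C$) defines a unitary $T:H_\tau\to K$. Set $\Theta(a)=T^*\rho(a)T$ for $a\in A$; this is a faithful representation of $A$ on $H_\tau$. *)

(* Defs.v *)
From HB Require Import structures.
From mathcomp Require Import all_boot all_order all_algebra.
From mathcomp Require Import complex mxtens ring.
From mathcomp Require Import all_classical all_reals all_analysis.

Set Implicit Arguments.
Unset Strict Implicit.
Unset Printing Implicit Defensive.

Import Order.TTheory GRing.Theory Num.Theory.
Import numFieldNormedType.Exports.

Local Open Scope classical_set_scope.
Local Open Scope complex_scope.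
Local Open Scope ring_scope.

HB.mixin Record isStarAlgebra (K : numClosedFieldType) A
    of GRing.Algebra K A := {
  star : A -> A;
  starK : forall x, star (star x) = x;
  starD : forall x y, star (x + y) = star x + star y;
  starZ : forall (k : K) x, star (k *: x) = (Num.conj k) *: star x;
  starM : forall x y, star (x * y) = star y * star x
}.

#[short(type="starAlgType")]
HB.structure Definition StarAlgebra (K : numClosedFieldType) :=
  {A of GRing.Algebra K A & isStarAlgebra K A}.

(* The norm is a field of its own, valued in K as all norms of the library:
   the existing hierarchy has no join of rings and normed modules, so that
   [StarAlgebra] and [CompleteNormedModule] cannot be combined. *)
HB.mixin Record isCStarAlgebra (K : numClosedFieldType) A
    of StarAlgebra K A := {
  cnorm : A -> K;
  cnorm0_eq0 : forall x, cnorm x = 0 -> x = 0;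
  cnormD_le : forall x y, cnorm (x + y) <= cnorm x + cnorm y;
  cnormZ : forall (k : K) x, cnorm (k *: x) = `|k| * cnorm x;
  cnormM_le : forall x y, cnorm (x * y) <= cnorm x * cnorm y;
  cnorm_starM : forall x, cnorm (star x * x) = cnorm x ^+ 2;
  cnorm_complete : forall u : nat -> A,
    (forall eps : K, 0 < eps -> exists N, forall m n, (N <= m)%N -> (N <= n)%N ->
       cnorm (u m - u n) < eps) ->
    exists l, forall eps : K, 0 < eps -> exists N, forall n, (N <= n)%N ->
       cnorm (u n - l) < eps
}.

#[short(type="cstarAlgType")]
HB.structure Definition CStarAlgebra (K : numClosedFieldType) :=
  {A of StarAlgebra K A & isCStarAlgebra K A}.

Section StarAlgebraTheory.
Variables (K : numClosedFieldType) (A : starAlgType K).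

Definition is_unitary (u : A) : Prop := star u * u = 1 /\ u * star u = 1.

Definition is_projection (p : A) : Prop := star p = p /\ p * p = p.

Definition is_state (phi : A -> K) : Prop :=
  [/\ scalar phi, forall a, 0 <= phi (star a * a) & phi 1 = 1].

Definition pure_state (phi : A -> K) : Prop :=
  is_state phi /\
  forall (phi1 phi2 : A -> K) (t : K),
    is_state phi1 -> is_state phi2 -> 0 < t < 1 ->
    (forall a, phi a = t * phi1 a + (1 - t) * phi2 a) ->
    phi1 = phi /\ phi2 = phi.

Definition commutant (S : set A) : set A :=
  [set x | forall y, S y -> x * y = y * x].

Definition bicommutant (S : set A) : set A := commutant (commutant S).

Definition star_subalgebra (B : set A) : Prop :=
  [/\ B 1,
      forall (k : K) x y, B x -> B y -> B (k *: x + y),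
      forall x y, B x -> B y -> B (x * y)
    & forall x, B x -> B (star x)].

Definition finite_dimensional (B : set A) : Prop :=
  exists s : seq A, forall x, B x ->
    exists c : nat -> K, x = \sum_(k < size s) c k *: s`_k.

End StarAlgebraTheory.

Record star_hom (K : numClosedFieldType) (A B : starAlgType K) (f : A -> B) :
    Prop := {
  star_hom_linear : linear f;
  star_hom1 : f 1 = 1;
  star_homM : forall x y, f (x * y) = f x * f y;
  star_hom_star : forall x, f (star x) = star (f x)
}.

Definition star_automorphism (K : numClosedFieldType) (A : starAlgType K)
    (f : A -> A) : Prop :=
  star_hom f /\ bijective f.

(* The zero space is excluded, so that the operators on a Hilbert space form a
   nontrivial ring, as the algebra structures of the library require.  Every
   space carrying a unit vector is of this kind; in particular irreducible
   representations, by convention, act on nonzero spaces. *)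
HB.mixin Record isHilbert (R : realType) H of CompleteNormedModule R[i] H := {
  inner : H -> H -> R[i];
  inner_linear : forall z : H, scalar (inner^~ z);
  inner_conj : forall x y, inner y x = Num.conj (inner x y);
  inner_norm : forall x : H, inner x x = `|x| ^+ 2;
  hilbert_nonzero : exists x : H, x != 0
}.

#[short(type="hilbertType")]
HB.structure Definition Hilbert (R : realType) :=
  {H of CompleteNormedModule R[i] H & isHilbert R H}.

Notation "<< x , y >>" := (inner x y) (at level 0, x, y at level 99) : ring_scope.

Section InnerTheory.
Variables (R : realType) (H : hilbertType R).
Implicit Types x y z : H.

Lemma innerDl x y z : <<x + y, z>> = <<x, z>> + <<y, z>>.
Proof. by rewrite -[x]scale1r inner_linear scale1r mul1r. Qed.

Lemma inner0l z : <<0, z>> = 0.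
Proof. by apply: (addrI <<0, z>>); rewrite -innerDl !addr0. Qed.

Lemma innerZl k x z : <<k *: x, z>> = k * <<x, z>>.
Proof. by rewrite -[k *: x]addr0 inner_linear inner0l addr0. Qed.

Lemma innerNl x z : <<- x, z>> = - <<x, z>>.
Proof. by rewrite -scaleN1r innerZl mulN1r. Qed.

Lemma innerDr z x y : <<z, x + y>> = <<z, x>> + <<z, y>>.
Proof. by rewrite inner_conj innerDl rmorphD /= -!inner_conj. Qed.

Lemma innerZr k z x : <<z, k *: x>> = Num.conj k * <<z, x>>.
Proof. by rewrite inner_conj innerZl rmorphM /= -inner_conj. Qed.

Lemma innerNr z x : <<z, - x>> = - <<z, x>>.
Proof. by rewrite inner_conj innerNl rmorphN /= -inner_conj. Qed.

Lemma innerlI x y : (forall z, <<x, z>> = <<y, z>>) -> x = y.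
Proof.
move=> xy; apply/eqP; rewrite -subr_eq0 -normr_eq0 -sqrf_eq0 -inner_norm.
by rewrite innerDl innerNl xy subrr.
Qed.

Lemma innerrI x y : (forall z, <<z, x>> = <<z, y>>) -> x = y.
Proof. by move=> xy; apply: innerlI => z; rewrite inner_conj xy -inner_conj. Qed.

Lemma cauchy_schwarz x y : `|<<x, y>>| <= `|x| * `|y|.
Proof.
have [->|y0] := eqVneq y 0.
  by rewrite inner_conj inner0l rmorph0 !normr0 mulr0.
have ny : 0 < `|y| by rewrite normr_gt0.
rewrite -(ler_pXn2r (n := 2)) ?nnegrE ?mulr_ge0//.
rewrite exprMn.
have Nyy : Num.conj (`|y| ^+ 2) = `|y| ^+ 2 by rewrite -inner_norm -inner_conj.
have : 0 <= `|(`|y| ^+ 2) *: x - <<x, y>> *: y| ^+ 2 by rewrite exprn_ge0.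
rewrite -inner_norm !(innerDl, innerDr, innerNl, innerNr, innerZl, innerZr).
rewrite !inner_norm Nyy [<<y, x>>]inner_conj.
set a := <<x, y>>; set b := `|y| ^+ 2; set c := `|x| ^+ 2 => h.
have {h} : 0 <= b * (c * b - a * Num.conj a).
  apply: le_trans h _; rewrite le_eqVlt; apply/orP; left; apply/eqP.
  by ring.
by rewrite pmulr_rge0 ?exprn_gt0// subr_ge0 => h; rewrite normCK.
Qed.

End InnerTheory.

(* A bounded operator is recorded together with its adjoint, which is unique
   and exists for every bounded operator by the Riesz representation theorem. *)
Record bop (R : realType) (H K : hilbertType R) := Bop {
  bop_fun :> H -> K;
  bop_adj : K -> H;
  bop_linear : linear bop_fun;
  bop_bounded : exists c : R[i], forall x, `|bop_fun x| <= c * `|x|;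
  bop_adjP : forall x y, <<bop_fun x, y>> = <<x, bop_adj y>>
}.

Section BopTheory.
Variables (R : realType).
Implicit Types H K L : hilbertType R.

HB.instance Definition _ H K (T : bop H K) :=
  GRing.isLinear.Build R[i] H K *:%R (bop_fun T) (bop_linear T).

Lemma bop_ext H K (S T : bop H K) : (forall x, S x = T x) -> S = T.
Proof.
case: S => f f' fl fb ff; case: T => g g' gl gb gg /= fg.
have e : f = g by apply/funext.
subst g.
have e' : f' = g'.
  by apply/funext => y; apply: innerrI => z; rewrite -ff gg.
subst g'; congr Bop; exact: Prop_irrelevance.
Qed.

HB.instance Definition _ H K := gen_eqMixin (bop H K).
HB.instance Definition _ H K := gen_choiceMixin (bop H K).

Lemma bop_boundP H K (T : bop H K) :
  exists2 c : R[i], 0 <= c & forall x, `|T x| <= c * `|x|.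
Proof.
have [c cP] := bop_bounded T; exists `|c| => // x.
have [x0 xn0] := hilbert_nonzero (s := H).
have c0 : 0 <= c.
  by rewrite -(pmulr_lge0 _ (_ : 0 < `|x0|)) ?normr_gt0//; apply: le_trans (cP x0).
by rewrite ger0_norm.
Qed.

Lemma bop_adj_linear H K (T : bop H K) : linear (bop_adj T).
Proof.
move=> k x y; apply: innerrI => z.
by rewrite -bop_adjP innerDr innerZr innerDr innerZr !bop_adjP.
Qed.

Lemma bop_adj_bounded H K (T : bop H K) :
  exists c : R[i], forall x, `|bop_adj T x| <= c * `|x|.
Proof.
have [c c0 cP] := bop_boundP T; exists c => x.
have [->|x0] := eqVneq (bop_adj T x) 0; first by rewrite normr0 mulr_ge0.
rewrite -(ler_pM2r (_ : 0 < `|bop_adj T x|)) ?normr_gt0// -expr2.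
rewrite -inner_norm -bop_adjP.
apply: le_trans (_ : `|T (bop_adj T x)| * `|x| <= _); last first.
  by rewrite mulrAC ler_wpM2r.
apply: le_trans (cauchy_schwarz _ _).
by rewrite bop_adjP inner_norm ger0_norm// exprn_ge0.
Qed.

Lemma bop_adjPC H K (T : bop H K) x y : <<bop_adj T x, y>> = <<x, T y>>.
Proof. by rewrite inner_conj -bop_adjP -inner_conj. Qed.

Definition adjoint H K (T : bop H K) : bop K H :=
  Bop (@bop_adj_linear H K T) (bop_adj_bounded T) (@bop_adjPC H K T).

Program Definition bop_comp H K L (S : bop K L) (T : bop H K) : bop H L :=
  @Bop R H L (fun x => S (T x)) (fun y => bop_adj T (bop_adj S y)) _ _ _.
Next Obligation. by move=> H K L S T k x y; rewrite !linearP. Qed.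
Next Obligation.
move=> H K L S T; have [c c0 cP] := bop_boundP S; have [d _ dP] := bop_boundP T.
exists (c * d) => x; apply: le_trans (cP _) _.
by rewrite -mulrA ler_wpM2l.
Qed.
Next Obligation. by move=> H K L S T x y /=; rewrite !bop_adjP. Qed.

Program Definition bop_id H : bop H H := @Bop R H H id id _ _ _.
Next Obligation. by []. Qed.
Next Obligation. by move=> H; exists 1 => x; rewrite mul1r. Qed.
Next Obligation. by []. Qed.

Program Definition bop_zero H K : bop H K := @Bop R H K (fun=> 0) (fun=> 0) _ _ _.
Next Obligation. by move=> H K k x y; rewrite scaler0 addr0. Qed.
Next Obligation. by move=> H K; exists 0 => x; rewrite normr0 mul0r. Qed.
Next Obligation.
by move=> H K x y /=; rewrite inner0l inner_conj inner0l rmorph0.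
Qed.

Program Definition bop_add H K (S T : bop H K) : bop H K :=
  @Bop R H K (fun x => S x + T x) (fun y => bop_adj S y + bop_adj T y) _ _ _.
Next Obligation.
by move=> H K S T k x y; rewrite !linearP scalerDr addrACA.
Qed.
Next Obligation.
move=> H K S T; have [c c0 cP] := bop_boundP S; have [d _ dP] := bop_boundP T.
exists (c + d) => x; apply: le_trans (ler_normD _ _) _.
by rewrite mulrDl lerD.
Qed.
Next Obligation.
by move=> H K S T x y /=; rewrite innerDl innerDr !bop_adjP.
Qed.

Program Definition bop_scale H K (k : R[i]) (T : bop H K) : bop H K :=
  @Bop R H K (fun x => k *: T x) (fun y => Num.conj k *: bop_adj T y) _ _ _.
Next Obligation.
by move=> H K k T a x y; rewrite linearP scalerDr !scalerA mulrC.
Qed.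
Next Obligation.
move=> H K k T; have [c c0 cP] := bop_boundP T; exists (`|k| * c) => x.
by rewrite normrZ -mulrA ler_wpM2l.
Qed.
Next Obligation.
by move=> H K k T x y /=; rewrite innerZl innerZr conjCK bop_adjP.
Qed.

Section Zmod.
Variables H K : hilbertType R.
Implicit Types S T : bop H K.

Let addA : associative (@bop_add H K).
Proof. by move=> S T U; apply: bop_ext => x /=; rewrite addrA. Qed.
Let addC : commutative (@bop_add H K).
Proof. by move=> S T; apply: bop_ext => x /=; rewrite addrC. Qed.
Let add0 : left_id (bop_zero H K) (@bop_add H K).
Proof. by move=> S; apply: bop_ext => x /=; rewrite add0r. Qed.
Let addN : left_inverse (bop_zero H K) (@bop_scale H K (-1)) (@bop_add H K).
Proof. by move=> S; apply: bop_ext => x /=; rewrite scaleN1r addNr. Qed.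

HB.instance Definition _ := GRing.isZmodule.Build (bop H K) addA addC add0 addN.

Let scaleA a b T : bop_scale a (bop_scale b T) = bop_scale (a * b) T.
Proof. by apply: bop_ext => x /=; rewrite scalerA. Qed.
Let scale1 : left_id 1 (@bop_scale H K).
Proof. by move=> S; apply: bop_ext => x /=; rewrite scale1r. Qed.
Let scaleDr : right_distributive (@bop_scale H K) +%R.
Proof. by move=> a S T; apply: bop_ext => x /=; rewrite scalerDr. Qed.
Let scaleDl T : {morph (@bop_scale H K)^~ T : a b / a + b}.
Proof. by move=> a b; apply: bop_ext => x /=; rewrite scalerDl. Qed.

HB.instance Definition _ :=
  GRing.Zmodule_isLmodule.Build R[i] (bop H K) scaleA scale1 scaleDr scaleDl.

End Zmod.

Section Algebra.
Variable H : hilbertType R.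
Implicit Types S T : bop H H.

Let mulA : associative (@bop_comp H H H).
Proof. by move=> S T U; apply: bop_ext. Qed.
Let mul1 : left_id (bop_id H) (@bop_comp H H H).
Proof. by move=> S; apply: bop_ext. Qed.
Let mulr1 : right_id (bop_id H) (@bop_comp H H H).
Proof. by move=> S; apply: bop_ext. Qed.
Let mulDl : left_distributive (@bop_comp H H H) +%R.
Proof. by move=> S T U; apply: bop_ext. Qed.
Let mulDr : right_distributive (@bop_comp H H H) +%R.
Proof. by move=> S T U; apply: bop_ext => x /=; rewrite linearD. Qed.
Let one_neq0 : bop_id H != 0.
Proof.
have [x x0] := hilbert_nonzero (s := H); apply/eqP => e.
by move/eqP: x0; apply; have := congr1 (fun T : bop H H => T x) e.
Qed.

HB.instance Definition _ :=
  GRing.Zmodule_isNzRing.Build (bop H H) mulA mul1 mulr1 mulDl mulDr one_neq0.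

Let scaleAl (k : R[i]) S T : k *: (S * T) = k *: S * T.
Proof. by apply: bop_ext. Qed.
HB.instance Definition _ := GRing.Lmodule_isLalgebra.Build R[i] (bop H H) scaleAl.

Let scaleAr (k : R[i]) S T : k *: (S * T) = S * (k *: T).
Proof. by apply: bop_ext => x /=; rewrite linearZ. Qed.
HB.instance Definition _ := GRing.Lalgebra_isAlgebra.Build R[i] (bop H H) scaleAr.

Let adjK S : adjoint (adjoint S) = S.
Proof. exact: bop_ext. Qed.
Let adjD S T : adjoint (S + T) = adjoint S + adjoint T.
Proof. exact: bop_ext. Qed.
Let adjZ (k : R[i]) S : adjoint (k *: S) = Num.conj k *: adjoint S.
Proof. exact: bop_ext. Qed.
Let adjM S T : adjoint (S * T) = adjoint T * adjoint S.
Proof. exact: bop_ext. Qed.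

HB.instance Definition _ := isStarAlgebra.Build R[i] (bop H H) adjK adjD adjZ adjM.

End Algebra.

Program Definition rank_one H K (x : K) (y : H) : bop H K :=
  @Bop R H K (fun z => <<z, y>> *: x) (fun z => <<z, x>> *: y) _ _ _.
Next Obligation.
by move=> H K x y k u v; rewrite inner_linear scalerDl scalerA.
Qed.
Next Obligation.
move=> H K x y; exists (`|x| * `|y|) => z; rewrite normrZ mulrC -mulrA.
by rewrite ler_wpM2l// mulrC cauchy_schwarz.
Qed.
Next Obligation.
by move=> H K x y u v /=; rewrite innerZl innerZr -inner_conj mulrC.
Qed.

Definition unitary_op H K (U : bop H K) : Prop :=
  bop_comp (adjoint U) U = bop_id H /\ bop_comp U (adjoint U) = bop_id K.

Definition opnorm_le H K (T : bop H K) (c : R[i]) : Prop :=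
  forall x, `|T x| <= c * `|x|.

End BopTheory.

Notation "''B(' H )" := (bop H H) (at level 0, format "''B(' H )") : type_scope.

Section OperatorAlgebras.
Variables (R : realType) (H : hilbertType R).
Implicit Types (B M G S : set 'B(H)) (T : 'B(H)).

Definition cstar_subalgebra B : Prop :=
  star_subalgebra B /\
  forall T, (forall eps : R[i], 0 < eps -> exists2 X, B X & opnorm_le (T - X) eps) ->
    B T.

Definition cstar_gen G : set 'B(H) :=
  [set T | forall B, cstar_subalgebra B -> G `<=` B -> B T].

Definition sot_closure S : set 'B(H) :=
  [set T | forall (xs : seq H) (eps : R[i]), 0 < eps ->
     exists2 X, S X & forall x, x \in xs -> `|T x - X x| < eps].

Definition von_neumann_algebra M : Prop :=
  star_subalgebra M /\ bicommutant M = M.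

Definition factor M : Prop :=
  von_neumann_algebra M /\
  forall z, M z -> commutant M z -> exists c : R[i], z = c *: 1.

(* Finiteness of the identity projection of M. *)
Definition finite_vna M : Prop :=
  forall v, M v -> star v * v = 1 -> v * star v = 1.

Definition abelian_projection M (p : 'B(H)) : Prop :=
  [/\ M p, is_projection p &
      forall x y, M x -> M y -> (p * x * p) * (p * y * p) = (p * y * p) * (p * x * p)].

(* Murray-von Neumann type: a finite factor without nonzero abelian
   projections. *)
Definition II1_factor M : Prop :=
  [/\ factor M, finite_vna M & forall p, abelian_projection M p -> p = 0].

Definition hyperfinite M : Prop :=
  exists N : nat -> set 'B(H),
    [/\ forall n, star_subalgebra (N n) /\ finite_dimensional (N n),
        forall n, N n `<=` N n.+1
      & M = bicommutant (\bigcup_n N n)].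

End OperatorAlgebras.

Section GeneratedAlgebra.
Variables (R : realType) (H : hilbertType R) (G : set 'B(H)).

Lemma cstar_gen_star_subalgebra : star_subalgebra (cstar_gen G).
Proof.
split.
- by move=> B [[? ? ? ?] _] _.
- by move=> k x y Bx By B hB GB; case: (hB) => [[_ h _ _] _]; apply: h;
    [apply: Bx | apply: By].
- by move=> x y Bx By B hB GB; case: (hB) => [[_ _ h _] _]; apply: h;
    [apply: Bx | apply: By].
- by move=> x Bx B hB GB; case: (hB) => [[_ _ _ h] _]; apply: h; apply: Bx.
Qed.

Definition cstar_gen_pred : {pred 'B(H)} := fun T => `[< cstar_gen G T >].

Let gen_subalg : GRing.subalg_closed cstar_gen_pred.
Proof.
have [g1 gD gM _] := cstar_gen_star_subalgebra.
split; first exact/asboolP.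
- by move=> k x y /asboolP gx /asboolP gy; apply/asboolP; apply: gD.
- by move=> x y /asboolP gx /asboolP gy; apply/asboolP; apply: gM.
Qed.

HB.instance Definition _ := GRing.isSubalgClosed.Build R[i] 'B(H) cstar_gen_pred gen_subalg.

Record cstar_alg := CstarAlg {
  cstar_val :> 'B(H);
  cstar_valP : cstar_val \in cstar_gen_pred
}.

HB.instance Definition _ := [isSub for cstar_val].
HB.instance Definition _ := [Choice of cstar_alg by <:].
HB.instance Definition _ := [SubChoice_isSubAlgebra of cstar_alg by <:].

Let gen_star (x : cstar_alg) : star (cstar_val x) \in cstar_gen_pred.
Proof.
have [_ _ _ h] := cstar_gen_star_subalgebra.
by apply/asboolP; apply: h; apply/asboolP; exact: cstar_valP.
Qed.

Definition cstar_alg_star (x : cstar_alg) : cstar_alg := CstarAlg (gen_star x).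

Let gstarK x : cstar_alg_star (cstar_alg_star x) = x.
Proof. by apply: val_inj; exact: starK. Qed.
Let gstarD x y : cstar_alg_star (x + y) = cstar_alg_star x + cstar_alg_star y.
Proof. by apply: val_inj; exact: starD. Qed.
Let gstarZ (k : R[i]) x : cstar_alg_star (k *: x) = Num.conj k *: cstar_alg_star x.
Proof. by apply: val_inj; exact: starZ. Qed.
Let gstarM x y : cstar_alg_star (x * y) = cstar_alg_star y * cstar_alg_star x.
Proof. by apply: val_inj; exact: starM. Qed.

HB.instance Definition _ :=
  isStarAlgebra.Build R[i] cstar_alg gstarK gstarD gstarZ gstarM.

End GeneratedAlgebra.

Section Representations.
Variables (R : realType) (A : starAlgType R[i]).

Definition closed_subspace (H : hilbertType R) (V : set H) : Prop :=
  [/\ V 0, forall (k : R[i]) x y, V x -> V y -> V (k *: x + y) & closed V].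

Definition irreducible_rep (H : hilbertType R) (pi : A -> 'B(H)) : Prop :=
  star_hom pi /\
  forall V : set H, closed_subspace V -> (forall a x, V x -> V (pi a x)) ->
    V = [set 0] \/ V = setT.

Definition unitarily_equivalent (H K : hilbertType R)
    (pi : A -> 'B(H)) (sigma : A -> 'B(K)) : Prop :=
  exists U : bop H K, unitary_op U /\
    forall a, bop_comp U (pi a) = bop_comp (sigma a) U.

Definition gns_triple (phi : A -> R[i]) (H : hilbertType R)
    (pi : A -> 'B(H)) (xi : H) : Prop :=
  [/\ star_hom pi, dense (range (fun a => pi a xi))
    & forall a, phi a = <<pi a xi, xi>>].

End Representations.

(* H is the Hilbert space direct sum of the H_i along the inclusions inc_i. *)
Definition hilbert_direct_sum (R : realType) (I : Type) (H_ : I -> hilbertType R)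
    (H : hilbertType R) (inc : forall i, bop (H_ i) H) : Prop :=
  [/\ forall i x y, <<inc i x, inc i y>> = <<x, y>>,
      forall i k, i <> k -> forall x y, <<inc i x, inc k y>> = 0
    & forall V : set H, closed_subspace V -> (forall i x, V (inc i x)) -> V = setT].

Fixpoint car_dim (n : nat) : nat := (if n is m.+1 then car_dim m * 2 else 1)%N.

(* a 0 (x) a 1 (x) ... (x) a (n - 1) in M_2 (x) ... (x) M_2 *)
Fixpoint tens_mx (K : numClosedFieldType) (a : nat -> 'M[K]_2) (n : nat) :
    'M[K]_(car_dim n) :=
  if n is m.+1 return 'M[K]_(car_dim n) then tens_mx a m *t a m else 1%:M.

Section CAR.
Variables (R : realType) (C : cstarAlgType R[i]).
Variable (iota : forall n, 'M[R[i]]_(car_dim n) -> C).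

(* C is the completed union of the C_n = M_2 (x) ... (x) M_2, where iota n is
   the inclusion of C_n. *)
Definition is_CAR : Prop :=
  [/\ forall n,
        [/\ linear (@iota n), injective (@iota n), @iota n 1%:M = 1,
            forall a b : 'M[R[i]]_(car_dim n), iota (a *m b) = iota a * iota b
          & forall a : 'M[R[i]]_(car_dim n),
            iota (map_mx Num.conj a)^T = star (iota a)],
      forall n (a : 'M[R[i]]_(car_dim n)),
        @iota n.+1 (a *t (1%:M : 'M[R[i]]_2)) = iota a
    & forall (x : C) (eps : R[i]), 0 < eps ->
        exists n (a : 'M[R[i]]_(car_dim n)), cnorm (x - iota a) < eps].

Definition is_trace_state (tau : C -> R[i]) : Prop :=
  is_state tau /\
  forall n (a : 'M[R[i]]_(car_dim n)), tau (iota a) = (2 ^+ n)^-1 * \tr a.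

(* The product of the vector states a |-> a_00 on M_2. *)
Definition is_corner_state (phi : C -> R[i]) : Prop :=
  is_state phi /\
  forall (a : nat -> 'M[R[i]]_2) n,
    phi (iota (tens_mx a n)) = \prod_(k < n) a k 0 0.

Definition corner_proj (n : nat) : C :=
  iota (tens_mx (fun=> delta_mx 0 0) n).

End CAR.

Section AsymptoticallyInner.
Variables (R : realType) (C : cstarAlgType R[i]).

Definition asymptotically_inner (alpha : C -> C) : Prop :=
  exists u : R -> C,
    [/\ forall t, 0 <= t -> is_unitary (u t),
        u 0 = 1,
        forall t, 0 <= t -> forall eps : R[i], 0 < eps -> exists2 d : R, 0 < d &
          forall s, 0 <= s -> `|s - t| < d -> cnorm (u s - u t) < eps
      & forall a (eps : R[i]), 0 < eps -> exists2 M : R, 0 <= M &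
          forall t, M <= t -> cnorm (alpha a - u t * a * star (u t)) < eps].

End AsymptoticallyInner.

(* Main.v *)
From HB Require Import structures.
From mathcomp Require Import all_boot all_order all_algebra.
From mathcomp Require Import complex mxtens ring.
From mathcomp Require spectral.
From mathcomp Require Import all_classical all_reals all_analysis.
Require Import Defs.

Set Implicit Arguments.
Unset Strict Implicit.
Unset Printing Implicit Defensive.

Import Order.TTheory GRing.Theory Num.Theory.
Import numFieldNormedType.Exports.

Local Open Scope classical_set_scope.
Local Open Scope complex_scope.
Local Open Scope ring_scope.

(** The algebra A contains, besides the CAR algebra C, the unitaries L i.  The
    point is that the tracial representation sees each L i as a strong limit of
    elements of C, although L i differs from the corresponding limit S i by a
    rank-one operator in the representation that defines A.

    The bicommutant of C in the tracial representation is treated by hand.  Right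
    multiplications lie in the commutant, so that the cyclic vector is tracial
    and separating for the bicommutant; this gives finiteness.  A central element
    induces a trace on every matrix algebra and is therefore scalar.  An abelian
    projection almost commutes with two anticommuting symmetries far out in the
    tensor product, which forces it to vanish.  Hyperfiniteness is built into C.
    Strong density of C holds because the conditional expectations of an operator
    onto the matrix algebras are uniformly bounded, by positivity of a matrix
    (positive_mx_factor), and converge in trace norm (vn_bounded_approx).

    The image of A lies in this factor.  One has L i * Pi (1 - p) = Pi (s) for the
    n-th projection p of the i-th sequence and the n-th partial sum s of w i.
    Since L i is unitary, the error L i * Pi (p) has trace norm equal to that of
    p, which is 2 ^ (- n / 2), so that the partial sums converge strongly to the
    image of L i (Theta_L_limit).

    The representation is isometric.  The normalized vectors eta n obtained from
    the corner projections q n induce states that converge to the corner state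
    on C, by excision.  The word b * star (L k) applied to eta n, for large n,
    has the same inner products as the vector Pi b (zeta k) of the representation
    space of A: for two different indices k this rests on the inequivalence of
    the irreducible representations, which makes the projections of one state
    tend to zero in the representation of another.  The closed linear span of
    these correspondences (pair_span) is stable under the generators, because
    L i agrees with an element of C off the line of zeta i and acts in the same
    way on both sides along that line (pair_map_off_line).  Norms of vectors a x
    are thus limits of norms of image vectors, and the norm of a is at most that
    of its image (pair_map_opnorm).  Injectivity and closedness of the range
    follow, and the remaining claims hold because C and its bicommutant enclose
    the image. *)

(** * Limits of sequences and bounded operators *)

Lemma subrACA (V : zmodType) (a b c d : V) :
  (a - b) - (c - d) = (a - c) - (b - d).
Proof. by rewrite !opprD; exact: addrACA. Qed.

Section Limits.
Variable R : realType.
Implicit Types V W : normedZmodType R[i].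

(** Convergence in norm in an elementary form, used alike for vectors and for
    their inner products, where the limit is a scalar. *)
Definition tends V (u : nat -> V) (l : V) : Prop :=
  forall e : R[i], 0 < e -> exists N, forall n, (N <= n)%N -> `|u n - l| <= e.

Lemma expV2_small (e : R[i]) : 0 < e ->
  exists N, forall n, (N <= n)%N -> (2 ^+ n)^-1 <= e.
Proof.
case: e => x y; rewrite ltcE /= => /andP[/eqP -> x0].
exists (Num.bound x^-1) => n /upper_nthrootP h.
rewrite -(rmorph1 (real_complex R)) -(rmorphMn (real_complex R) 2) -rmorphXn.
by rewrite -fmorphV /= lecR invf_ple ?posrE ?exprn_gt0// ltW.
Qed.

Lemma tends_cst V (x : V) : tends (fun=> x) x.
Proof. by move=> e e0; exists 0%N => n _; rewrite subrr normr0 ltW. Qed.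

Lemma tends_eventually V (u v : nat -> V) l :
  (exists N, forall n, (N <= n)%N -> u n = v n) -> tends v l -> tends u l.
Proof.
move=> [N uv] vl e /vl[M MP]; exists (maxn N M) => n.
by rewrite geq_max => /andP[? ?]; rewrite uv// MP.
Qed.

Lemma eq_tends V (u v : nat -> V) l : u =1 v -> tends v l -> tends u l.
Proof. by move=> uv; apply: tends_eventually; exists 0%N. Qed.

Lemma tends_dom V W (u : nat -> V) l (v : nat -> W) m (c : R[i]) : 0 <= c ->
  (exists N, forall n, (N <= n)%N -> `|u n - l| <= c * `|v n - m|) ->
  tends v m -> tends u l.
Proof.
move=> c0 [N h] vm e e0.
have c1 : 0 < c + 1 by rewrite ltr_wpDl.
have [M MP] := vm (e / (c + 1)) (divr_gt0 e0 c1).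
exists (maxn N M) => n; rewrite geq_max => /andP[nN nM].
apply: le_trans (h n nN) _; apply: le_trans (_ : (c + 1) * `|v n - m| <= _).
  by rewrite ler_wpM2r// lerDl.
by rewrite -ler_pdivlMl// mulrC MP.
Qed.

Lemma tends_approx V (u : nat -> V) l :
  (forall e : R[i], 0 < e -> exists v m, [/\ tends v m, `|m - l| <= e
     & exists N, forall n, (N <= n)%N -> `|u n - v n| <= e]) -> tends u l.
Proof.
move=> h e e0; have e3 : 0 < e / 3 by rewrite divr_gt0.
have [v [m [vm ml [N uv]]]] := h _ e3.
have [M MP] := vm _ e3; exists (maxn N M) => n.
rewrite geq_max => /andP[nN nM].
have -> : u n - l = (u n - v n) + (v n - m) + (m - l) by rewrite -addrA !subrKA.
have -> : e = e / 3 + e / 3 + e / 3 by field.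
by rewrite !(le_trans (ler_normD _ _)) ?lerD ?uv ?MP// (le_trans (ler_normD _ _))
  ?lerD ?uv ?MP.
Qed.

Lemma tendsD V (u v : nat -> V) l m :
  tends u l -> tends v m -> tends (fun n => u n + v n) (l + m).
Proof.
move=> ul vm e e0; have e2 : 0 < e / 2 by rewrite divr_gt0.
have [N NP] := ul _ e2; have [M MP] := vm _ e2; exists (maxn N M) => n.
rewrite geq_max => /andP[nN nM]; rewrite opprD addrACA (splitr e).
by rewrite (le_trans (ler_normD _ _))// lerD ?NP ?MP.
Qed.

Lemma tendsN V (u : nat -> V) l : tends u l -> tends (fun n => - u n) (- l).
Proof.
move=> ul e /ul[N NP]; exists N => n /NP.
by rewrite -opprD normrN.
Qed.

Lemma tendsB V (u v : nat -> V) l m :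
  tends u l -> tends v m -> tends (fun n => u n - v n) (l - m).
Proof. by move=> ul vm; apply: tendsD => //; apply: tendsN. Qed.

Lemma tends_norm V (u : nat -> V) l : tends u l -> tends (fun n => `|u n|) `|l|.
Proof.
move=> ul e /ul[N NP]; exists N => n /NP; apply: le_trans.
exact: ler_dist_dist.
Qed.

Lemma tends_unique V (u : nat -> V) l m : tends u l -> tends u m -> l = m.
Proof.
move=> ul um; apply/eqP; rewrite -subr_eq0 -normr_eq0; apply: contraT => lm.
have e0 : 0 < `|l - m| / 4 by rewrite divr_gt0// lt0r lm normr_ge0.
have [N NP] := ul _ e0; have [M MP] := um _ e0.
have := ler_normD (u (maxn N M) - m) (l - u (maxn N M)).
rewrite [X in `|X|]addrC subrKA distrC [X in _ <= _ + X]distrC.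
move/le_trans => /(_ _ (lerD (MP _ (leq_maxr _ _)) (NP _ (leq_maxl _ _)))).
rewrite distrC; set d := `|_|.
have -> : d / 4 + d / 4 = d / 2 by field.
rewrite ler_pdivlMr// ger_pMr ?lt0r ?lm ?normr_ge0//.
by rewrite -[X in _ <= X]/(1%:R) ler_nat.
Qed.

Lemma tends_norm_le V (u : nat -> V) l (c : R[i]) :
  tends u l -> (exists N, forall n, (N <= n)%N -> `|u n| <= c) -> `|l| <= c.
Proof.
move=> ul [N NP]; apply/ler_addgt0Pl => e e0; have [M MP] := ul _ e0.
set n := maxn N M; rewrite -[l](subKr (u n)) opprB addrC.
apply: le_trans (ler_normD _ _) _.
by rewrite lerD// ?NP ?leq_maxl// distrC MP ?leq_maxr.
Qed.

Lemma tends_bounded V (u : nat -> V) l : tends u l ->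
  exists2 c : R[i], 0 <= c & exists N, forall n, (N <= n)%N -> `|u n| <= c.
Proof.
move=> ul; have [N NP] := ul 1 ltr01; exists (1 + `|l|); first by rewrite addr_ge0.
exists N => n /NP h; rewrite -[u n](subrK l).
by apply: le_trans (ler_normD _ _) _; rewrite lerD2r.
Qed.

Lemma tends_expV2 : tends (fun n => (2 ^+ n)^-1 : R[i]) 0.
Proof.
move=> e /expV2_small[N NP]; exists N => n /NP.
by rewrite subr0 ger0_norm// invr_ge0 exprn_ge0.
Qed.

Lemma tends_le (u v : nat -> R[i]) l m : tends u l -> tends v m ->
  l \is Num.real -> m \is Num.real ->
  (exists N, forall n, (N <= n)%N -> u n <= v n) -> l <= m.
Proof.
move=> ul vm lr mr [N uv]; rewrite -subr_ge0.
have [//|neg] := real_ge0P (rpredB mr lr).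
have e0 : 0 < (l - m) / 4 by rewrite divr_gt0// -opprB oppr_gt0.
have [N1 P1] := ul _ e0; have [N2 P2] := vm _ e0.
pose n := maxn N (maxn N1 N2).
have {}uv : 0 <= v n - u n by rewrite subr_ge0 uv// leq_maxl.
have {}P1 : `|u n - l| <= (l - m) / 4.
  by apply: P1; rewrite (leq_trans _ (leq_maxr _ _))// leq_maxl.
have {}P2 : `|v n - m| <= (l - m) / 4.
  by apply: P2; rewrite (leq_trans _ (leq_maxr _ _))// leq_maxr.
have : `|(v n - u n) + (l - m)| <= (l - m) / 2.
  rewrite (_ : _ + _ = (v n - m) - (u n - l)); last by ring.
  rewrite (le_trans (ler_normB _ _))// (_ : _ / 2 = (l - m) / 4 + (l - m) / 4).
    by rewrite lerD.
  by field.
have lm0 : 0 < l - m by rewrite -opprB oppr_gt0.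
rewrite ger0_norm; last exact: addr_ge0 uv (ltW lm0).
have : l - m <= v n - u n + (l - m) by rewrite lerDr.
move=> /le_trans h /h.
by rewrite ler_pdivlMr// ger_pMr// -[X in _ <= X]/(1%:R) ler_nat.
Qed.

End Limits.

Section HilbertLimits.
Variable R : realType.
Implicit Types H K : hilbertType R.

Lemma bopN H K (T : bop H K) x : (- T) x = - T x.
Proof. by rewrite /= scaleN1r. Qed.

Lemma bopB H K (S T : bop H K) x : (S - T) x = S x - T x.
Proof. by rewrite /= scaleN1r. Qed.

Lemma bopM H (S T : 'B(H)) x : (S * T) x = S (T x).
Proof. by []. Qed.

Lemma bop_subZ H K (T : bop H K) (k : R[i]) x y :
  T (x - k *: y) = T x - k *: T y.
Proof.
have -> : x - k *: y = (- k) *: y + x by rewrite scaleNr addrC.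
by rewrite linearP /= scaleNr addrC.
Qed.

Lemma tendsZ H (k : R[i]) (u : nat -> H) l :
  tends u l -> tends (fun n => k *: u n) (k *: l).
Proof.
move=> ul; apply: (tends_dom (normr_ge0 k) _ ul); exists 0%N => n _.
by rewrite -scalerBr normrZ.
Qed.

Lemma tends_bop H K (T : bop H K) (u : nat -> H) l :
  tends u l -> tends (fun n => T (u n)) (T l).
Proof.
move=> ul; have [c c0 cP] := bop_boundP T; apply: (tends_dom c0 _ ul).
by exists 0%N => n _; rewrite -linearB; exact: cP.
Qed.

Lemma innerBl H (x y z : H) : <<x - y, z>> = <<x, z>> - <<y, z>>.
Proof. by rewrite innerDl innerNl. Qed.

Lemma innerBr H (x y z : H) : <<z, x - y>> = <<z, x>> - <<z, y>>.
Proof. by rewrite innerDr innerNr. Qed.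

Lemma inner0r H (z : H) : <<z, 0>> = 0.
Proof. by rewrite inner_conj inner0l rmorph0. Qed.

Lemma tends_inner H (u v : nat -> H) x y :
  tends u x -> tends v y -> tends (fun n => <<u n, v n>>) <<x, y>>.
Proof.
move=> ux vy; have [c c0 [N NP]] := tends_bounded ux.
apply: tends_approx => e e0.
exists (fun n => <<u n, y>>), <<x, y>>; split.
- apply: (tends_dom (normr_ge0 y) _ ux); exists 0%N => n _.
  by rewrite -innerBl mulrC cauchy_schwarz.
- by rewrite subrr normr0 ltW.
have c1 : 0 < c + 1 by rewrite ltr_wpDl.
have [M MP] := vy _ (divr_gt0 e0 c1).
exists (maxn N M) => n; rewrite geq_max => /andP[nN nM].
rewrite -innerBr; apply: le_trans (cauchy_schwarz _ _) _.
apply: le_trans (_ : (c + 1) * (e / (c + 1)) <= _); last first.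
  by rewrite mulrC divfK// gt_eqF.
rewrite ler_pM ?MP//; apply: le_trans (NP _ nN) _; by rewrite lerDl.
Qed.

Lemma cvg_tends H (u : nat -> H) l : u n @[n --> \oo] --> l <-> tends u l.
Proof.
rewrite cvgrPdist_le; split=> ul e e0.
  have [N _ NP] := ul e e0; exists N => n Nn; rewrite distrC; exact: NP.
have [N NP] := ul e e0; exists N => // n Nn /=; rewrite distrC; exact: NP.
Qed.

Lemma cauchy_tends H (u : nat -> H) :
  (forall e : R[i], 0 < e -> exists N, forall m n, (N <= m)%N -> (N <= n)%N ->
     `|u m - u n| <= e) -> exists l, tends u l.
Proof.
move=> uc; suff /cvg_ex[l ul] : cvg (u n @[n --> \oo]).
  by exists l; apply/cvg_tends.
apply/cauchy_cvgP/cauchy_exP => e e0.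
have e2 : 0 < e / 2 by rewrite divr_gt0.
have [N NP] := uc _ e2; exists (u N); exists N => // n /= Nn.
rewrite -ball_normE /=; apply: le_lt_trans (NP N n (leqnn _) Nn) _.
by rewrite ltr_pdivrMr// ltr_pMr// -[X in X < _]/(1%:R) ltr_nat.
Qed.

Lemma closureP H (V : set H) x : closure V x <->
  forall e : R[i], 0 < e -> exists2 y, V y & `|x - y| < e.
Proof.
split=> [cV e e0|h B].
  have [y [Vy]] := cV _ (nbhsx_ballx x e e0).
  by rewrite -ball_normE /=; exists y.
rewrite -nbhs_ballE => -[e /= e0 eB]; have [y Vy xy] := h e e0.
by exists y; split => //; apply: eB; rewrite -ball_normE.
Qed.

Lemma closedP H (V : set H) : closed V <->
  forall x, (forall e : R[i], 0 < e -> exists2 y, V y & `|x - y| < e) -> V x.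
Proof.
split=> [cV x h|h x cVx]; first by apply: cV; apply/closureP.
by apply: h; apply/closureP.
Qed.

Lemma closed_tends H (V : set H) (u : nat -> H) l :
  closed V -> (forall n, V (u n)) -> tends u l -> V l.
Proof.
move=> /closedP cV Vu ul; apply: cV => e e0.
have e2 : 0 < e / 2 by rewrite divr_gt0.
have [N NP] := ul _ e2; exists (u N) => //; rewrite distrC.
apply: le_lt_trans (NP N (leqnn _)) _.
by rewrite ltr_pdivrMr// ltr_pMr// -[X in X < _]/(1%:R) ltr_nat.
Qed.

Lemma denseP H (V : set H) : dense V <->
  forall x (e : R[i]), 0 < e -> exists2 y, V y & `|x - y| < e.
Proof.
split=> [dV x e e0|h O [x Ox] oO].
  have [|y []] := dV (ball x e) _ (ball_open x e).
    by exists x; exact: ballxx.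
  by rewrite -ball_normE /=; exists y.
have : nbhs x O by exact: open_nbhs_nbhs.
rewrite -nbhs_ballE => -[e /= e0 eB]; have [y Vy xy] := h x e e0.
by exists y; split => //; apply: eB; rewrite -ball_normE.
Qed.

(** Uniform boundedness makes the set of convergence of a sequence of maps a
    closed subspace, so strong convergence may be tested on a dense set. *)
Lemma tends_closure H K (u : nat -> bop H K) (v : bop H K) (c : R[i])
    (V : set H) (x : H) : 0 <= c ->
  (forall n, opnorm_le (u n) c) -> opnorm_le v c ->
  (forall y, V y -> tends (fun n => u n y) (v y)) ->
  (forall e : R[i], 0 < e -> exists2 y, V y & `|x - y| < e) ->
  tends (fun n => u n x) (v x).
Proof.
move=> c0 uc vc h cx; apply: tends_approx => e e0.
have c1 : 0 < c + 1 by rewrite ltr_wpDl.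
have [y Vy xy] := cx _ (divr_gt0 e0 c1).
have bd : c * `|x - y| <= e.
  apply: le_trans (_ : (c + 1) * `|x - y| <= _).
    by rewrite ler_wpM2r// lerDl.
  by rewrite -ler_pdivlMl// mulrC ltW.
exists (fun n => u n y), (v y); split; first exact: h.
  by rewrite -linearB /=; apply: le_trans bd; rewrite distrC; exact: vc.
by exists 0%N => n _; rewrite -linearB /=; apply: le_trans bd; exact: uc.
Qed.

Lemma opnorm_ler H K (T : bop H K) (c d : R[i]) :
  c <= d -> opnorm_le T c -> opnorm_le T d.
Proof. by move=> cd Tc x; apply: le_trans (Tc x) _; rewrite ler_wpM2r. Qed.

Lemma bop_eq_dense H K (S T : bop H K) (V : set H) : dense V ->
  (forall x, V x -> S x = T x) -> S = T.
Proof.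
move=> /denseP dV ST; apply: bop_ext => x.
have [c c0 cP] := bop_boundP (S - T).
apply/eqP; rewrite -subr_eq0 -normr_eq0 eq_le normr_ge0 andbT.
apply/ler_addgt0Pl => e e0; rewrite addr0.
have c1 : 0 < c + 1 by rewrite ltr_wpDl.
have [y Vy xy] := dV x _ (divr_gt0 e0 c1).
have -> : S x - T x = (S - T) (x - y).
  have -> : (S - T) (x - y) = (S - T) x - (S - T) y by exact: linearB.
  by rewrite !bopB (ST y Vy) subrr subr0.
apply: le_trans (cP _) _; apply: le_trans (_ : (c + 1) * `|x - y| <= _).
  by rewrite ler_wpM2r// lerDl.
by rewrite -ler_pdivlMl// mulrC ltW.
Qed.

End HilbertLimits.

(** * Square roots, and automatic continuity of representations *)

Section OperatorNorm.
Variable R : realType.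
Implicit Types H K L : hilbertType R.

Lemma opnorm_le_ge0 H K (T : bop H K) (c : R[i]) : opnorm_le T c -> 0 <= c.
Proof.
move=> Tc; have [x x0] := hilbert_nonzero (s := H).
by rewrite -(pmulr_lge0 _ (_ : 0 < `|x|)) ?normr_gt0//; apply: le_trans (Tc x).
Qed.

Lemma opnorm_leD H K (S T : bop H K) (c d : R[i]) :
  opnorm_le S c -> opnorm_le T d -> opnorm_le (S + T) (c + d).
Proof.
move=> Sc Td x; rewrite mulrDl; apply: le_trans (ler_normD _ _) _.
exact: lerD.
Qed.

Lemma opnorm_leZ H K (k : R[i]) (T : bop H K) (c : R[i]) :
  opnorm_le T c -> opnorm_le (k *: T) (`|k| * c).
Proof. by move=> Tc x; rewrite normrZ -mulrA ler_wpM2l. Qed.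

Lemma opnorm_leM H (S T : 'B(H)) (c d : R[i]) :
  opnorm_le S c -> opnorm_le T d -> opnorm_le (S * T) (c * d).
Proof.
move=> Sc Td x; apply: le_trans (Sc _) _.
by rewrite -mulrA ler_wpM2l// (opnorm_le_ge0 Sc).
Qed.

Lemma opnorm_le_adjoint H K (T : bop H K) (c : R[i]) :
  opnorm_le T c -> opnorm_le (adjoint T) c.
Proof.
move=> Tc x; have c0 := opnorm_le_ge0 Tc.
have [->|x0] := eqVneq (adjoint T x) 0; first by rewrite normr0 mulr_ge0.
rewrite -(ler_pM2r (_ : 0 < `|adjoint T x|)) ?normr_gt0// -expr2.
rewrite -inner_norm -[X in X <= _]bop_adjP.
have -> : <<T (adjoint T x), x>> = `|<<T (adjoint T x), x>>|.
  by rewrite bop_adjP inner_norm ger0_norm// exprn_ge0.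
apply: le_trans (cauchy_schwarz _ _) _; rewrite mulrAC ler_wpM2r//.
Qed.

Lemma normE H (x : H) : `|x| ^+ 2 = <<x, x>>.
Proof. by rewrite inner_norm. Qed.

Lemma inner_ge0 H (x : H) : 0 <= <<x, x>>.
Proof. by rewrite inner_norm exprn_ge0. Qed.

Lemma norm_le_sqr H K (x : H) (y : K) (c : R[i]) : 0 <= c ->
  (`|x| <= c * `|y|) = (<<x, x>> <= c ^+ 2 * <<y, y>>).
Proof.
move=> c0; rewrite !inner_norm -exprMn ler_pXn2r ?nnegrE ?mulr_ge0//.
Qed.

(** The limit of a norm-Cauchy sequence of operators exists pointwise; the
    adjoints form a Cauchy sequence as well, and their limit is its adjoint. *)
Lemma bop_complete H K (u : nat -> bop H K) :
  (forall e : R[i], 0 < e -> exists N, forall m n, (N <= m)%N -> (N <= n)%N ->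
     opnorm_le (u m - u n) e) ->
  exists T : bop H K, forall e : R[i], 0 < e -> exists N, forall n, (N <= n)%N ->
     opnorm_le (u n - T) e.
Proof.
move=> uc.
have ptw (E F : hilbertType R) (v : nat -> bop E F) :
    (forall e : R[i], 0 < e -> exists N, forall m n, (N <= m)%N -> (N <= n)%N ->
      opnorm_le (v m - v n) e) -> forall x, exists l, tends (fun n => v n x) l.
  move=> vc x; apply: cauchy_tends => e e0.
  have x1 : 0 < `|x| + 1 by rewrite ltr_wpDl.
  have [N NP] := vc _ (divr_gt0 e0 x1); exists N => m n Nm Nn.
  have := NP m n Nm Nn x; rewrite /= scaleN1r => /le_trans -> //.
  by rewrite mulrAC ler_pdivrMr// ler_wpM2l ?ltW// ltrDl.
have auc (e : R[i]) : 0 < e -> exists N, forall m n, (N <= m)%N -> (N <= n)%N ->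
     opnorm_le (adjoint (u m) - adjoint (u n)) e.
  move=> /uc[N NP]; exists N => m n Nm Nn.
  rewrite (_ : _ - _ = adjoint (u m - u n)); first exact/opnorm_le_adjoint/NP.
  by apply: bop_ext => x /=; rewrite rmorphN1.
have [f fP] := choice (ptw _ _ _ uc).
have [g gP] := choice (ptw _ _ _ auc).
have f_lin : linear f.
  move=> k x y; apply: tends_unique (fP _) _.
  apply: (@eq_tends _ _ _ (fun n => k *: u n x + u n y)).
    by move=> n; rewrite linearP.
  by apply: tendsD => //; exact: tendsZ.
have near (e : R[i]) : 0 < e -> exists N, forall n, (N <= n)%N -> forall x,
    `|u n x - f x| <= e * `|x|.
  move=> e0; have [N NP] := uc _ e0; exists N => n Nn x.
  apply: (@tends_norm_le _ _ (fun m => u n x - u m x)).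
    by apply: tendsB => //; exact: tends_cst.
  by exists N => m Nm; have := NP n m Nn Nm x; rewrite /= scaleN1r.
have f_bd : exists c : R[i], forall x, `|f x| <= c * `|x|.
  have [N NP] := near 1 ltr01; have [c c0 cP] := bop_boundP (u N).
  exists (c + 1) => x; rewrite -[f x](subKr (u N x)) mulrDl.
  apply: le_trans (ler_normB _ _) _; rewrite lerD//.
  exact: NP.
have f_adj x y : <<f x, y>> = <<x, g y>>.
  apply: (@tends_unique _ _ (fun n => <<u n x, y>>)).
    by apply: tends_inner => //; exact: tends_cst.
  apply: (@eq_tends _ _ _ (fun n => <<x, adjoint (u n) y>>)).
    by move=> n; rewrite bop_adjP.
  by apply: tends_inner => //; exact: tends_cst.
exists (Bop f_lin f_bd f_adj) => e /near[N NP]; exists N => n Nn x.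
by rewrite /= scaleN1r; exact: NP.
Qed.

End OperatorNorm.

(** A norm presented by its upper bounds: the norm of a C*-algebra and the
    operator norm on a concrete algebra of operators are both of this form. *)
Record star_normed (R : realType) (A : starAlgType R[i])
    (nle : A -> R[i] -> Prop) : Prop := {
  nle_le : forall x a b, a <= b -> nle x a -> nle x b;
  nle_bd : forall x, exists2 c, 0 <= c & nle x c;
  nle_eq0 : forall x, (forall e, 0 < e -> nle x e) -> x = 0;
  nleD : forall x y a b, nle x a -> nle y b -> nle (x + y) (a + b);
  nleZ : forall k x a, nle x a -> nle (k *: x) (`|k| * a);
  nleM : forall x y a b, 0 <= a -> 0 <= b -> nle x a -> nle y b ->
    nle (x * y) (a * b);
  nle_star : forall x a, nle x a -> nle (star x) a;
  nle_complete : forall u : nat -> A,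
    (forall e, 0 < e -> exists N, forall m n, (N <= m)%N -> (N <= n)%N ->
       nle (u m - u n) e) ->
    exists l, forall e, 0 < e -> exists N, forall n, (N <= n)%N -> nle (u n - l) e
}.

Section StarNormed.
Variables (R : realType) (A : starAlgType R[i]) (nle : A -> R[i] -> Prop).
Hypothesis nleP : star_normed nle.

Lemma star0 : star (0 : A) = 0.
Proof. by have := starZ 0 (0 : A); rewrite rmorph0 !scale0r. Qed.

Lemma starN (x : A) : star (- x) = - star x.
Proof. by rewrite -scaleN1r starZ rmorphN1 scaleN1r. Qed.

Lemma starB (x y : A) : star (x - y) = star x - star y.
Proof. by rewrite starD starN. Qed.

Lemma star1 : star (1 : A) = 1.
Proof. by rewrite -[LHS]mulr1 -[X in _ * X]starK -starM mulr1 starK. Qed.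

Lemma nleN x a : nle x a -> nle (- x) a.
Proof. by move/(nleZ nleP (-1)); rewrite normrN1 mul1r scaleN1r. Qed.

Lemma nleB x y a b : nle x a -> nle y b -> nle (x - y) (a + b).
Proof. by move=> xa yb; apply: (nleD nleP) => //; exact: nleN. Qed.

Let half_ge0 : 0 <= 2^-1 :> R[i]. Proof. by rewrite invr_ge0. Qed.

Let sqr_diff x y (r c : R[i]) : 0 <= r -> 0 <= c -> nle x r -> nle y r ->
  nle (x - y) c -> nle (x * x - y * y) (r * c + c * r).
Proof.
move=> r0 c0 xr yr xyc.
have -> : x * x - y * y = x * (x - y) + (x - y) * y.
  by rewrite mulrBl mulrBr subrKA.
by apply: (nleD nleP); exact: (nleM nleP).
Qed.

(** The map y |-> (h + y ^ 2) / 2 contracts the ball of radius one half, and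
    its fixed point y satisfies (1 - y) ^ 2 = 1 - h. *)
Lemma sqrt_one_minus (h : A) : star h = h -> nle h (2^-1) ->
  exists b, star b * b = 1 - h.
Proof.
move=> sh h2.
pose F (y : A) := 2^-1 *: (h + y * y).
pose u n := iter n F 0.
have u0 : nle (0 : A) 0 by have := nleZ nleP 0 h2; rewrite scale0r normr0 mul0r.
have hn : `|2^-1| = 2^-1 :> R[i] by rewrite ger0_norm.
have ub n : nle (u n) (2^-1).
  elim: n => [|n IH]; first exact: (nle_le nleP) half_ge0 u0.
  apply: (@nle_le _ _ _ nleP _ (`|2^-1| * (2^-1 + 2^-1 * 2^-1))); last first.
    by apply: (nleZ nleP); apply: (nleD nleP) => //; exact: (nleM nleP).
  rewrite hn -[X in _ <= X]mulr1 ler_wpM2l// [X in _ <= X](splitr 1) mul1r lerD2l.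
  by rewrite ger_pMl ?invr_gt0// invf_le1 ?ler1n// ltr0n.
have us n : star (u n) = u n.
  elim: n => [|n IH]; first exact: star0.
  by rewrite /= starZ starD starM IH sh fmorphV rmorph_nat.
have le21 : 2^-1 <= 1 :> R[i] by rewrite invf_le1 ?ler1n// ltr0n.
have ub1 n : nle (u n) 1 by exact: (nle_le nleP) le21 (ub n).
have FB x y : F x - F y = 2^-1 *: (x * x - y * y).
  by rewrite -scalerBr opprD addrACA subrr add0r.
have ud n k : nle (u (n + k)%N - u n) ((2 ^+ n)^-1).
  elim: n k => [|n IH] k; first by rewrite add0n subr0 expr0 invr1.
  have := nleZ nleP 2^-1 (sqr_diff half_ge0 _ (ub _) (ub _) (IH k)).
  rewrite -FB hn invr_ge0 exprn_ge0// => /(_ isT); apply: (nle_le nleP).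
  by rewrite exprS invfM ler_wpM2l// [2^-1 / _]mulrC -splitr.
have [|l ul] := nle_complete nleP (u := u).
  move=> e e0; have e2 : 0 < e / 2 by rewrite divr_gt0.
  have [N NP] := expV2_small e2; exists N => m n Nm Nn.
  have aux k : (N <= k)%N -> nle (u k - u N) (e / 2).
    by move=> Nk; rewrite -(subnKC Nk); apply: (nle_le nleP) (NP _ (leqnn _)) (ud _ _).
  rewrite (splitr e) -(subrKA (u N)); apply: (nleD nleP); first exact: aux.
  by rewrite -opprB; apply: nleN; exact: aux.
have sl : star l = l.
  apply/eqP; rewrite -subr_eq0; apply/eqP/(nle_eq0 nleP) => e e0.
  have e2 : 0 < e / 2 by rewrite divr_gt0.
  have [N /(_ N (leqnn _)) NP] := ul _ e2.
  rewrite (splitr e) (_ : _ - _ = (u N - l) - star (u N - l)).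
    by apply: nleB => //; exact: (nle_star nleP).
  by rewrite starB us opprB [RHS]addrC subrKA.
have l1 : nle l 1.
  have [N /(_ N (leqnn _)) NP] := ul 2^-1 ltac:(by rewrite invr_gt0).
  rewrite -[l](subKr (u N)) (splitr 1) mul1r.
  by apply: nleB => //; exact: ub.
have fixl : F l = l.
  apply/eqP; rewrite -subr_eq0; apply/eqP/(nle_eq0 nleP) => e e0.
  have e2 : 0 < e / 2 by rewrite divr_gt0.
  have [N NP] := ul _ e2.
  rewrite (splitr e) -(subrKA (u N.+1)); apply: (nleD nleP); last exact: NP.
  have lu : nle (l - u N) (e / 2) by rewrite -opprB; apply: nleN; exact: NP.
  have := nleZ nleP 2^-1 (sqr_diff ler01 (ltW e2) l1 (ub1 N) lu).
  by rewrite -FB mul1r mulr1 -splitr hn mulrC.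
exists (1 - l); rewrite starB star1 sl mulrBl mul1r mulrBr mulr1.
have -> : h = 2 *: l - l * l by rewrite -{1}fixl scalerA divff ?pnatr_eq0// scale1r addrK.
by rewrite -addrA -opprD [l + (l - _)]addrA scaler_nat mulr2n.
Qed.

(** Since the norm bound on x makes the normalized complement of star x * x
    a square, positivity alone bounds every representation.  The constant 2
    absorbs the margin kept in the square root lemma; continuity is all that
    is used later. *)
Lemma star_hom_bounded (H : hilbertType R) (rho : A -> 'B(H)) x (c : R[i]) :
  star_hom rho -> 0 < c -> nle x c -> opnorm_le (rho x) (2 * c).
Proof.
move=> [rl r1 rM rs] c0 xc v.
have cc0 : 0 < c ^+ 2 by rewrite exprn_gt0.
pose k := (2 * c ^+ 2)^-1.
have k0 : 0 <= k by rewrite invr_ge0 mulr_ge0// ltW.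
have [||b] := @sqrt_one_minus (k *: (star x * x)).
- by rewrite starZ starM starK (_ : Num.conj k = k)//; apply/CrealP; exact: ger0_real.
- have := nleZ nleP k (nleM nleP (ltW c0) (ltW c0) (nle_star nleP xc) xc).
  apply: (nle_le nleP); rewrite ger0_norm// -expr2 /k invfM -mulrA mulVf ?mulr1//.
  by rewrite gt_eqF.
move/(congr1 (fun y => <<rho y v, v>>)).
have rlin k' y z : rho (k' *: y + z) = k' *: rho y + rho z by exact: rl.
have -> : 1 - k *: (star x * x) = (- k) *: (star x * x) + 1.
  by rewrite scaleNr addrC.
rewrite rlin r1 !rM !rs /= [LHS]bop_adjPC innerDl innerZl bop_adjPC => e.
have := inner_ge0 (rho b v); rewrite e mulNr addrC subr_ge0 /k mulrC.
rewrite ler_pdivrMr ?mulr_gt0// => h.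
rewrite norm_le_sqr; last by rewrite mulr_ge0// ltW.
rewrite exprMn; apply: le_trans h _.
rewrite mulrC ler_wpM2r ?inner_ge0// ler_wpM2r ?ltW//.
by rewrite -natrX ltr_nat.
Qed.

End StarNormed.

Section CStarNormed.
Variable R : realType.

Lemma cnorm_normed (C : cstarAlgType R[i]) :
  star_normed (fun (x : C) c => cnorm x <= c).
Proof.
have n0 : cnorm (0 : C) = 0 by rewrite -(scale0r (0 : C)) cnormZ normr0 mul0r.
have ge0 (x : C) : 0 <= cnorm x.
  have := cnormD_le x (- x); rewrite subrr n0 -scaleN1r cnormZ normrN1 mul1r.
  by rewrite -mulr2n pmulrn_lge0.
have star_le (x : C) : cnorm x <= cnorm (star x).
  have [->|x0] := eqVneq (cnorm x) 0; first exact: ge0.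
  have xp : 0 < cnorm x by rewrite lt0r x0 ge0.
  by rewrite -(ler_pM2r xp) -expr2 -cnorm_starM cnormM_le.
split.
- by move=> x a b ab xa; apply: le_trans ab.
- by move=> x; exists (cnorm x).
- move=> x h; apply: cnorm0_eq0; apply/eqP; rewrite eq_le ge0 andbT.
  by apply/ler_addgt0Pl => e /h; rewrite addr0.
- by move=> x y a b xa yb; apply: le_trans (cnormD_le _ _) _; rewrite lerD.
- by move=> k x a xa; rewrite cnormZ ler_wpM2l.
- by move=> x y a b _ _ xa yb; apply: le_trans (cnormM_le _ _) _; rewrite ler_pM.
- by move=> x a; apply: le_trans; rewrite -[X in _ <= cnorm X]starK star_le.
- move=> u uc; have [|l lP] := cnorm_complete u.
    move=> e e0; have e2 : 0 < e / 2 by rewrite divr_gt0.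
    have [N NP] := uc _ e2; exists N => m n Nm Nn; apply: le_lt_trans (NP _ _ Nm Nn) _.
    by rewrite ltr_pdivrMr// ltr_pMr// -[X in X < _]/(1%:R) ltr_nat.
  exists l => e /lP[N NP]; exists N => n /NP; exact: ltW.
Qed.

Variables (H : hilbertType R) (G : set 'B(H)).

Lemma cstar_gen_closed : cstar_subalgebra (cstar_gen G).
Proof.
split; first exact: cstar_gen_star_subalgebra.
move=> T h B hB GB; case: (hB) => _; apply=> e /h[X gX TX].
by exists X => //; exact: gX.
Qed.

(** The elements satisfying P, viewed as operators, form one of the algebras
    whose intersection is the generated algebra. *)
Lemma cstar_alg_ind (P : cstar_alg G -> Prop) :
  P 1 -> (forall (k : R[i]) x y, P x -> P y -> P (k *: x + y)) ->
  (forall x y, P x -> P y -> P (x * y)) -> (forall x, P x -> P (star x)) ->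
  (forall x, (forall e : R[i], 0 < e ->
     exists2 y, P y & opnorm_le (cstar_val (x - y)) e) -> P x) ->
  (forall x, G (cstar_val x) -> P x) -> forall x, P x.
Proof.
move=> P1 Pl PM Ps Pc PG x.
have : [set T | exists2 y, cstar_val y = T & P y] (cstar_val x); last first.
  by move=> [y /val_inj <-].
have /asboolP := cstar_valP x; apply.
  split; first split.
  - by exists 1.
  - by move=> k _ _ [y <- Py] [z <- Pz]; exists (k *: y + z) => //; exact: Pl.
  - by move=> _ _ [y <- Py] [z <- Pz]; exists (y * z) => //; exact: PM.
  - by move=> _ [y <- Py]; exists (star y) => //; exact: Ps.
  - move=> T h.
    have TG : T \in cstar_gen_pred G.
      apply/asboolP; case: cstar_gen_closed => _; apply=> e /h[_ [y <- _] Ty].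
      by exists (cstar_val y) => //; apply/asboolP; exact: cstar_valP.
    exists (CstarAlg TG) => //; apply: Pc => e /h[_ [y <- Py] Ty].
    by exists y.
move=> T GT.
have TG : T \in cstar_gen_pred G by apply/asboolP => B _; apply.
by exists (CstarAlg TG) => //; exact: PG.
Qed.

Lemma opnorm_normed : star_normed (fun (x : cstar_alg G) c => opnorm_le (cstar_val x) c).
Proof.
split.
- by move=> x a b; exact: opnorm_ler.
- by move=> x; exact: bop_boundP.
- move=> x h; apply: val_inj; apply: bop_ext => v.
  apply/eqP; rewrite -normr_eq0 eq_le normr_ge0 andbT.
  apply/ler_addgt0Pl => e e0; rewrite addr0.
  have v1 : 0 < `|v| + 1 by rewrite ltr_wpDl.
  apply: le_trans (h _ (divr_gt0 e0 v1) v) _.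
  by rewrite mulrAC ler_pdivrMr// ler_wpM2l ?ltW// ltrDl.
- by move=> x y a b; exact: opnorm_leD.
- by move=> k x a; exact: opnorm_leZ.
- by move=> x y a b _ _; exact: opnorm_leM.
- by move=> x a; exact: opnorm_le_adjoint.
- move=> u uc; have [|T TP] := @bop_complete _ _ _ (fun n => cstar_val (u n)).
    exact: uc.
  have TG : T \in cstar_gen_pred G.
    apply/asboolP; case: cstar_gen_closed => _; apply=> e /TP[N /(_ N (leqnn _)) NP].
    exists (cstar_val (u N)); first by apply/asboolP; exact: cstar_valP.
    move=> v; have := NP v; rewrite /= !scaleN1r distrC; exact.
  by exists (CstarAlg TG).
Qed.

End CStarNormed.

(** * Operators given on a dense subspace *)

Section DenseExtension.
Variables (R : realType) (H K : hilbertType R).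

Lemma dense_range_tends (T : Type) (f : T -> H) : dense (range f) ->
  forall x, exists a : nat -> T, tends (fun n => f (a n)) x.
Proof.
move=> /denseP df x.
have /choice[a aP] : forall n : nat, exists t, `|x - f t| <= (2 ^+ n)^-1.
  move=> n; have [|_ [t _ <-] h] := df x (2 ^+ n)^-1.
    by rewrite invr_gt0 exprn_gt0.
  by exists t; exact: ltW.
exists a; apply: (@tends_dom _ _ _ _ _ (fun n => (2 ^+ n)^-1 : R[i]) 0 1) => //.
  exists 0%N => n _; rewrite distrC mul1r subr0 ger0_norm ?aP//.
exact: tends_expV2.
Qed.

Variable A : lmodType R[i].

(** The bound on distances determines the value at each x by completeness, and
    it carries linearity and boundedness over to the extension. *)
Lemma dense_extension (f : A -> H) (g : A -> K) (c : R[i]) :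
  linear f -> linear g -> dense (range f) -> 0 <= c ->
  (forall a, `|g a| <= c * `|f a|) ->
  exists F : H -> K, [/\ linear F, forall x, `|F x| <= c * `|x|
    & forall a, F (f a) = g a].
Proof.
move=> fl gl df c0 gf.
have fB a b : f (a - b) = f a - f b by rewrite addrC -scaleN1r fl scaleN1r addrC.
have gB a b : g (a - b) = g a - g b by rewrite addrC -scaleN1r gl scaleN1r addrC.
have f0 : f 0 = 0 by rewrite -(subrr 0) fB subrr.
have g0 : g 0 = 0 by rewrite -(subrr 0) gB subrr.
have /choice[F FP] : forall x, exists l, forall a, `|l - g a| <= c * `|x - f a|.
  move=> x; have [a xa] := dense_range_tends df x.
  have [|l gal] := @cauchy_tends _ K (fun n => g (a n)).
    move=> e e0; have c1 : 0 < c + 1 by rewrite ltr_wpDl.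
    have [N NP] := xa _ (divr_gt0 (divr_gt0 e0 c1) (ltr0n _ 2)).
    exists N => m n Nm Nn; rewrite -gB; apply: le_trans (gf _) _.
    apply: le_trans (_ : (c + 1) * `|f (a m - a n)| <= _).
      by rewrite ler_wpM2r// lerDl.
    rewrite -ler_pdivlMl// mulrC [X in _ <= X](splitr _) fB -(subrKA x).
    apply: le_trans (ler_normD _ _) _; rewrite lerD ?NP//.
    by rewrite distrC NP.
  exists l => b.
  have h1 := tends_norm (tendsB gal (tends_cst (g b))).
  have h2 := tends_norm (tendsB xa (tends_cst (f b))).
  have h3 : tends (fun n => c * `|f (a n) - f b|) (c * `|x - f b|).
    apply: (tends_dom c0 _ h2); exists 0%N => n _.
    by rewrite -mulrBr normrM (ger0_norm c0).
  apply: (tends_le h1 h3); rewrite ?ger0_real ?mulr_ge0//.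
  by exists 0%N => n _; rewrite -gB -fB.
have Ff a : F (f a) = g a.
  apply/eqP; rewrite -subr_eq0 -normr_eq0 eq_le normr_ge0 andbT.
  by apply: le_trans (FP _ a) _; rewrite subrr normr0 mulr0.
exists F; split=> // [k x y|x]; last first.
  by have := FP x 0; rewrite f0 g0 !subr0.
have [a ax] := dense_range_tends df x; have [b bx] := dense_range_tends df y.
have lim z u : tends (fun n => f (u n)) z -> tends (fun n => g (u n)) (F z).
  move=> uz; apply: (tends_dom c0 _ uz); exists 0%N => n _.
  by rewrite distrC [X in _ * X]distrC; exact: FP.
apply: (@tends_unique _ _ (fun n => g (k *: a n + b n))).
  apply: lim; apply: (@eq_tends _ _ _ (fun n => k *: f (a n) + f (b n))) => [n|].
    by rewrite fl.
  by apply: tendsD => //; exact: tendsZ.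
apply: (@eq_tends _ _ _ (fun n => k *: g (a n) + g (b n))) => [n|].
  by rewrite gl.
by apply: tendsD; [apply: tendsZ|]; exact: lim.
Qed.

End DenseExtension.

(** The adjoint is extended in the same way; the two extensions are adjoint to
    each other because they are so on dense subspaces. *)
Lemma dense_bop (R : realType) (H K : hilbertType R) (A B : lmodType R[i])
    (f : A -> H) (g : A -> K) (f' : B -> K) (g' : B -> H) (c c' : R[i]) :
  linear f -> linear g -> linear f' -> linear g' ->
  dense (range f) -> dense (range f') -> 0 <= c -> 0 <= c' ->
  (forall a, `|g a| <= c * `|f a|) -> (forall b, `|g' b| <= c' * `|f' b|) ->
  (forall a b, <<g a, f' b>> = <<f a, g' b>>) ->
  exists T : bop H K, (forall a, T (f a) = g a) /\
    forall b, adjoint T (f' b) = g' b.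
Proof.
move=> fl gl fl' gl' df df' c0 c0' gf gf' adj.
have [F [Fl Fb FE]] := dense_extension fl gl df c0 gf.
have [G [Gl Gb GE]] := dense_extension fl' gl' df' c0' gf'.
have lip (E E' : hilbertType R) (P : E -> E') d : 0 <= d -> linear P ->
    (forall x, `|P x| <= d * `|x|) ->
    forall u x, tends u x -> tends (fun n => P (u n)) (P x).
  move=> d0 Pl Pb u x ux; apply: (tends_dom d0 _ ux); exists 0%N => n _.
  have -> : P (u n) - P x = P (u n - x).
    by rewrite [u n - x]addrC -[- x]scaleN1r Pl scaleN1r addrC.
  exact: Pb.
have FG x y : <<F x, y>> = <<x, G y>>.
  have [a ax] := dense_range_tends df x; have [b yb] := dense_range_tends df' y.
  apply: (@tends_unique _ _ (fun n => <<F (f (a n)), f' (b n)>>)).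
    by apply: tends_inner => //; exact: (lip _ _ _ _ c0 Fl Fb _ _ ax).
  apply: (@eq_tends _ _ _ (fun n => <<f (a n), G (f' (b n))>>)).
    by move=> n; rewrite FE GE.
  by apply: tends_inner => //; exact: (lip _ _ _ _ c0' Gl Gb _ _ yb).
by exists (Bop Fl (ex_intro _ c Fb) FG).
Qed.

(** * Representations and their vector states *)

Section StarHom.
Variables (R : realType) (A : starAlgType R[i]) (H : hilbertType R).
Variables (pi : A -> 'B(H)) (hpi : star_hom pi).

Lemma repZ k x v : pi (k *: x) v = k *: pi x v.
Proof.
have l := star_hom_linear hpi.
have p0 : pi 0 = 0 by apply: (addrI (pi 0)); rewrite -{1}(scale1r (pi 0)) -l scaler0 !addr0.
by rewrite -[k *: x]addr0 l p0 addr0.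
Qed.

Lemma repD x y v : pi (x + y) v = pi x v + pi y v.
Proof. by rewrite -[x]scale1r (star_hom_linear hpi) /= !scale1r. Qed.

Lemma repN x v : pi (- x) v = - pi x v.
Proof. by rewrite -scaleN1r repZ scaleN1r. Qed.

Lemma repB x y v : pi (x - y) v = pi x v - pi y v.
Proof. by rewrite repD repN. Qed.

Lemma rep0 v : pi 0 v = 0.
Proof. by rewrite -(scale0r (0 : A)) repZ scale0r. Qed.

Lemma rep1 v : pi 1 v = v.
Proof. by rewrite (star_hom1 hpi). Qed.

Lemma repM x y v : pi (x * y) v = pi x (pi y v).
Proof. by rewrite (star_homM hpi). Qed.

Lemma rep_starr x v z : <<v, pi (star x) z>> = <<pi x v, z>>.
Proof. by rewrite (star_hom_star hpi) bop_adjP. Qed.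

Lemma rep_starl x v z : <<pi (star x) v, z>> = <<v, pi x z>>.
Proof. by rewrite (star_hom_star hpi) bop_adjPC. Qed.

Lemma rep_orbit_linear v : linear (fun a => pi a v).
Proof. by move=> k x y; rewrite repD repZ. Qed.

End StarHom.

Lemma star_bopl (R : realType) (H : hilbertType R) (T : 'B(H)) x y :
  <<star T x, y>> = <<x, T y>>.
Proof. exact: bop_adjPC. Qed.

Lemma star_bopr (R : realType) (H : hilbertType R) (T : 'B(H)) x y :
  <<x, star T y>> = <<T x, y>>.
Proof. by rewrite bop_adjP. Qed.

Lemma projection_inner (R : realType) (H : hilbertType R) (p : 'B(H)) x :
  is_projection p -> <<p x, x>> = `|p x| ^+ 2.
Proof. by move=> [ps pp]; rewrite normE -star_bopl ps -[p (p x)]/((p * p) x) pp. Qed.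

Lemma projection_contraction (R : realType) (H : hilbertType R) (p : 'B(H)) x :
  is_projection p -> `|p x| <= `|x|.
Proof.
move=> hp; have := cauchy_schwarz (p x) x; rewrite projection_inner//.
rewrite normrX normr_id expr2; have [->//|px] := eqVneq `|p x| 0.
by rewrite ler_pM2l// lt0r px normr_ge0.
Qed.

(** Cyclic vectors inducing the same state give equivalent representations:
    the correspondence of orbits is isometric in both directions. *)
Lemma same_state_equivalent (R : realType) (A : starAlgType R[i])
    (H K : hilbertType R) (pi : A -> 'B(H)) (sigma : A -> 'B(K)) (xi : H) (eta : K) :
  star_hom pi -> star_hom sigma ->
  dense (range (fun a => pi a xi)) -> dense (range (fun a => sigma a eta)) ->
  (forall a, <<pi a xi, xi>> = <<sigma a eta, eta>>) ->
  unitarily_equivalent pi sigma.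
Proof.
move=> hp hs dp ds e.
have iso a b : <<sigma a eta, sigma b eta>> = <<pi a xi, pi b xi>>.
  by rewrite -(rep_starl hs) -(rep_starl hp) -(repM hs) -(repM hp) e.
have nrm a : `|sigma a eta| <= 1 * `|pi a xi|.
  by rewrite norm_le_sqr// expr1n mul1r iso.
have nrm' a : `|pi a xi| <= 1 * `|sigma a eta|.
  by rewrite norm_le_sqr// expr1n mul1r iso.
have [U [UE VE]] := dense_bop (rep_orbit_linear hp xi) (rep_orbit_linear hs eta)
  (rep_orbit_linear hs eta) (rep_orbit_linear hp xi) dp ds ler01 ler01 nrm nrm' iso.
exists U; split; first split.
- apply: (bop_eq_dense dp) => _ [a _ <-].
  by rewrite /= UE; exact: VE.
- apply: (bop_eq_dense ds) => _ [a _ <-].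
  by rewrite -[LHS]/(U (adjoint U (sigma a eta))) VE UE.
- move=> a; apply: (bop_eq_dense dp) => _ [b _ <-].
  by rewrite /= -(repM hp) !UE (repM hs).
Qed.

(** * Commutants *)

Section Commutants.
Variables (R : realType) (A : starAlgType R[i]).
Implicit Types S T : set A.

Lemma commutantS S T : S `<=` T -> commutant T `<=` commutant S.
Proof. by move=> ST x xT y /ST; exact: xT. Qed.

Lemma sub_bicommutant S : S `<=` bicommutant S.
Proof. by move=> x Sx y yS; rewrite yS. Qed.

Lemma commutant3 S : commutant (bicommutant S) = commutant S.
Proof.
apply/seteqP; split; first exact/commutantS/sub_bicommutant.
exact: sub_bicommutant.
Qed.

Lemma commutant_subalgebra S : (forall x, S x -> S (star x)) ->
  star_subalgebra (commutant S).
Proof.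
move=> Ss; split.
- by move=> y _; rewrite mul1r mulr1.
- move=> k x y cx cy z Sz.
  by rewrite mulrDl mulrDr -scalerAl -scalerAr cx// cy.
- by move=> x y cx cy z Sz; rewrite -mulrA cy// mulrA cx// mulrA.
- move=> x cx z Sz; rewrite -[z in LHS]starK -starM -cx; last exact: Ss.
  by rewrite starM starK.
Qed.

Lemma bicommutant_subalgebra S : (forall x, S x -> S (star x)) ->
  star_subalgebra (bicommutant S).
Proof.
move=> Ss; apply: commutant_subalgebra.
by case: (commutant_subalgebra Ss).
Qed.

End Commutants.

(** * The von Neumann algebra of a tracial representation *)

Section TracialRepresentation.
Variables (R : realType) (A : starAlgType R[i]) (tau : A -> R[i]).
Variables (H : hilbertType R) (pi : A -> 'B(H)) (Om : H).
Hypothesis gns : gns_triple tau pi Om.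
Hypothesis traceC : forall a b, tau (a * b) = tau (b * a).

Let hpi : star_hom pi. Proof. by case: gns. Qed.
Let cyc : dense (range (fun a => pi a Om)). Proof. by case: gns. Qed.
Let tauE a : tau a = <<pi a Om, Om>>. Proof. by case: gns. Qed.

Local Notation M := (bicommutant (range pi)).

Lemma gns_inner a b : <<pi a Om, pi b Om>> = tau (star b * a).
Proof. by rewrite tauE (repM hpi) (rep_starl hpi). Qed.

Lemma gns_norm_star a : `|pi (star a) Om| = `|pi a Om|.
Proof.
apply/eqP; rewrite -(eqrXn2 (n := 2))// !normE !gns_inner starK traceC//.
Qed.

Lemma range_rep_star x : range pi x -> range pi (star x).
Proof. by move=> [a _ <-]; exists (star a) => //; rewrite (star_hom_star hpi). Qed.

Lemma vn_subalgebra : star_subalgebra M.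
Proof. exact/bicommutant_subalgebra/range_rep_star. Qed.

Lemma vn_rep a : M (pi a).
Proof. by apply: sub_bicommutant; exists a. Qed.

(** The trace property makes right multiplication bounded in the norm of the
    representation, which provides many elements of the commutant. *)
Lemma right_mult b : exists T : 'B(H), [/\ commutant (range pi) T,
  forall a, T (pi a Om) = pi (a * b) Om
  & forall a, star T (pi a Om) = pi (a * star b) Om].
Proof.
have bd d : exists2 c : R[i], 0 <= c &
    forall a, `|pi (a * d) Om| <= c * `|pi a Om|.
  have [c c0 cP] := bop_boundP (pi (star d)); exists c => // a.
  rewrite -gns_norm_star -[`|pi a Om|]gns_norm_star starM (repM hpi).
  exact: cP.
have lin d : linear (fun a => pi (a * d) Om).
  by move=> k x y; rewrite mulrDl -scalerAl (repD hpi) (repZ hpi).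
have [c c0 cP] := bd b; have [c' c0' cP'] := bd (star b).
have [|T [TE TE']] := dense_bop (rep_orbit_linear hpi Om) (lin b)
  (rep_orbit_linear hpi Om) (lin (star b)) cyc cyc c0 c0' cP cP'.
  by move=> x y; rewrite !gns_inner starM starK mulrA traceC !mulrA.
exists T; split=> // _ [a _ <-]; apply: (bop_eq_dense cyc) => _ [x _ <-].
by rewrite /= TE -!(repM hpi) TE mulrA.
Qed.

(** The image m Om determines m: on the orbit of Om, m acts as the right
    multiplications, which are in the commutant, act on m Om. *)
Lemma vn_right_mult m b T : M m -> commutant (range pi) T ->
  (forall a, T (pi a Om) = pi (a * b) Om) -> m (pi b Om) = T (m Om).
Proof.
move=> Mm cT TE; have -> : pi b Om = T Om.
  by rewrite -[Om in RHS](rep1 hpi) TE mul1r.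
by have := congr1 (fun S : 'B(H) => S Om) (Mm T cT).
Qed.

Lemma vn_inner_mulr m b c : M m ->
  <<m (pi b Om), pi c Om>> = <<m Om, pi (c * star b) Om>>.
Proof.
move=> Mm; have [T [cT TE TE']] := right_mult b.
by rewrite (vn_right_mult Mm cT TE) -TE' star_bopr.
Qed.

Lemma cyclic_orth x : (forall a, <<x, pi a Om>> = 0) -> x = 0.
Proof.
move=> x0; apply: innerlI => z; rewrite inner0l.
have [a az] := dense_range_tends cyc z.
apply: (@tends_unique _ _ (fun n => <<x, pi (a n) Om>>)).
  by apply: tends_inner => //; exact: tends_cst.
by apply: (@eq_tends _ _ _ (fun=> 0)) => //; exact: tends_cst.
Qed.

Lemma vn_separating m : M m -> m Om = 0 -> m = 0.
Proof.
move=> Mm m0; apply: (bop_eq_dense cyc) => _ [b _ <-].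
have [T [cT TE _]] := right_mult b.
by rewrite (vn_right_mult Mm cT TE) m0 linear0.
Qed.

Lemma vn_eq m n : M m -> M n -> m Om = n Om -> m = n.
Proof.
move=> Mm Mn mn; apply/eqP; rewrite -subr_eq0; apply/eqP/vn_separating.
  have [_ ML _ _] := vn_subalgebra.
  by rewrite addrC -scaleN1r; exact: ML.
by rewrite /= scaleN1r mn subrr.
Qed.

(** The involution is isometric for the trace norm, so approximants of m Om
    are also approximants of star m Om. *)
Lemma vn_approx m : M m -> exists a : nat -> A,
  tends (fun n => pi (a n) Om) (m Om) /\
  tends (fun n => pi (star (a n)) Om) (star m Om).
Proof.
move=> Mm; have [a am] := dense_range_tends cyc (m Om); exists a; split=> //.
have [|l al] := @cauchy_tends _ H (fun n => pi (star (a n)) Om).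
  move=> e e0; have e2 : 0 < e / 2 by rewrite divr_gt0.
  have [N NP] := am _ e2; exists N => i k Ni Nk.
  rewrite -(repB hpi) -starB gns_norm_star (repB hpi) -(subrKA (m Om)) (splitr e).
  by rewrite (le_trans (ler_normD _ _))// lerD ?NP// distrC NP.
suff -> : star m Om = l by [].
apply: innerlI => z; have [b bz] := dense_range_tends cyc z.
apply: (@tends_unique _ _ (fun n => <<star m Om, pi (b n) Om>>)).
  by apply: tends_inner => //; exact: tends_cst.
apply: (@eq_tends _ _ _ (fun n => <<(l), pi (b n) Om>>)); last first.
  by apply: tends_inner => //; exact: tends_cst.
move=> n; have [T [cT TE _]] := right_mult (b n).
rewrite star_bopl (vn_right_mult Mm cT TE).
apply: (@tends_unique _ _ (fun k => <<Om, T (pi (a k) Om)>>)).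
  by apply: tends_inner; [exact: tends_cst|exact: tends_bop].
apply: (@eq_tends _ _ _ (fun k => <<pi (star (a k)) Om, pi (b n) Om>>)).
  by move=> k; rewrite TE (repM hpi) (rep_starl hpi).
by apply: tends_inner => //; exact: tends_cst.
Qed.

Lemma vn_trace m n : M m -> M n -> <<m (n Om), Om>> = <<n (m Om), Om>>.
Proof.
move=> /vn_approx[a [am am']] /vn_approx[b [bn bn']].
rewrite -[LHS]star_bopr -[RHS]star_bopr.
apply: (@tends_unique _ _ (fun k => <<pi (b k) Om, pi (star (a k)) Om>>)).
  exact: tends_inner.
apply: (@eq_tends _ _ _ (fun k => <<pi (a k) Om, pi (star (b k)) Om>>)).
  by move=> k; rewrite !gns_inner !starK traceC.
exact: tends_inner.
Qed.

Lemma vn_norm_star m : M m -> `|star m Om| = `|m Om|.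
Proof.
move=> Mm; have [_ _ _ Ms] := vn_subalgebra.
apply/eqP; rewrite -(eqrXn2 (n := 2))// !normE star_bopl inner_conj.
by rewrite (vn_trace Mm (Ms _ Mm)) star_bopl -inner_conj.
Qed.

(** Passing to adjoints turns right multiplication by u into left
    multiplication by the isometry star u, without changing trace norms. *)
Lemma vn_isom_mulr m u : M m -> M u -> u * star u = 1 ->
  `|m (u Om)| = `|m Om|.
Proof.
move=> Mm Mu u1; have [_ _ MM Ms] := vn_subalgebra.
rewrite -[m (u Om)]/((m * u) Om) -vn_norm_star; last exact: MM.
rewrite -[`|m Om|]vn_norm_star// starM /=.
apply/eqP; rewrite -(eqrXn2 (n := 2))// !normE star_bopl.
by rewrite -[u (star u _)]/((u * star u) _) u1.
Qed.

(** A faithful trace forbids a proper isometry: the defect projection of an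
    isometry has trace zero. *)
Lemma vn_finite : finite_vna M.
Proof.
move=> v Mv vv; have [M1 ML MM Ms] := vn_subalgebra.
have sM := Ms _ Mv; apply: vn_eq => //; first exact: MM.
apply/eqP; rewrite -subr_eq0 -normr_eq0 -sqrf_eq0 normE; apply/eqP.
have idem : v * star v * (v * star v) = v * star v.
  by rewrite mulrA -[v * star v * v]mulrA vv mulr1.
have tr : <<(v * star v) Om, Om>> = <<Om, Om>>.
  rewrite -[LHS]/(<<v (star v Om), Om>>) vn_trace// -[star v (v Om)]/((star v * v) Om).
  by rewrite vv.
have sq : <<(v * star v) Om, (v * star v) Om>> = <<Om, Om>>.
  rewrite -[X in <<_, X>>]/((v * star v) Om) -[LHS]star_bopl starM starK.
  by rewrite -[X in <<X, _>>]/((v * star v * (v * star v)) Om) idem.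
have tr' : <<Om, (v * star v) Om>> = <<Om, Om>> by rewrite inner_conj tr -inner_conj.
by rewrite innerBl !innerBr sq tr tr' !subrr.
Qed.

End TracialRepresentation.

(** * The trace of the CAR algebra *)

Lemma tensmx11 (S : comPzRingType) m n :
  (1%:M : 'M[S]_m) *t (1%:M : 'M[S]_n) = 1%:M.
Proof.
apply/matrixP => i j.
case: (mxtens_indexP i) => i1 i2; case: (mxtens_indexP j) => j1 j2.
rewrite tensmxE !mxE (can_eq (@mxtens_indexK _ _)) xpair_eqE -natrM mulnb.
by [].
Qed.

Section PositiveMatrices.
Variable K : numClosedFieldType.
Local Notation ctmx a := (map_mx Num.conj a)^T.

Lemma trace_delta n (A : 'M[K]_n) i : \tr (delta_mx i i *m A *m delta_mx i i) = A i i.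
Proof.
rewrite mxtrace_mulC mulmxA mul_delta_mx /mxtrace (bigD1 i)//= big1 ?addr0.
  rewrite mxE (bigD1 i)//= big1 ?addr0 => [|k ki]; rewrite !mxE ?eqxx ?mul1r//.
  by rewrite (negPf ki) mul0r.
move=> k ki; rewrite mxE big1// => l _; rewrite !mxE.
by rewrite (negPf ki) mul0r.
Qed.

(** Diagonalization turns positivity of the form into nonnegative eigenvalues,
    whose square roots assemble into the factor. *)
Lemma positive_mx_factor n (D : 'M[K]_n) : ctmx D = D ->
  (forall b : 'M[K]_n, 0 <= \tr (ctmx b *m D *m b)) -> exists y : 'M[K]_n, D = ctmx y *m y.
Proof.
move=> Dh Dp.
have nD : D \is spectral.normalmx by apply/spectral.normalmxP; rewrite -map_trmx Dh.
have /spectral.orthomx_spectralP := nD.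
have := spectral.spectral_unitarymx D.
set P := spectral.spectralmx D; set d := spectral.spectral_diag D => Pu DE.
have PP : P *m ctmx P = 1%:M by have /spectral.unitarymxP := Pu; rewrite -map_trmx.
have PP' : ctmx P *m P = 1%:M by exact: mulmx1C.
have Pi : invmx P = ctmx P by rewrite spectral.invmx_unitary// map_trmx.
rewrite Pi in DE.
have d0 i : 0 <= d 0 i.
  have := Dp (ctmx P *m delta_mx i i).
  have -> : ctmx (ctmx P *m delta_mx i i) = delta_mx i i *m P.
    rewrite map_mxM trmx_mul map_delta_mx trmx_delta -map_trmx trmxK.
    by rewrite -map_mx_comp map_mx_id// => x; exact: conjCK.
  rewrite DE !mulmxA -(mulmxA _ P) PP mulmx1 -(mulmxA _ P) PP mulmx1.
  by rewrite trace_delta mxE eqxx mulr1n.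
exists (diag_mx (map_mx sqrtC d) *m P).
rewrite map_mxM trmx_mul mulmxA -(mulmxA _ _ (diag_mx _)) {1}DE.
congr (_ *m _ *m _); rewrite map_diag_mx tr_diag_mx mulmx_diag; congr diag_mx.
apply/rowP => i; rewrite !mxE.
have e : Num.conj (sqrtC (d 0 i)) = sqrtC (d 0 i).
  by apply/CrealP; rewrite ger0_real// sqrtC_ge0.
by rewrite [X in X * _]e -expr2 sqrtCK.
Qed.

End PositiveMatrices.

Section CARTrace.
Variables (R : realType) (C : cstarAlgType R[i]).
Variables (iota : forall n, 'M[R[i]]_(car_dim n) -> C) (hC : is_CAR iota).
Local Notation ctmx a := (map_mx Num.conj a)^T.

Lemma iotaP n (k : R[i]) a b : iota (k *: a + b) = k *: iota a + @iota n b.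
Proof. by case: hC => h _ _; have [l _ _ _ _] := h n; exact: l. Qed.

Lemma iotaM n a b : iota (a *m b) = iota a * @iota n b.
Proof. by case: hC => h _ _; have [_ _ _ m _] := h n; exact: m. Qed.

Lemma iota1 n : @iota n 1%:M = 1.
Proof. by case: hC => h _ _; case: (h n). Qed.

Lemma iota_star n a : iota (ctmx a) = star (@iota n a).
Proof. by case: hC => h _ _; have [_ _ _ _ s] := h n; exact: s. Qed.

Lemma iotaS n a : @iota n.+1 (a *t (1%:M : 'M[R[i]]_2)) = @iota n a.
Proof. by case: hC. Qed.

Lemma iotaD n a b : iota (a + b) = iota a + @iota n b.
Proof. by rewrite -[a]scale1r iotaP !scale1r. Qed.

Lemma iota0 n : @iota n 0 = 0.
Proof. by apply: (addrI (@iota n 0)); rewrite -iotaD !addr0. Qed.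

Lemma iotaZ n (k : R[i]) a : iota (k *: a) = k *: @iota n a.
Proof. by rewrite -[k *: a]addr0 iotaP iota0 addr0. Qed.

Lemma iotaN n a : iota (- a) = - @iota n a.
Proof. by rewrite -scaleN1r iotaZ scaleN1r. Qed.

Lemma iotaB n a b : iota (a - b) = iota a - @iota n b.
Proof. by rewrite iotaD iotaN. Qed.

Lemma iota_sum n J (s : seq J) F :
  @iota n (\sum_(i <- s) F i) = \sum_(i <- s) @iota n (F i).
Proof. exact: (big_morph (@iota n) (@iotaD n) (iota0 n)). Qed.

Lemma iota_lift n (a : 'M[R[i]]_(car_dim n)) m : (n <= m)%N ->
  exists b, @iota m b = iota a.
Proof.
elim: m => [|m IH]; first by rewrite leqn0 => /eqP e; subst n; exists a.
rewrite leq_eqVlt => /orP[/eqP e|/IH[b <-]]; first by subst n; exists a.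
by exists (b *t 1%:M); exact: iotaS.
Qed.

Lemma car_dense (x : C) (e : R[i]) : 0 < e ->
  exists n a, cnorm (x - @iota n a) <= e.
Proof. by case: hC => _ _ h /(h x)[n [a /ltW xa]]; exists n, a. Qed.

(** Identities that are continuous in an element of C are checked on matrices
    through this lemma. *)
Lemma car_dense_eq0 (V : normedZmodType R[i]) (f : C -> V) (c : R[i]) :
  0 <= c -> (forall x y, f (x - y) = f x - f y) ->
  (forall x e, 0 < e -> cnorm x <= e -> `|f x| <= c * e) ->
  (forall n a, f (@iota n a) = 0) -> forall x, f x = 0.
Proof.
move=> c0 fB fc f0 x; apply/eqP; rewrite -normr_eq0 eq_le normr_ge0 andbT.
apply/ler_addgt0Pl => e e0; rewrite addr0.
have c1 : 0 < c + 1 by rewrite ltr_wpDl.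
have ec := divr_gt0 e0 c1.
have [n [a xa]] := car_dense x ec.
have := fc _ _ ec xa; rewrite fB f0 subr0 => /le_trans; apply.
by rewrite mulrCA ger_pMr// ler_pdivrMr// mul1r lerDl.
Qed.

(** The Pauli matrices x and z, placed in the tensor factor that follows the
    n-th matrix algebra. *)
Lemma pauli n : exists u v : C, [/\ star u = u, star v = v, u * u = 1, v * v = 1
  & u * v = - (v * u) /\
    forall a : 'M[R[i]]_(car_dim n), u * iota a = iota a * u /\ v * iota a = iota a * v].
Proof.
pose s1 : 'M[R[i]]_2 := \matrix_(i, j) (i != j)%:R.
pose s3 : 'M[R[i]]_2 := \matrix_(i, j) (if i == j then (-1) ^+ i else 0).
pose up (s : 'M[R[i]]_2) : 'M[R[i]]_(car_dim n.+1) := (1%:M : 'M[R[i]]_(car_dim n)) *t s.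
have upM s t : up s *m up t = up (s *m t) by rewrite /up tensmx_mul mul1mx.
have up1 : up 1%:M = 1%:M by rewrite /up tensmx11.
have upT s : ctmx s = s -> ctmx (up s) = up s.
  by move=> sE; rewrite /up map_mxT trmx_tens map_mx1 trmx1 sE.
have upC s (a : 'M[R[i]]_(car_dim n)) : @iota n.+1 (up s) * iota a = iota a * @iota n.+1 (up s).
  by rewrite -(iotaS a) -!iotaM /up !tensmx_mul !mulmx1 !mul1mx.
have cs1 : ctmx s1 = s1.
  by apply/matrixP => i j; rewrite !mxE eq_sym rmorph_nat.
have cs3 : ctmx s3 = s3.
  apply/matrixP => i j; rewrite !mxE eq_sym; case: eqP => [->|_].
    by rewrite rmorphXn rmorphN1.
  by rewrite rmorph0.
have s11 : s1 *m s1 = 1%:M.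
  apply/matrixP => i j; rewrite !mxE !big_ord_recl big_ord0 !mxE.
  by case: i => [[|[|]]] // ?; case: j => [[|[|]]] // ?; rewrite /= ?(mulr0, mul0r, mulr1, addr0, add0r).
have s33 : s3 *m s3 = 1%:M.
  apply/matrixP => i j; rewrite !mxE !big_ord_recl big_ord0 !mxE.
  by case: i => [[|[|]]] // ?; case: j => [[|[|]]] // ?; rewrite /= ?(mulr0, mul0r, mulr1, addr0, add0r, mulrNN).
have s13 : s1 *m s3 = - (s3 *m s1).
  apply/matrixP => i j; rewrite !mxE !big_ord_recl !big_ord0 !mxE.
  by case: i => [[|[|]]] // ?; case: j => [[|[|]]] // ?; rewrite /= ?(mulr0, mul0r, mulr1, addr0, add0r, mul1r, oppr0, opprK).
exists (iota (up s1)), (iota (up s3)); split.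
- by rewrite -iota_star upT.
- by rewrite -iota_star upT.
- by rewrite -iotaM upM s11 up1 iota1.
- by rewrite -iotaM upM s33 up1 iota1.
split; last by move=> a; split; exact: upC.
rewrite -!iotaM !upM s13 -iotaN; congr iota.
apply/matrixP => i j; rewrite /up [RHS]mxE.
case: (mxtens_indexP i) => i1 i2; case: (mxtens_indexP j) => j1 j2.
by rewrite !tensmxE [X in _ * X]mxE mulrN.
Qed.

End CARTrace.

(** * The hyperfinite II_1 factor *)

Lemma rep_cnorm (R : realType) (C : cstarAlgType R[i]) (H : hilbertType R)
    (pi : C -> 'B(H)) (x : C) (e : R[i]) (v : H) :
  star_hom pi -> 0 < e -> cnorm x <= e -> `|pi x v| <= 2 * e * `|v|.
Proof. by move=> hp e0 xe; exact: (star_hom_bounded (cnorm_normed C) hp e0 xe). Qed.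

Lemma car_dim_gt0 n : (0 < car_dim n)%N.
Proof. by elim: n => //= n IH; rewrite muln_gt0 IH. Qed.

Lemma car_dimE (K : numDomainType) n : (car_dim n)%:R = 2 ^+ n :> K.
Proof. by elim: n => //= n IH; rewrite natrM IH exprS mulrC. Qed.

(** Factoring each matrix unit through a fixed index and commuting the factors
    shows that f vanishes off the diagonal and is constant along it. *)
Lemma trace_unique (K : numFieldType) n (f : 'M[K]_(car_dim n) -> K) :
  (forall k a b, f (k *: a + b) = k * f a + f b) ->
  (forall a b, f (a *m b) = f (b *m a)) ->
  forall a, f a = (2 ^+ n)^-1 * \tr a * f 1%:M.
Proof.
move=> fl fC.
have fD a b : f (a + b) = f a + f b by rewrite -[a]scale1r fl mul1r scale1r.
have f0 : f 0 = 0 by apply: (addrI (f 0)); rewrite -fD !addr0.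
have fZ k a : f (k *: a) = k * f a by rewrite -[k *: a]addr0 fl f0 addr0.
have fsum J (s : seq J) F : f (\sum_(i <- s) F i) = \sum_(i <- s) f (F i).
  exact: (big_morph f fD f0).
have i0 : 'I_(car_dim n) := Ordinal (car_dim_gt0 n).
have fij i j : f (delta_mx i j) = (i == j)%:R * f (delta_mx i0 i0).
  rewrite -(mul_delta_mx i0) fC mul_delta_mx_cond eq_sym.
  by case: eqP => _; rewrite ?mulr1n ?mulr0n ?mul1r// f0 mul0r.
have fE a : f a = \tr a * f (delta_mx i0 i0).
  rewrite {1}[a]matrix_sum_delta fsum mulr_suml; apply: eq_bigr => i _.
  rewrite fsum (bigD1 i)//= big1 ?addr0 => [|j ji].
    by rewrite fZ fij eqxx mul1r.
  by rewrite fZ fij eq_sym (negPf ji) mul0r mulr0.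
move=> a; rewrite (fE 1%:M) fE mxtrace1 car_dimE [_^-1 * _]mulrC -mulrA; congr (_ * _).
by rewrite mulKf// expf_neq0// pnatr_eq0.
Qed.

Section TraceFactor.
Variables (R : realType) (C : cstarAlgType R[i]).
Variables (iota : forall n, 'M[R[i]]_(car_dim n) -> C) (hC : is_CAR iota).
Variables (tau : C -> R[i]) (htau : is_trace_state iota tau).
Variables (H : hilbertType R) (pi : C -> 'B(H)) (Om : H).
Hypothesis gns : gns_triple tau pi Om.

Local Notation ctmx a := (map_mx Num.conj a)^T.
Local Notation M := (bicommutant (range pi)).

Let hpi : star_hom pi. Proof. by case: gns. Qed.
Let cyc : dense (range (fun a => pi a Om)). Proof. by case: gns. Qed.
Let tauE a : tau a = <<pi a Om, Om>>. Proof. by case: gns. Qed.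

Lemma tau_iota n (a : 'M[R[i]]_(car_dim n)) : tau (iota a) = (2 ^+ n)^-1 * \tr a.
Proof. by case: htau. Qed.

Lemma trace_vector_norm : `|Om| = 1.
Proof.
apply/eqP; rewrite -(eqrXn2 (n := 2))// normE -{1}[Om](rep1 hpi) -tauE expr1n.
by rewrite -(iota1 hC 0) tau_iota mxtrace1 expr0 invr1 mul1r.
Qed.

(** Both sides are continuous in each variable, and agree on matrices. *)
Lemma car_traceC a b : tau (a * b) = tau (b * a).
Proof.
have comm x y : tau (x * y) - tau (y * x) =
    <<pi y Om, pi (star x) Om>> - <<pi x Om, pi (star y) Om>>.
  by rewrite !tauE !(repM hpi) !(rep_starr hpi).
have bd y x e : 0 < e -> cnorm x <= e ->
    `|tau (x * y) - tau (y * x)| <= (2 * `|pi y Om| + 2 * `|pi (star y) Om|) * e.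
  move=> e0 xe; rewrite comm; apply: le_trans (ler_normB _ _) _.
  rewrite mulrDl lerD//.
    apply: le_trans (cauchy_schwarz _ _) _; rewrite mulrAC mulrC ler_wpM2r//.
    apply: le_trans (rep_cnorm Om hpi e0 _) _; last by rewrite trace_vector_norm mulr1.
    exact: (nle_star (cnorm_normed C)).
  apply: le_trans (cauchy_schwarz _ _) _; rewrite mulrAC ler_wpM2r//.
  by apply: le_trans (rep_cnorm Om hpi e0 xe) _; rewrite trace_vector_norm mulr1.
have add y : forall x x', tau ((x - x') * y) - tau (y * (x - x')) =
    (tau (x * y) - tau (y * x)) - (tau (x' * y) - tau (y * x')).
  move=> x x'; rewrite mulrBl mulrBr !tauE !(repB hpi) !innerBl.
  exact: subrACA.
have bd0 y : 0 <= 2 * `|pi y Om| + 2 * `|pi (star y) Om|.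
  by rewrite addr_ge0// mulr_ge0.
suff h x y : tau (x * y) - tau (y * x) = 0 by apply/eqP; rewrite -subr_eq0 h.
apply: (car_dense_eq0 hC (bd0 y) (add y) (bd y)) => n {}x.
apply/eqP; rewrite -oppr_eq0 opprB; apply/eqP.
apply: (car_dense_eq0 hC (bd0 (iota x)) (add (iota x)) (bd (iota x))) => m {}y.
have [x' <-] := iota_lift hC x (leq_maxl n m).
have [y' <-] := iota_lift hC y (leq_maxr n m).
by rewrite -!(iotaM hC) !tau_iota mxtrace_mulC subrr.
Qed.

Let traceC := car_traceC.
Let vnS := vn_subalgebra gns.
Let Mr a : M (pi a). Proof. exact: vn_rep. Qed.

Lemma vn_von_neumann : von_neumann_algebra M.
Proof. by split=> //; rewrite /bicommutant commutant3. Qed.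

(** A central element defines a tracial functional on each matrix algebra,
    hence a multiple of the trace; its deviation from that scalar annihilates
    the cyclic vector. *)
Lemma vn_factor : factor M.
Proof.
split; first exact: vn_von_neumann.
move=> z Mz cz; have [M1 ML MM Ms] := vnS.
pose g a := <<z (pi a Om), Om>>.
have g1 : g 1 = <<z Om, Om>> by rewrite /g (rep1 hpi).
have gE n (a : 'M[R[i]]_(car_dim n)) : g (iota a) = tau (iota a) * g 1.
  rewrite tau_iota -(iota1 hC n); apply: (@trace_unique _ n (fun a => g (iota a))).
    by move=> k x y; rewrite /g (iotaP hC) (repD hpi) (repZ hpi) linearP innerDl innerZl.
  move=> x y; rewrite /g !(iotaM hC) !(repM hpi).
  rewrite -[z (_ _)]/((z * pi (iota x)) (pi (iota y) Om)).
  rewrite (vn_trace gns traceC (MM _ _ Mz (Mr _)) (Mr (iota y))).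
  rewrite -[pi _ _]/((pi (iota y) * z) (pi (iota x) Om)).
  by rewrite -(cz (pi (iota y))) //; exact: Mr.
pose y : 'B(H) := - g 1 *: 1 + z.
have My : M y by exact: ML.
have yE v : y v = z v - g 1 *: v by rewrite /y addrC /= scaleNr.
suff y0 : y = 0.
  exists (g 1); apply/eqP; rewrite -subr_eq0; apply/eqP; rewrite -y0 /y scaleNr addrC.
  by [].
apply: (vn_separating gns traceC) => //; apply: (cyclic_orth gns) => a.
rewrite -[a]starK (rep_starr hpi).
have cy v : pi (star a) (y v) = y (pi (star a) v).
  rewrite !yE linearB linearZ /=; congr (_ - _).
  have := cz (pi (star a)) (Mr _).
  by move/(congr1 (fun S : 'B(H) => S v)).
rewrite cy; have [c c0 cP] := bop_boundP y.
apply: (car_dense_eq0 hC (f := fun x => <<y (pi x Om), Om>>) (c := c * 2) _ _ _ _ (star a))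
  => [|x x'|x e e0 xe|n x].
- by rewrite mulr_ge0.
- by rewrite (repB hpi) linearB innerBl.
- apply: le_trans (cauchy_schwarz _ _) _; rewrite trace_vector_norm mulr1.
  apply: le_trans (cP _) _; rewrite -mulrA ler_wpM2l//.
  by apply: le_trans (rep_cnorm Om hpi e0 xe) _; rewrite trace_vector_norm mulr1.
- by rewrite yE innerBl innerZl -tauE -[X in X - _]/(g (iota x)) gE mulrC subrr.
Qed.

(** If pMp is commutative, approximate p in trace norm by a matrix in the n-th
    algebra: it nearly commutes with two anticommuting symmetries u, v of the
    next tensor factor, so that (p u p) (p v p) = (p v p) (p u p) forces
    2 p u v = p (u v - v u) to be small, although its norm is twice that of p. *)
Lemma vn_no_abelian_projection p : abelian_projection M p -> p = 0.
Proof.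
move=> [Mp [ps pp] pab]; have [M1 ML MM Ms] := vnS.
apply: (vn_separating gns traceC) => //; apply/eqP; rewrite -normr_eq0 eq_le normr_ge0 andbT.
apply/ler_addgt0Pl => e' e'0; rewrite addr0.
have [e eE] : exists e, e = e' / 4 by exists (e' / 4).
have e0 : 0 < e by rewrite eE divr_gt0.
have [n [a' ea]] : exists n (a : 'M[R[i]]_(car_dim n)), `|p Om - pi (iota a) Om| <= e.
  have e2 : 0 < e / 2 by rewrite divr_gt0.
  have /denseP/(_ (p Om) _ e2)[_ [b _ <-] pb] := cyc.
  have e4 : 0 < e / 2 / 2 by rewrite divr_gt0.
  have [n [a ba]] := car_dense hC b e4; exists n, a.
  rewrite [X in _ <= X](splitr _) -(subrKA (pi b Om)) (le_trans (ler_normD _ _))// lerD//.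
    exact: ltW.
  rewrite -(repB hpi); apply: le_trans (rep_cnorm Om hpi e4 ba) _.
  by rewrite trace_vector_norm mulr1 mulrC divfK.
have [u [v [us vs uu vv [uv comm]]]] := pauli hC n.
pose U := pi u; pose V := pi v; pose x := pi (iota a').
have MU : M U by exact: Mr.
have MV : M V by exact: Mr.
have Mx : M x by exact: Mr.
have MB s t : M s -> M t -> M (s - t).
  by move=> Ms' Mt; rewrite addrC -scaleN1r; exact: ML.
have sym w : star w = w -> w * w = 1 -> pi w * star (pi w) = 1 /\
    (forall y, `|pi w y| = `|y|).
  move=> ws ww; have e1 : pi w * star (pi w) = 1.
    by rewrite -(star_hom_star hpi) ws -(star_homM hpi) ww (star_hom1 hpi).
  split=> // y; apply/eqP; rewrite -(eqrXn2 (n := 2))// !normE -(rep_starl hpi) ws.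
  by rewrite -(repM hpi) ww (rep1 hpi).
have [UU Ui] := sym _ us uu; have [VV Vi] := sym _ vs vv.
have pc y : `|p y| <= `|y| by apply: projection_contraction; split.
have near (w : C) : w * iota a' = iota a' * w -> pi w * star (pi w) = 1 ->
    (forall y, `|pi w y| = `|y|) -> `|(p * pi w - pi w * p) Om| <= e + e.
  move=> wa ww wi; have Mw : M (pi w) by exact: Mr.
  have -> : p * pi w - pi w * p = (p - x) * pi w - pi w * (p - x).
    by rewrite mulrBl mulrBr subrACA /x -!(star_homM hpi) wa subrr subr0.
  rewrite bopB !bopM; apply: le_trans (ler_normB _ _) _.
  rewrite wi (vn_isom_mulr gns traceC) ?bopB ?lerD//; exact: MB.
have cu := near _ (comm a').1 UU Ui; have cv := near _ (comm a').2 VV Vi.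
(* T p = p T - [p, T] and S p = p S - [p, S], with commutators of trace norm at
   most e + e *)
have key (S T : 'B(H)) : M S -> M T -> T * star T = 1 -> (forall y, `|S y| = `|y|) ->
    `|(p * S - S * p) Om| <= e + e -> `|(p * T - T * p) Om| <= e + e ->
    `|(p * S * p * (p * T * p) - p * S * T) Om| <= (e + e) + (e + e).
  move=> MS MT TT Si cS cT.
  have -> : p * S * p * (p * T * p) - p * S * T =
      - (p * ((p * S - S * p) * T)) - p * S * p * (p * T - T * p).
    have -> : p * S * p * (p * T * p) = p * S * p * (T * p).
      by rewrite !mulrA -[p * S * p * p]mulrA pp.
    rewrite !(mulrBr, mulrBl) !mulrA pp -[p * S * p * p]mulrA pp.
    by rewrite -[RHS]opprD subrKA opprB.
  rewrite bopB bopN !bopM; apply: le_trans (ler_normB _ _) _; rewrite normrN lerD//.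
    apply: le_trans (pc _) _; rewrite (vn_isom_mulr gns traceC)//.
    by apply: MB; exact: MM.
  by apply: le_trans (pc _) _; rewrite Si; apply: le_trans (pc _) _.
have h1 := key U V MU MV VV Ui cu cv; have h2 := key V U MV MU UU Vi cv cu.
have h : `|(p * V * U - p * U * V) Om| <= ((e + e) + (e + e)) + ((e + e) + (e + e)).
  have -> : p * V * U - p * U * V = (p * U * p * (p * V * p) - p * U * V)
      - (p * V * p * (p * U * p) - p * V * U).
    by rewrite (pab _ _ MU MV) opprB [RHS]addrC subrKA.
  rewrite bopB.
  by apply: le_trans (ler_normB _ _) _; rewrite lerD.
move: h; have -> : p * V * U - p * U * V = p * (V * U) *+ 2.
  have UV : U * V = - (V * U).
    by rewrite -!(star_homM hpi) uv; apply: bop_ext => y; rewrite bopN (repN hpi).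
  by rewrite -!mulrA UV mulrN opprK mulr2n.
have -> : (p * (V * U) *+ 2) Om = (2 : R[i]) *: ((p * (V * U)) Om).
  by rewrite -scaler_nat.
have -> : (p * (V * U)) Om = (p * V) (U Om) by [].
rewrite normrZ (vn_isom_mulr gns traceC (MM _ _ Mp MV) MU UU) bopM.
rewrite (vn_isom_mulr gns traceC Mp MV VV) ger0_norm//.
have -> : e + e + (e + e) + (e + e + (e + e)) = 2 * e' by rewrite eE; field.
by rewrite ler_pM2l.
Qed.

Lemma vn_II1_factor : II1_factor M.
Proof.
split; [exact: vn_factor|exact: (vn_finite gns traceC)|].
exact: vn_no_abelian_projection.
Qed.

Lemma vn_hyperfinite : hyperfinite M.
Proof.
exists (fun n => range (fun a : 'M[R[i]]_(car_dim n) => pi (iota a))); split.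
- move=> n; split; first split.
  + by exists 1%:M => //; rewrite (iota1 hC) (star_hom1 hpi).
  + move=> k _ _ [a _ <-] [b _ <-]; exists (k *: a + b) => //.
    by rewrite (iotaP hC) (star_hom_linear hpi).
  + by move=> _ _ [a _ <-] [b _ <-]; exists (a *m b) => //; rewrite (iotaM hC) (star_homM hpi).
  + move=> _ [a _ <-]; exists (ctmx a) => //.
    by rewrite (iota_star hC) (star_hom_star hpi).
  have [E EP] : exists E : seq ('I_(car_dim n) * 'I_(car_dim n)), forall F : _ -> _ -> C,
      \sum_i \sum_j F i j = \sum_(p <- E) F p.1 p.2.
    by exists (index_enum _) => F; rewrite pair_big.
  exists [seq pi (iota (delta_mx p.1 p.2)) | p <- E] => _ [a _ <-].
  exists (fun k => nth 0 [seq a p.1 p.2 | p <- E] k).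
  have p0 : 'I_(car_dim n) * 'I_(car_dim n) by split; exact: (Ordinal (car_dim_gt0 n)).
  have -> : iota a = \sum_(p <- E) a p.1 p.2 *: iota (delta_mx p.1 p.2).
    rewrite -(EP (fun i j => a i j *: iota (delta_mx i j))) {1}[a]matrix_sum_delta (iota_sum hC).
    apply: eq_bigr => i _; rewrite (iota_sum hC).
    by apply: eq_bigr => j _; rewrite (iotaZ hC).
  have piD x y : pi (x + y) = pi x + pi y by apply: bop_ext => v; rewrite (repD hpi).
  have pi0 : pi 0 = 0 by apply: bop_ext => v; rewrite (rep0 hpi).
  rewrite (big_morph pi piD pi0) (big_nth p0) big_mkord size_map.
  apply: eq_bigr => k _; rewrite !(nth_map p0) ?ltn_ord//.
  by apply: bop_ext => v; rewrite (repZ hpi).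
- by move=> n _ [a _ <-]; exists (a *t 1%:M) => //; rewrite (iotaS hC).
rewrite /bicommutant; apply: congr1; apply/seteqP; split.
  by apply: commutantS => _ [n _ [a _ <-]]; exists (iota a).
move=> T cT _ [x _ <-]; apply: bop_ext => v.
apply/eqP; rewrite -subr_eq0; apply/eqP.
have [c c0 cP] := bop_boundP T.
apply: (car_dense_eq0 hC (f := fun x => T (pi x v) - pi x (T v))
  (c := c * (2 * `|v|) + 2 * (c * `|v|)) _ _ _ _ x) => [|y z|y e e0 ye|n a].
- by rewrite addr_ge0 ?mulr_ge0.
- by rewrite /= !(repB hpi) linearB; exact: subrACA.
- apply: le_trans (ler_normB _ _) _; rewrite mulrDl lerD//.
    apply: le_trans (cP _) _; rewrite -mulrA ler_wpM2l//.
    by apply: le_trans (rep_cnorm v hpi e0 ye) _; rewrite mulrAC.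
  apply: le_trans (rep_cnorm _ hpi e0 ye) _; rewrite mulrAC ler_wpM2r ?(ltW e0)//.
  by rewrite ler_wpM2l.
- apply/eqP; rewrite subr_eq0; apply/eqP.
  have : T * pi (iota a) = pi (iota a) * T by apply: cT; exists n => //; exists a.
  by move/(congr1 (fun S : 'B(H) => S v)).
Qed.

(** * Strong density of the CAR algebra in its tracial closure *)

(** The trace-preserving conditional expectation, written with coefficients
    along the matrix units, which are orthogonal in the trace form. *)
Lemma matrix_compression n (y : H) : exists a : 'M[R[i]]_(car_dim n),
  forall b : 'M[R[i]]_(car_dim n), <<pi (iota a) Om, pi (iota b) Om>> = <<y, pi (iota b) Om>>.
Proof.
pose c i j := <<y, pi (iota (delta_mx i j : 'M[R[i]]_(car_dim n))) Om>>.
have ip (a b : 'M[R[i]]_(car_dim n)) :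
    <<pi (iota a) Om, pi (iota b) Om>> = (2 ^+ n)^-1 * \tr (ctmx b *m a).
  by rewrite (gns_inner gns) -(iota_star hC) -(iotaM hC) tau_iota.
pose a := \matrix_(i, j) (2 ^+ n * c i j); exists a => b.
have -> : pi (iota b) Om = \sum_i \sum_j b i j *: pi (iota (delta_mx i j : 'M[R[i]]_(car_dim n))) Om.
  rewrite {1}[b]matrix_sum_delta (iota_sum hC).
  rewrite (big_morph (fun x => pi x Om) (fun x z => repD hpi x z Om) (rep0 hpi Om)).
  apply: eq_bigr => i _; rewrite (iota_sum hC).
  rewrite (big_morph (fun x => pi x Om) (fun x z => repD hpi x z Om) (rep0 hpi Om)).
  by apply: eq_bigr => j _; rewrite (iotaZ hC) (repZ hpi).
have isum z J (s : seq J) (F : J -> H) : <<z, \sum_(k <- s) F k>> = \sum_(k <- s) <<z, F k>>.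
  by apply: (big_morph (fun x => <<z, x>>)) => [u v|]; rewrite ?innerDr ?inner0r.
rewrite !isum; apply: eq_bigr => i _; rewrite !isum; apply: eq_bigr => j _.
rewrite !innerZr ip map_delta_mx trmx_delta.
have -> : \tr (delta_mx j i *m a) = a i j.
  rewrite /mxtrace (bigD1 j)//= big1 ?addr0 => [|k kj].
    rewrite mxE (bigD1 i)//= big1 ?addr0 => [|l li]; rewrite mxE !eqxx ?mul1r//.
    by rewrite (negPf li) mul0r.
  by rewrite mxE big1// => l _; rewrite mxE (negPf kj) mul0r.
by rewrite mxE mulKf// expf_neq0// pnatr_eq0.
Qed.

(** The compression a n of m to the n-th matrix algebra satisfies
    a n b Om = m b Om, for b in that algebra, up to vectors orthogonal to its
    orbit, so that k ^ 2 - star (a n) * a n is a positive matrix when k bounds m.  A positive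
    matrix is of the form star y * y, and the bound passes from the matrix
    algebra to the whole space.  Uniform boundedness then upgrades the
    convergence of a n Om to strong convergence. *)
Lemma vn_bounded_approx m : M m -> exists a : nat -> C,
  forall x, tends (fun n => pi (a n) x) (m x).
Proof.
move=> Mm; have [k k0 kP] := bop_boundP m.
pose a n := projT1 (cid (matrix_compression n (m Om))).
have aP n (b : 'M[R[i]]_(car_dim n)) : <<pi (iota (a n)) Om, pi (iota b) Om>> = <<m Om, pi (iota b) Om>>.
  exact: projT2 (cid (matrix_compression n (m Om))) b.
(* the bound on the orbit of the n-th matrix algebra, where a n and m have the
   same matrix coefficients *)
have nrm n (b : 'M[R[i]]_(car_dim n)) : `|pi (iota (a n *m b)) Om| <= k * `|pi (iota b) Om|.
  have [->|ab0] := eqVneq `|pi (iota (a n *m b)) Om| 0; first by rewrite mulr_ge0.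
  rewrite -(ler_pM2r (_ : 0 < `|pi (iota (a n *m b)) Om|)) ?lt0r ?ab0 ?normr_ge0//.
  rewrite -expr2 normE.
  have {1}-> : pi (iota (a n *m b)) Om = pi (iota (a n)) (pi (iota b) Om).
    by rewrite (iotaM hC) (repM hpi).
  rewrite (vn_inner_mulr gns traceC _ _ (Mr _)) -(iota_star hC) -(iotaM hC) aP.
  rewrite (iotaM hC) (iota_star hC) -(vn_inner_mulr gns traceC _ _ Mm).
  have /le_trans := cauchy_schwarz (m (pi (iota b) Om)) (pi (iota (a n *m b)) Om).
  have <- : <<m (pi (iota b) Om), pi (iota (a n *m b)) Om>> =
      `|<<m (pi (iota b) Om), pi (iota (a n *m b)) Om>>|.
    rewrite (vn_inner_mulr gns traceC _ _ Mm) -(iota_star hC) -(iotaM hC) -aP.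
    rewrite (iotaM hC) (iota_star hC) -(vn_inner_mulr gns traceC _ _ (Mr _)).
    by rewrite -(repM hpi) -(iotaM hC) ger0_norm ?inner_ge0.
  by apply; rewrite ler_wpM2r.
have bd n x : `|pi (iota (a n)) x| <= k * `|x|.
  pose D := k ^+ 2 *: 1%:M - ctmx (a n) *m a n.
  have kk : Num.conj (k ^+ 2) = k ^+ 2 by apply/CrealP; rewrite ger0_real// exprn_ge0.
  have DE v : <<pi (iota D) v, v>> = k ^+ 2 * <<v, v>> - <<pi (iota (a n)) v, pi (iota (a n)) v>>.
    rewrite (iotaB hC) (iotaZ hC) (iota1 hC) (iotaM hC) (iota_star hC).
    by rewrite (repB hpi) (repZ hpi) (rep1 hpi) (repM hpi) innerBl innerZl (rep_starl hpi).
  have [|b|y Dy] := @positive_mx_factor _ _ D.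
  - rewrite /D map_mxB map_mxZ map_mx1 map_mxM linearB linearZ /= trmx1 trmx_mul kk.
    congr (_ - _ *m _); rewrite -map_trmx trmxK -map_mx_comp map_mx_id// => z.
    exact: conjCK.
  - rewrite -[X in 0 <= X](mulKf (_ : 2 ^+ n != 0 :> R[i])) ?expf_neq0 ?pnatr_eq0//.
    rewrite mulrCA; apply: mulr_ge0; first by rewrite exprn_ge0.
    rewrite -tau_iota tauE !(iotaM hC) !(repM hpi) (iota_star hC) (rep_starl hpi) DE.
    rewrite subr_ge0 -norm_le_sqr// -(repM hpi) -(iotaM hC).
    exact: nrm.
  rewrite norm_le_sqr// -subr_ge0 -DE Dy (iotaM hC) (iota_star hC) (repM hpi).
  by rewrite (rep_starl hpi) inner_ge0.
(* a n Om is the orthogonal projection of m Om, hence its best approximation *)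
have lim : tends (fun n => pi (iota (a n)) Om) (m Om).
  move=> e e0; have e2 : 0 < e / 2 by rewrite divr_gt0.
  have /denseP/(_ (m Om) _ e2)[_ [c _ <-] mc] := cyc.
  have e4 : 0 < e / 2 / 2 by rewrite divr_gt0.
  have [N [b' cb]] := car_dense hC c e4; exists N => n Nn.
  have [b bE] := iota_lift hC b' Nn.
  have mb : `|m Om - pi (iota b) Om| <= e.
    rewrite (splitr e) -(subrKA (pi c Om)) (le_trans (ler_normD _ _))// lerD//.
      exact: ltW.
    rewrite bE -(repB hpi); apply: le_trans (rep_cnorm Om hpi e4 cb) _.
    by rewrite trace_vector_norm mulr1 mulrC divfK.
  apply: le_trans mb; rewrite -(ler_pXn2r (n := 2)) ?nnegrE// distrC !normE.
  have -> : m Om - pi (iota b) Om =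
      (m Om - pi (iota (a n)) Om) + pi (iota (a n - b)) Om.
    by rewrite (iotaB hC) (repB hpi) subrKA.
  have o : <<m Om - pi (iota (a n)) Om, pi (iota (a n - b)) Om>> = 0.
    by rewrite innerBl aP subrr.
  move: (m Om - _) (pi (iota (a n - b)) Om) o => X Y o.
  rewrite innerDl !innerDr o addr0 [<<Y, X>>]inner_conj o.
  by rewrite rmorph0 add0r lerDl inner_ge0.
exists (fun n => iota (a n)) => x.
apply: (tends_closure k0 bd kP (V := range (fun b => pi b Om))) => [_ [b _ <-]|e e0].
  have [T [cT TE _]] := right_mult gns traceC b.
  rewrite (vn_right_mult gns Mm cT TE).
  apply: (@eq_tends _ _ _ (fun n => T (pi (iota (a n)) Om))).
    by move=> n; rewrite (vn_right_mult gns (Mr _) cT TE).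
  exact: tends_bop.
by have /denseP/(_ x _ e0) := cyc.
Qed.

Lemma vn_sot_closure : M `<=` sot_closure (range pi).
Proof.
move=> m /vn_bounded_approx[a am] xs e e0.
have e2 : 0 < e / 2 by rewrite divr_gt0.
suff [N NP] : exists N, forall n, (N <= n)%N -> forall x, x \in xs ->
    `|m x - pi (a n) x| <= e / 2.
  exists (pi (a N)); first by exists (a N).
  move=> x /(NP N (leqnn _)) /le_lt_trans; apply.
  by rewrite ltr_pdivrMr// ltr_pMr// -[X in X < _]/(1%:R) ltr_nat.
elim: xs => [|x xs [N NP]]; first by exists 0%N.
have [K KP] := am x _ e2; exists (maxn N K) => n; rewrite geq_max => /andP[Nn Kn] y.
by rewrite inE => /orP[/eqP->|]; [rewrite distrC KP|exact: NP].
Qed.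

End TraceFactor.

(** * Excision of the corner state *)

Lemma tensmx_delta (S : comPzRingType) m n p q (i : 'I_m) (j : 'I_n) (k : 'I_p) (l : 'I_q) :
  (delta_mx i j : 'M[S]_(m, n)) *t (delta_mx k l : 'M[S]_(p, q)) =
  delta_mx (mxtens_index (i, k)) (mxtens_index (j, l)).
Proof.
apply/matrixP => x y.
case: (mxtens_indexP x) => x1 x2; case: (mxtens_indexP y) => y1 y2.
rewrite tensmxE !mxE !(can_eq (@mxtens_indexK _ _)) !xpair_eqE -natrM mulnb.
by rewrite andbACA.
Qed.

Lemma star_hom_comp (R : realType) (A B : starAlgType R[i]) (H : hilbertType R)
    (f : A -> B) (g : B -> 'B(H)) :
  star_hom f -> star_hom g -> star_hom (g \o f).
Proof.
move=> [fl f1 fM fs] [gl g1 gM gs]; split=> /=.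
- by move=> k x y /=; rewrite fl gl.
- by rewrite f1.
- by move=> x y; rewrite fM gM.
- by move=> x; rewrite fs gs.
Qed.

Lemma star_hom_projection (R : realType) (A : starAlgType R[i]) (H : hilbertType R)
    (sigma : A -> 'B(H)) p :
  star_hom sigma -> is_projection p -> is_projection (sigma p).
Proof.
move=> hs [ps pp]; split; first by rewrite -(star_hom_star hs) ps.
by rewrite -(star_homM hs) pp.
Qed.

Lemma decreasing_cauchy (R : realType) (u : nat -> R[i]) :
  (forall n, 0 <= u n) -> (forall m n, (m <= n)%N -> u n <= u m) ->
  forall e : R[i], 0 < e -> exists N, forall n, (N <= n)%N -> u N - u n <= e.
Proof.
move=> u0 ud e e0.
have uE n : u n = (complex.Re (u n))%:C.
  by have := u0 n; rewrite lecE /=; case: (u n) => x y /= /andP[/eqP -> _].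
have eE : e = (complex.Re e)%:C.
  by move: e0; rewrite ltcE /=; case: (e) => x y /= /andP[/eqP -> _].
have e0' : 0 < complex.Re e by move: e0; rewrite ltcE => /andP[].
pose A := range (fun n => complex.Re (u n)).
have lbA : lbound A 0 by move=> _ [n _ <-]; have := u0 n; rewrite lecE => /andP[].
have iA : has_inf A by split; [exists (complex.Re (u 0%N)), 0%N|exists 0].
have [_ [N _ <-] hN] := inf_adherent e0' iA; exists N => n _.
rewrite (uE N) (uE n) eE -rmorphB /= lecR lerBlDl; apply: le_trans (ltW hN) _.
by rewrite lerD2r; apply: ge_inf; [case: iA|exists n].
Qed.

Section Corner.
Variables (R : realType) (C : cstarAlgType R[i]).
Variables (iota : forall n, 'M[R[i]]_(car_dim n) -> C) (hC : is_CAR iota).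
Variables (phi : C -> R[i]) (hphi : is_corner_state iota phi).

Local Notation q := (corner_proj iota).

Lemma corner_delta (K : numClosedFieldType) n : exists i,
  tens_mx (fun=> delta_mx 0 0 : 'M[K]_2) n = delta_mx i i.
Proof.
elim: n => [|n [i IH]]; first by exists 0; apply/matrixP => i j; rewrite !mxE !ord1.
by exists (mxtens_index (i, 0)); rewrite /= IH tensmx_delta.
Qed.

Lemma corner_projection n : is_projection (q n).
Proof.
have [i E] := corner_delta R[i] n; rewrite /corner_proj E; split.
  by rewrite -(iota_star hC) map_delta_mx trmx_delta.
by rewrite -(iotaM hC) mul_delta_mx.
Qed.

Lemma corner_le m n : (m <= n)%N -> q n * q m = q n /\ q m * q n = q n.
Proof.
move=> mn; have r : q n * q m = q n.
  elim: n mn => [|n IH]; first by rewrite leqn0 => /eqP->; case: (corner_projection 0).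
  rewrite leq_eqVlt => /orP[/eqP->|mn]; first by case: (corner_projection n.+1).
  have S : q n.+1 * q n = q n.+1.
    rewrite /corner_proj -(iotaS hC (tens_mx _ n)) -(iotaM hC) /= tensmx_mul mulmx1.
    by have [i ->] := corner_delta R[i] n; rewrite mul_delta_mx.
  by rewrite -{1}S -mulrA IH// S.
split=> //; have [sn _] := corner_projection n; have [sm _] := corner_projection m.
by have := congr1 star r; rewrite starM sn sm.
Qed.

(** The m-th projection is minimal in the m-th algebra and majorizes the later
    ones. *)
Lemma corner_compress m (a : 'M[R[i]]_(car_dim m)) : exists c : R[i],
  forall n, (m <= n)%N -> q n * iota a * q n = c *: q n.
Proof.
have [i E] := corner_delta R[i] m; exists (a i i) => n mn.
have [nm mn'] := corner_le mn; rewrite -{1}nm -{2}mn' !mulrA.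
have -> : q n * q m * iota a * q m = q n * (q m * iota a * q m) by rewrite !mulrA.
have -> : q m * iota a * q m = a i i *: q m.
  rewrite /corner_proj E -!(iotaM hC) -(iotaZ hC); congr iota.
  apply/matrixP => x y; rewrite !mxE (bigD1 i)//= big1 ?addr0 => [|z zi]; last first.
    by rewrite [X in _ * X]mxE (negPf zi) mulr0.
  rewrite [X in X * _]mxE (bigD1 i)//= big1 ?addr0 => [|z zi]; last first.
    by rewrite mxE (negPf zi) andbF mul0r.
  by rewrite !mxE !eqxx andbT mulrAC mulrC -natrM mulnb.
by rewrite -scalerAr -scalerAl nm (corner_projection n).2.
Qed.

Lemma corner_state1 n : phi (q n) = 1.
Proof.
case: hphi => _ h; rewrite /corner_proj h big1// => i _.
by rewrite mxE eqxx.
Qed.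

Section CornerVector.
Variables (X : hilbertType R) (sigma : C -> 'B(X)) (xi : X).
Hypothesis gns : gns_triple phi sigma xi.

Let hs : star_hom sigma. Proof. by case: gns. Qed.
Let cyc : dense (range (fun a => sigma a xi)). Proof. by case: gns. Qed.
Let phiE a : phi a = <<sigma a xi, xi>>. Proof. by case: gns. Qed.

Lemma corner_norm : `|xi| = 1.
Proof.
apply/eqP; rewrite -(eqrXn2 (n := 2))// normE -{1}[xi](rep1 hs) -phiE expr1n.
by case: hphi => -[_ _ ->].
Qed.

Lemma corner_fixed n : sigma (q n) xi = xi.
Proof.
have hp := star_hom_projection hs (corner_projection n).
have h : <<sigma (q n) xi, xi>> = 1 by rewrite -phiE corner_state1.
have h' : <<xi, sigma (q n) xi>> = 1 by rewrite inner_conj h rmorph1.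
apply/eqP; rewrite -subr_eq0 -normr_eq0 -sqrf_eq0 normE innerBl !innerBr h h'.
by rewrite -normE -projection_inner// h -normE corner_norm expr1n !subrr.
Qed.

Lemma corner_state_bounded x (e : R[i]) : 0 < e -> cnorm x <= e -> `|phi x| <= 2 * e.
Proof.
move=> e0 xe; rewrite phiE; apply: le_trans (cauchy_schwarz _ _) _.
rewrite corner_norm mulr1; apply: le_trans (rep_cnorm xi hs e0 xe) _.
by rewrite corner_norm mulr1.
Qed.

(** The corner projections compress each matrix to a multiple of themselves,
    and evaluating the state identifies the multiple. *)
Lemma excision (Y : hilbertType R) (pi : C -> 'B(Y)) (c : C) : star_hom pi ->
  forall e : R[i], 0 < e -> exists N, forall n, (N <= n)%N -> forall y,
    `|pi (q n * c * q n) y - phi c *: pi (q n) y| <= e * `|y|.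
Proof.
move=> hp e e0; have e4 : 0 < e / 4 by rewrite divr_gt0.
have [m [a ca]] := car_dense hC c e4; exists m => n mn y.
have [k kP] := corner_compress a.
have kE : phi (iota a) = k.
  have := congr1 (fun x => <<sigma x xi, xi>>) (kP n mn).
  rewrite !(repM hs) (repZ hs) corner_fixed -(rep_starr hs).
  have [-> _] := corner_projection n.
  by rewrite corner_fixed innerZl -phiE -normE corner_norm expr1n mulr1.
have pc z : `|pi (q n) z| <= `|z|.
  exact/projection_contraction/star_hom_projection/corner_projection.
have -> : pi (q n * c * q n) y - phi c *: pi (q n) y =
    pi (q n) (pi (c - iota a) (pi (q n) y)) - (phi (c - iota a)) *: pi (q n) y.
  have -> : phi (c - iota a) = phi c - k.
    by rewrite phiE (repB hs) innerBl -!phiE kE.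
  rewrite -!(repM hp) mulrBr mulrBl (repB hp) scalerBl subrACA.
  have -> : pi (q n * iota a * q n) y = k *: pi (q n) y by rewrite kP// (repZ hp).
  by rewrite subrr subr0.
have -> : e = 2 * (e / 4) + 2 * (e / 4) by field.
rewrite mulrDl; apply: le_trans (ler_normB _ _) _; rewrite lerD//.
  apply: le_trans (pc _) _; apply: le_trans (rep_cnorm _ hp e4 ca) _.
  by rewrite ler_wpM2l// mulr_ge0// ltW.
rewrite normrZ ler_pM//; exact: corner_state_bounded.
Qed.

(** On the orbit of the GNS vector this is excision, since the projections fix
    that vector; contractivity extends it to the whole space. *)
Lemma corner_limit x : tends (fun n => sigma (q n) x) (<<x, xi>> *: xi).
Proof.
have pc n z : `|sigma (q n) z| <= 1 * `|z|.
  by rewrite mul1r; exact/projection_contraction/star_hom_projection/corner_projection.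
have pr : opnorm_le (rank_one xi xi) 1.
  move=> z /=; rewrite normrZ corner_norm mulr1 mul1r.
  by apply: le_trans (cauchy_schwarz _ _) _; rewrite corner_norm mulr1.
rewrite -[_ *: xi]/(rank_one xi xi x).
apply: (tends_closure ler01 pc pr (V := range (fun a => sigma a xi))); last first.
  by move=> e e0; have /denseP/(_ x _ e0) := cyc.
move=> _ [a _ <-] e e0; have [N NP] := excision a hs e0.
exists N => n /NP/(_ xi); rewrite !(repM hs) !corner_fixed corner_norm mulr1.
by rewrite phiE.
Qed.

(** An invariant subspace not orthogonal to the GNS vector contains it, by the
    limit above; otherwise it is orthogonal to the whole orbit. *)
Lemma corner_irreducible : irreducible_rep sigma.
Proof.
split=> // V [V0 Vl Vc] Vinv.
have [[x Vx xxi]|no] := EM (exists2 x, V x & <<x, xi>> != 0).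
  right; have Vxi : V xi.
    have : V (<<x, xi>> *: xi).
      by apply: closed_tends Vc _ (corner_limit x) => n; exact: Vinv.
    move=> h; have := Vl (<<x, xi>>^-1) _ _ h V0.
    by rewrite addr0 scalerA mulVf// scale1r.
  apply/seteqP; split=> // z _; have /closedP := Vc; apply=> e e0.
  have /denseP/(_ z _ e0)[_ [a _ <-] za] := cyc.
  by exists (sigma a xi) => //; exact: Vinv.
left; apply/seteqP; split=> [x Vx|_ ->//].
apply: (cyclic_orth gns) => a; rewrite -[a]starK (rep_starr hs).
have [//|h] := eqVneq (<<sigma (star a) x, xi>>) 0.
by exfalso; apply: no; exists (sigma (star a) x) => //; exact: Vinv.
Qed.

End CornerVector.

(** The squared distances telescope because the projections decrease; so the
    vectors converge, and their limit is fixed by all the projections. *)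
Lemma corner_limit0 (X : hilbertType R) (sigma : C -> 'B(X)) : star_hom sigma ->
  (forall eta, (forall n, sigma (q n) eta = eta) -> eta = 0) ->
  forall x, tends (fun n => sigma (q n) x) 0.
Proof.
move=> hs h x.
have hp n := star_hom_projection hs (corner_projection n).
have le m n z : (m <= n)%N -> sigma (q n) (sigma (q m) z) = sigma (q n) z.
  by move=> mn; rewrite -(repM hs) (corner_le mn).1.
have sq m n : (m <= n)%N -> `|sigma (q m) x - sigma (q n) x| ^+ 2 =
    `|sigma (q m) x| ^+ 2 - `|sigma (q n) x| ^+ 2.
  move=> mn; rewrite -[in LHS](le m n)//; set y := sigma (q m) x.
  rewrite normE innerBl !innerBr -normE [<<y, sigma _ y>>]inner_conj projection_inner//.
  have /CrealP -> : `|sigma (q n) y| ^+ 2 \is Num.real by rewrite ger0_real// exprn_ge0.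
  by rewrite -[<<sigma (q n) y, _>>]normE subrr subr0 /y le.
have [|l xl] := @cauchy_tends _ X (fun n => sigma (q n) x).
  move=> e e0; have e2 : 0 < e / 2 by rewrite divr_gt0.
  have [||N NP] := @decreasing_cauchy R (fun n => `|sigma (q n) x| ^+ 2) _ _ _
    (exprn_gt0 2 e2).
  - by move=> n; rewrite exprn_ge0.
  - by move=> m n mn; rewrite -subr_ge0 -sq// exprn_ge0.
  have close n : (N <= n)%N -> `|sigma (q N) x - sigma (q n) x| <= e / 2.
    move=> Nn; have d : `|sigma (q N) x - sigma (q n) x| ^+ 2 <= (e / 2) ^+ 2.
      by rewrite sq ?NP.
    by rewrite (ler_pXn2r (n := 2)) ?nnegrE ?(ltW e2)// in d.
  exists N => m n Nm Nn; rewrite -(subrKA (sigma (q N) x)) (splitr e).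
  by rewrite (le_trans (ler_normD _ _))// lerD ?close// distrC close.
suff l0 : l = 0 by rewrite l0 in xl.
apply: h => k; apply: (tends_unique _ xl).
apply: (tends_eventually (v := fun n => sigma (q k) (sigma (q n) x))).
  by exists k => n kn; rewrite -(repM hs) (corner_le kn).2.
exact: tends_bop xl.
Qed.

End Corner.

(** * The reduced atomic representation *)

(** The closure of a nonzero orbit is an invariant subspace. *)
Lemma orbit_dense (R : realType) (A : starAlgType R[i]) (H : hilbertType R)
    (sigma : A -> 'B(H)) eta :
  irreducible_rep sigma -> eta != 0 -> dense (range (fun a => sigma a eta)).
Proof.
move=> [hs irr] e0; pose V := closure (range (fun a => sigma a eta)).
have [||V0|VT] := irr V.
- split; first by apply: subset_closure; exists 0 => //; exact: (rep0 hs).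
    move=> k x y /closureP Vx /closureP Vy; apply/closureP => e e1.
    have e2 : 0 < e / 2 by rewrite divr_gt0.
    have k1 : 0 < `|k| + 1 by rewrite ltr_wpDl.
    have [_ [a _ <-] xa] := Vx _ (divr_gt0 e2 k1).
    have [_ [b _ <-] yb] := Vy _ e2.
    exists (sigma (k *: a + b) eta); first by exists (k *: a + b).
    rewrite (repD hs) (repZ hs) opprD addrACA -scalerBr (splitr e).
    apply: le_lt_trans (ler_normD _ _) _; apply: ler_ltD => //.
    rewrite normrZ; apply: le_trans (_ : (`|k| + 1) * `|x - sigma a eta| <= _).
      by rewrite ler_wpM2r// lerDl.
    by rewrite -ler_pdivlMl// mulrC ltW.
  exact: closed_closure.
- move=> a x /closureP Vx; apply/closureP => e e0'.
  have [c c0 cP] := bop_boundP (sigma a).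
  have c1 : 0 < c + 1 by rewrite ltr_wpDl.
  have [_ [b _ <-] xb] := Vx _ (divr_gt0 e0' c1).
  exists (sigma (a * b) eta); first by exists (a * b).
  rewrite (repM hs) -linearB /=; apply: le_lt_trans (cP _) _.
  apply: le_lt_trans (_ : (c + 1) * `|x - sigma b eta| < _).
    by rewrite ler_wpM2r// lerDl.
  by rewrite -ltr_pdivlMl// mulrC.
- have : V eta by apply: subset_closure; exists 1 => //; exact: (rep1 hs).
  by rewrite V0 /= => /eqP; rewrite (negPf e0).
apply/denseP => x e e1.
have : V x by rewrite VT.
by move/closureP => /(_ e e1).
Qed.

Lemma equivalent_refl (R : realType) (A : starAlgType R[i]) (H : hilbertType R)
  (sigma : A -> 'B(H)) : unitarily_equivalent sigma sigma.
Proof.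
exists (bop_id H); split; first by split; exact: bop_ext.
by move=> a; exact: bop_ext.
Qed.

Section PureStates.
Variables (R : realType) (C : cstarAlgType R[i]).
Variables (iota : forall n, 'M[R[i]]_(car_dim n) -> C) (hC : is_CAR iota).
Variables (I : Type) (r : I) (phi : I -> C -> R[i]).
Hypothesis hphir : is_corner_state iota (phi r).
Variables (H_ : I -> hilbertType R) (pi_ : forall i, C -> 'B(H_ i)) (xi : forall i, H_ i).
Arguments pi_ : clear implicits.
Hypothesis gnsphi : forall i, gns_triple (phi i) (pi_ i) (xi i).
Hypothesis hclasses : forall (K : hilbertType R) (sigma : C -> 'B(K)),
  irreducible_rep sigma -> exists! i, unitarily_equivalent sigma (pi_ i).
Variable alpha : I -> C -> C.
Hypothesis halpha : forall i, star_automorphism (alpha i).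
Hypothesis hphialpha : forall i a, phi i (alpha i a) = phi r a.

Local Notation q := (corner_proj iota).
Local Notation p i n := (alpha i (q n)).

Let hom i : star_hom (pi_ i). Proof. by case: (gnsphi i). Qed.
Let ahom i : star_hom (alpha i). Proof. by case: (halpha i). Qed.

Lemma alpha_surj i a : exists b, alpha i b = a.
Proof. by case: (halpha i) => _ [f _ fK]; exists (f a). Qed.

(** Composing with the automorphism turns every chosen pure state into the
    corner state, so that a single excision argument serves all of them. *)
Lemma twisted_gns i : gns_triple (phi r) (pi_ i \o alpha i) (xi i).
Proof.
split; first exact: star_hom_comp.
  have [_ d _] := gnsphi i; apply/denseP => x e e0.
  have /denseP/(_ x e e0)[_ [a _ <-] xa] := d.
  have [b ba] := alpha_surj i a.
  by exists (pi_ i a (xi i)) => //; exists b => //=; rewrite ba.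
by move=> a /=; rewrite -(hphialpha i); case: (gnsphi i).
Qed.

Lemma gns_vector_norm i : `|xi i| = 1.
Proof. exact: (corner_norm hphir (twisted_gns i)). Qed.

Lemma pure_irreducible i : irreducible_rep (pi_ i).
Proof.
have [_ irr] := corner_irreducible hC hphir (twisted_gns i).
by split=> // V Vc Vinv; apply: irr => // a x; exact: Vinv.
Qed.

Lemma pure_inequivalent i k : unitarily_equivalent (pi_ k) (pi_ i) -> i = k.
Proof.
have [j [_ ju]] := hclasses (pure_irreducible k).
by move=> /ju <-; apply: ju; exact: equivalent_refl.
Qed.

Lemma pure_limit i x : tends (fun n => pi_ i (p i n) x) (<<x, xi i>> *: xi i).
Proof. exact: (corner_limit hC hphir (twisted_gns i) x). Qed.

(** A vector fixed by all the projections attached to the i-th state would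
    induce that state, hence a second copy of the i-th representation. *)
Lemma pure_limit0 i k x : i <> k -> tends (fun n => pi_ k (p i n) x) 0.
Proof.
move=> ik; have hs := star_hom_comp (ahom i) (hom k).
apply: (corner_limit0 hC hs) => eta etaP; apply/eqP; apply: contraT => eta0.
exfalso; apply: ik; apply: pure_inequivalent.
pose z := `|eta|^-1 *: eta.
have z1 : <<z, z>> = 1.
  rewrite -normE normrZ ger0_norm ?invr_ge0// mulVf ?expr1n//.
  by rewrite normr_eq0.
have zfix n : (pi_ k \o alpha i) (q n) z = z.
  by rewrite /z linearZ /= -[X in _ *: X = _]/((pi_ k \o alpha i) (q n) eta) etaP.
have z0 : z != 0 by rewrite scaler_eq0 negb_or invr_eq0 normr_eq0 eta0.
have st a : <<pi_ k (alpha i a) z, z>> = phi r a.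
  apply: (@tends_unique _ _ (fun=> <<pi_ k (alpha i a) z, z>>)).
    exact: tends_cst.
  have h : tends (fun n => (pi_ k \o alpha i) (q n * a * q n) z) (phi r a *: z).
    move=> e e0; have [N NP] := excision hC hphir (twisted_gns i) a hs e0.
    have nz : `|z| = 1.
      by apply/eqP; rewrite -(eqrXn2 (n := 2))// normE z1 expr1n.
    by exists N => n /NP/(_ z); rewrite zfix nz mulr1.
  have := tends_inner h (tends_cst z); rewrite innerZl z1 mulr1.
  apply: eq_tends => n; rewrite !(repM hs) zfix -(rep_starr hs).
  by have [-> _] := corner_projection hC n; rewrite zfix.
apply: (@same_state_equivalent _ _ _ _ _ _ z (xi i)).
- exact: hom.
- exact: hom.
- exact: orbit_dense (pure_irreducible k) z0.
- by case: (gnsphi i).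
- move=> a; have [b <-] := alpha_surj i a; rewrite st -(hphialpha i).
  by case: (gnsphi i).
Qed.

Variables (H : hilbertType R) (inc : forall i, bop (H_ i) H).
Hypothesis hinc : hilbert_direct_sum inc.
Variable Pi : C -> 'B(H).
Hypothesis hPi : forall a i x, Pi a (inc i x) = inc i (pi_ i a x).
Local Notation zeta i := (inc i (xi i)).

Let inc_inner i x y : <<inc i x, inc i y>> = <<x, y>>. Proof. by case: hinc. Qed.
Let inc_orth i k x y : i <> k -> <<inc i x, inc k y>> = 0.
Proof. by case: hinc => _ h _ /h. Qed.

Lemma direct_sum_closure (V : set H) : V 0 ->
  (forall (k : R[i]) x y, V x -> V y -> V (k *: x + y)) ->
  (forall x, (forall e : R[i], 0 < e -> exists2 y, V y & `|x - y| < e) -> V x) ->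
  (forall i x, V (inc i x)) -> forall x, V x.
Proof.
move=> V0 Vl Vc Vi x; case: hinc => _ _ h; rewrite (h V)//; split=> //.
exact/closedP.
Qed.

Lemma direct_sum_inner_ext u v : (forall i x, <<u, inc i x>> = <<v, inc i x>>) -> u = v.
Proof.
move=> uv; apply: innerrI => z; rewrite inner_conj [RHS]inner_conj; congr Num.conj.
move: z; apply: direct_sum_closure => //.
- by rewrite !inner0r.
- by move=> k x y ux uy; rewrite !innerDr !innerZr ux uy.
move=> x h; apply/eqP; rewrite -subr_eq0 -innerBl -normr_eq0 eq_le normr_ge0 andbT.
apply/ler_addgt0Pl => e e0; rewrite addr0.
have c1 : 0 < `|u - v| + 1 by rewrite ltr_wpDl.
have [y uvy xy] := h _ (divr_gt0 e0 c1).
have -> : <<u - v, x>> = <<u - v, x - y>>.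
  by rewrite innerBr [<<u - v, y>>]innerBl uvy subrr subr0.
apply: le_trans (cauchy_schwarz _ _) _.
apply: le_trans (_ : (`|u - v| + 1) * `|x - y| <= _).
  by rewrite ler_wpM2r// lerDl.
by rewrite -ler_pdivlMl// mulrC ltW.
Qed.

Lemma direct_sum_ext (S T : 'B(H)) : (forall i x, S (inc i x) = T (inc i x)) -> S = T.
Proof.
move=> ST; rewrite -[S]starK -[T]starK; congr star; apply: bop_ext => v.
by apply: direct_sum_inner_ext => i x; rewrite !star_bopl ST.
Qed.

Lemma direct_sum_rep : star_hom Pi.
Proof.
split.
- move=> k a b; apply: direct_sum_ext => i x.
  by rewrite /= !hPi (repD (hom i)) (repZ (hom i)) linearP.
- by apply: direct_sum_ext => i x; rewrite hPi (rep1 (hom i)).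
- by move=> a b; apply: direct_sum_ext => i x; rewrite /= !hPi (repM (hom i)).
- move=> a; apply: direct_sum_ext => i x; apply: direct_sum_inner_ext => k y.
  rewrite star_bopl !hPi.
  have [ik|ik] := EM (i = k); last by rewrite !inc_orth.
  by subst k; rewrite !inc_inner (rep_starl (hom i)).
Qed.

Let hP := direct_sum_rep.

Lemma direct_sum_vector_norm i : `|zeta i| = 1.
Proof.
apply/eqP; rewrite -(eqrXn2 (n := 2))// normE inc_inner -normE.
by rewrite gns_vector_norm.
Qed.

Lemma p_projection i n : is_projection (p i n).
Proof.
have [s pp] := corner_projection hC n.
by split; [rewrite -(star_hom_star (ahom i)) s|rewrite -(star_homM (ahom i)) pp].
Qed.

Lemma p_le i m n : (m <= n)%N -> p i n * p i m = p i n /\ p i m * p i n = p i n.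
Proof.
by move=> /(corner_le hC)[nm mn]; rewrite -!(star_homM (ahom i)) nm mn.
Qed.

Lemma Pi_p_fixed i n : Pi (p i n) (zeta i) = zeta i.
Proof.
by rewrite hPi; congr (inc i _); exact: (corner_fixed hC hphir (twisted_gns i)).
Qed.

(** Only the i-th component contributes to the limit, because the states are
    pairwise inequivalent. *)
Lemma Pi_p_limit i x : tends (fun n => Pi (p i n) x) (rank_one (zeta i) (zeta i) x).
Proof.
have pc n z : `|Pi (p i n) z| <= 1 * `|z|.
  rewrite mul1r; apply/projection_contraction/star_hom_projection => //.
  exact: p_projection.
have pr : opnorm_le (rank_one (zeta i) (zeta i)) 1.
  move=> z /=; rewrite normrZ direct_sum_vector_norm mulr1 mul1r.
  by apply: le_trans (cauchy_schwarz _ _) _; rewrite direct_sum_vector_norm mulr1.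
move: x; apply: direct_sum_closure.
- rewrite linear0; apply: (@eq_tends _ _ _ (fun=> 0)); last exact: tends_cst.
  by move=> n; rewrite linear0.
- move=> k x y hx hy; rewrite linearP.
  apply: (@eq_tends _ _ _ (fun n => k *: Pi (p i n) x + Pi (p i n) y)).
    by move=> n; rewrite linearP.
  by apply: tendsD => //; exact: tendsZ.
- by move=> x; apply: (tends_closure ler01 pc pr).
move=> k x /=; apply: (@eq_tends _ _ _ (fun n => inc k (pi_ k (p i n) x))).
  by move=> n; rewrite hPi.
have [ki|ki] := EM (k = i).
  by subst k; rewrite inc_inner -linearZ; apply: tends_bop; exact: pure_limit.
rewrite inc_orth// scale0r -(linear0 (inc k)); apply: tends_bop.
by apply: pure_limit0 => ik; apply: ki.
Qed.

End PureStates.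

(** * Partial isometries between decreasing projections *)

(** The w n are partial isometries from the steps of p onto the steps of q.
    The steps are orthogonal, so the partial sums of w are again partial
    isometries, and cutting them by 1 - p m or 1 - q m truncates the sum. *)
Section Ladder.
Variables (R : realType) (C : cstarAlgType R[i]).
Variables (p q w : nat -> C).
Hypothesis p0 : p 0%N = 1.
Hypothesis q0 : q 0%N = 1.
Hypothesis pP : forall n, is_projection (p n).
Hypothesis qP : forall n, is_projection (q n).
Hypothesis ple : forall m n, (m <= n)%N -> p n * p m = p n /\ p m * p n = p n.
Hypothesis qle : forall m n, (m <= n)%N -> q n * q m = q n /\ q m * q n = q n.
Hypothesis ww : forall n, star (w n) * w n = p n - p n.+1.
Hypothesis ww' : forall n, w n * star (w n) = q n - q n.+1.

Local Notation s N := (\sum_(n < N) w n).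

Lemma cstar_sqr_eq0 (x : C) : star x * x = 0 -> x = 0.
Proof.
move=> x0; apply: cnorm0_eq0; apply/eqP; rewrite -sqrf_eq0 -cnorm_starM x0.
apply/eqP; have := cnormZ 0 (0 : C).
by rewrite scale0r normr0 mul0r.
Qed.

Lemma ladder_initial n : w n * (p n - p n.+1) = w n.
Proof.
have [pn1 pn2] := ple (leqnSn n).
apply/eqP; rewrite -subr_eq0; apply/eqP; apply: cstar_sqr_eq0.
have es : star (p n - p n.+1) = p n - p n.+1.
  by rewrite starB (pP n).1 (pP n.+1).1.
have ee : (p n - p n.+1) * (p n - p n.+1) = p n - p n.+1.
  by rewrite mulrBl !mulrBr pn1 pn2 (pP n).2 (pP n.+1).2 subrr subr0.
move: (p n - p n.+1) es ee (ww n) => e es ee we.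
rewrite starB starM es mulrBl !mulrBr -!mulrA [star (w n) * (w n * _)]mulrA !we.
by rewrite !ee !subrr.
Qed.

Lemma ladder_final n : (q n - q n.+1) * w n = w n.
Proof. by rewrite -ww' -mulrA ww ladder_initial. Qed.

Lemma ladder_mulp n m : w n * (1 - p m) = if (n < m)%N then w n else 0.
Proof.
rewrite -ladder_initial -mulrA mulrBr mulr1; case: ltnP => nm.
  by rewrite mulrBl (ple (ltnW nm)).2 (ple nm).2 subrr subr0.
by rewrite mulrBl (ple nm).1 (ple (leqW nm)).1 subrr mulr0.
Qed.

Lemma ladder_mulq n m : (1 - q m) * w n = if (n < m)%N then w n else 0.
Proof.
rewrite -ladder_final mulrA mulrBl mul1r; case: ltnP => nm.
  by rewrite mulrBr (qle (ltnW nm)).1 (qle nm).1 subrr subr0.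
by rewrite mulrBr (qle nm).2 (qle (leqW nm)).2 subrr mul0r.
Qed.

Lemma sum_ladder_lt M N : (M <= N)%N ->
  \sum_(n < N) (if (n < M)%N then w n else 0) = s M.
Proof.
move=> MN; rewrite -big_mkcond /= -(big_mkord (fun n => (n < M)%N)) -(subnKC MN).
rewrite -(big_mkord predT w) (big_cat_nat (n := M)) ?leq_addr//= -[RHS]addr0; congr (_ + _).
  by rewrite [RHS]big_nat big_nat_cond; apply: eq_bigl => n; rewrite /= andbb.
by rewrite big_nat_cond big1// => n /andP[/andP[Mn _]]; rewrite ltnNge Mn.
Qed.

Lemma ladder_sump M N : (M <= N)%N -> s N * (1 - p M) = s M.
Proof.
move=> MN; rewrite mulr_suml -(sum_ladder_lt MN).
by apply: eq_bigr => n _; exact: ladder_mulp.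
Qed.

Lemma ladder_sumq M N : (M <= N)%N -> (1 - q M) * s N = s M.
Proof.
move=> MN; rewrite mulr_sumr -(sum_ladder_lt MN).
by apply: eq_bigr => n _; exact: ladder_mulq.
Qed.

Lemma ladder_isometry N : star (s N) * s N = 1 - p N.
Proof.
elim: N => [|N IH]; first by rewrite big_ord0 mulr0 p0 subrr.
have cross : star (s N) * w N = 0.
  have /(congr1 star) := ladder_sumq (leqnn N).
  rewrite starM starB star1 (qP N).1 => <-.
  by rewrite -mulrA ladder_mulq ltnn mulr0.
have cross' : star (w N) * s N = 0.
  by rewrite -[s N]starK -starM cross star0.
by rewrite big_ord_recr /= starD mulrDl !mulrDr IH cross cross' ww addr0 add0r subrKA.
Qed.

Lemma ladder_coisometry N : s N * star (s N) = 1 - q N.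
Proof.
elim: N => [|N IH]; first by rewrite big_ord0 mul0r q0 subrr.
have cross : w N * star (s N) = 0.
  have /(congr1 star) := ladder_sump (leqnn N).
  rewrite starM starB star1 (pP N).1 => <-.
  by rewrite mulrA ladder_mulp ltnn mul0r.
have cross' : s N * star (w N) = 0.
  by rewrite -[s N]starK -starM cross star0.
by rewrite big_ord_recr /= starD mulrDl !mulrDr IH cross cross' ww' addr0 add0r subrKA.
Qed.

End Ladder.

(** * Transporting a representation along approximating sequences *)

Lemma tends_inner_norm_lt (R : realType) (H K : hilbertType R) (u : nat -> K)
    (x : H) (e : R[i]) :
  tends (fun n => <<u n, u n>>) <<x, x>> -> `|x| < e ->
  exists N, forall n, (N <= n)%N -> `|u n| <= e.
Proof.
move=> ux xe; have e0 : 0 < e by apply: le_lt_trans xe.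
have d0 : 0 < e ^+ 2 - `|x| ^+ 2 by rewrite subr_gt0 ltr_pXn2r ?nnegrE ?(ltW e0).
have [N NP] := ux _ d0; exists N => n /NP; rewrite -!normE => hn.
rewrite -(ler_pXn2r (n := 2)) ?nnegrE ?(ltW e0)// -[X in X <= _](subrK (`|x| ^+ 2)).
rewrite -lerBrDr; apply: le_trans hn; apply: real_ler_norm.
by rewrite rpredB ?ger0_real ?exprn_ge0.
Qed.

(** Preimages of a convergent sequence of values form a Cauchy sequence, and
    the generated algebra is complete. *)
Lemma closed_range (R : realType) (H K : hilbertType R) (G : set 'B(H))
    (rho : cstar_alg G -> 'B(K)) : star_hom rho ->
  (forall x (c : R[i]), opnorm_le (rho x) c -> opnorm_le (cstar_val x) c) ->
  cstar_subalgebra (range rho).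
Proof.
move=> hr below; split; first split.
- by exists 1 => //; exact: (star_hom1 hr).
- move=> k _ _ [x _ <-] [y _ <-]; exists (k *: x + y) => //.
  exact: (star_hom_linear hr).
- by move=> _ _ [x _ <-] [y _ <-]; exists (x * y) => //; exact: (star_homM hr).
- by move=> _ [x _ <-]; exists (star x) => //; exact: (star_hom_star hr).
move=> T h.
have rB x y : rho (x - y) = rho x - rho y.
  by apply: bop_ext => v; rewrite (repB hr) bopB.
have /choice[a aP] : forall n : nat, exists x, opnorm_le (T - rho x) (2 ^+ n)^-1.
  move=> n; have [|_ [x _ <-] Tx] := h (2 ^+ n)^-1.
    by rewrite invr_gt0 exprn_gt0.
  by exists x.
have aT (e : R[i]) : 0 < e -> exists N, forall n, (N <= n)%N -> opnorm_le (T - rho (a n)) e.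
  by move=> /expV2_small[N NP]; exists N => n /NP /opnorm_ler; apply; exact: aP.
have sym (X Y : 'B(K)) e : opnorm_le (X - Y) e -> opnorm_le (Y - X) e.
  by move=> XY v; rewrite bopB distrC -bopB; exact: XY.
have [|l lP] := nle_complete (opnorm_normed G) (u := a).
  move=> e e0; have e2 : 0 < e / 2 by rewrite divr_gt0.
  have [N NP] := aT _ e2; exists N => m n Nm Nn; apply: below.
  rewrite rB (splitr e) -(subrKA T); apply: opnorm_leD; last exact: NP.
  exact/sym/NP.
exists l => //; apply/eqP; rewrite -subr_eq0; apply/eqP/bop_ext => v.
apply/eqP; rewrite -normr_eq0 eq_le normr_ge0 andbT.
apply/ler_addgt0Pl => e e0; rewrite addr0.
have v1 : 0 < `|v| + 1 by rewrite ltr_wpDl.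
have d0 := divr_gt0 e0 v1; set d := e / _ in d0.
have d4 : 0 < d / 4 by rewrite divr_gt0.
have [N1 P1] := aT _ d4; have [N2 P2] := lP _ d4; pose n := maxn N1 N2.
have {}P1 := sym _ _ _ (P1 n (leq_maxl _ _)).
have {}P2 := star_hom_bounded (opnorm_normed G) hr d4 (P2 n (leq_maxr _ _)).
rewrite rB in P2; have P3 := opnorm_leD (sym _ _ _ P2) P1.
rewrite subrKA in P3; apply: le_trans (P3 v) _.
apply: le_trans (_ : d * `|v| <= _); last first.
  by rewrite /d mulrAC ler_pdivrMr// ler_wpM2l ?(ltW e0)// lerDl.
rewrite ler_wpM2r// (_ : 2 * (d / 4) + d / 4 = d - d / 4); last by field.
by rewrite gerBl ltW.
Qed.

Section ApproximatePairs.
Variables (R : realType) (H K : hilbertType R).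
Variable base : (nat -> K) -> H -> Prop.

(** The closed linear span of the base pairs, for the seminorm on sequences
    given by the eventual size.  A pair (v, x) in it records that the vectors
    v n behave, for large n, like the single vector x. *)
Definition pair_span (v : nat -> K) (x : H) : Prop :=
  forall P : (nat -> K) -> H -> Prop,
    (forall v x, base v x -> P v x) ->
    (forall (k : R[i]) v x v' x', P v x -> P v' x' ->
       P (fun n => k *: v n + v' n) (k *: x + x')) ->
    (forall v x, (forall e : R[i], 0 < e -> exists v' x', [/\ P v' x',
       `|x - x'| <= e & exists N, forall n, (N <= n)%N -> `|v n - v' n| <= e]) ->
       P v x) -> P v x.

Lemma pair_ind (P : (nat -> K) -> H -> Prop) :
  (forall v x, base v x -> P v x) ->
  (forall (k : R[i]) v x v' x', P v x -> P v' x' ->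
     P (fun n => k *: v n + v' n) (k *: x + x')) ->
  (forall v x, (forall e : R[i], 0 < e -> exists v' x', [/\ P v' x',
     `|x - x'| <= e & exists N, forall n, (N <= n)%N -> `|v n - v' n| <= e]) ->
     P v x) -> forall v x, pair_span v x -> P v x.
Proof. by move=> Pb Pl Pa v x h; exact: (h P Pb Pl Pa). Qed.

Lemma pair_base v x : base v x -> pair_span v x.
Proof. by move=> b P Pb _ _; exact: Pb. Qed.

Lemma pair_lin (k : R[i]) v x v' x' : pair_span v x -> pair_span v' x' ->
  pair_span (fun n => k *: v n + v' n) (k *: x + x').
Proof. by move=> h h' P Pb Pl Pa; apply: (Pl); [exact: (h P Pb Pl Pa)|exact: (h' P Pb Pl Pa)]. Qed.

Lemma pair_approx v x : (forall e : R[i], 0 < e -> exists v' x',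
    [/\ pair_span v' x', `|x - x'| <= e
      & exists N, forall n, (N <= n)%N -> `|v n - v' n| <= e]) -> pair_span v x.
Proof.
move=> h P Pb Pl Pa; apply: (Pa) => e /h[v' [x' [hp xx' vv']]].
by exists v', x'; split=> //; exact: (hp P Pb Pl Pa).
Qed.

Lemma pair_eventually v v' x : pair_span v x ->
  (exists N, forall n, (N <= n)%N -> v' n = v n) -> pair_span v' x.
Proof.
move=> h [N vv']; apply: pair_approx => e e0; exists v, x; split=> //.
  by rewrite subrr normr0 ltW.
by exists N => n /vv' ->; rewrite subrr normr0 ltW.
Qed.

Hypothesis base_bounded : forall v x, base v x ->
  exists c : R[i], exists N, forall n, (N <= n)%N -> `|v n| <= c.
Hypothesis base_inner : forall v x v' x', base v x -> base v' x' ->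
  tends (fun n => <<v n, v' n>>) <<x, x'>>.

Lemma pair_bounded v x : pair_span v x ->
  exists2 c : R[i], 0 <= c & exists N, forall n, (N <= n)%N -> `|v n| <= c.
Proof.
move: v x; apply: pair_ind => [v x /base_bounded[c [N NP]]|
  k v _ v' _ [c c0 [N NP]] [d d0 [N' NP']]|v x h].
- by exists c; [apply: le_trans (NP N (leqnn _))|exists N].
- exists (`|k| * c + d); first by rewrite addr_ge0// mulr_ge0.
  exists (maxn N N') => n; rewrite geq_max => /andP[nN nN'].
  apply: le_trans (ler_normD _ _) _; rewrite normrZ lerD ?NP'// ler_wpM2l//.
  exact: NP.
have [v' [x' [[c c0 [N NP]] _ [N' NP']]]] := h 1 ltr01.
exists (1 + c); first by rewrite addr_ge0.
exists (maxn N N') => n; rewrite geq_max => /andP[nN nN'].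
rewrite -[v n](subrK (v' n)); apply: le_trans (ler_normD _ _) _.
by rewrite lerD ?NP ?NP'.
Qed.

Lemma pair_inner_bounded (u : nat -> K) (y : H) (c : R[i]) : 0 <= c ->
  (exists N, forall n, (N <= n)%N -> `|u n| <= c) ->
  (forall v x, base v x -> tends (fun n => <<v n, u n>>) <<x, y>>) ->
  forall v x, pair_span v x -> tends (fun n => <<v n, u n>>) <<x, y>>.
Proof.
move=> c0 [M MP] hb; apply: pair_ind => // [k v x v' x' hv hv'|v x h].
  rewrite innerDl innerZl.
  apply: (@eq_tends _ _ _ (fun n => k * <<v n, u n>> + <<v' n, u n>>)).
    by move=> n; rewrite innerDl innerZl.
  apply: tendsD => //; apply: (tends_dom (normr_ge0 k) _ hv).
  by exists 0%N => n _; rewrite -mulrBr normrM.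
apply: tends_approx => e e0.
have c1 : 0 < c + `|y| + 1 by rewrite ltr_wpDl// addr_ge0.
have d0 := divr_gt0 e0 c1; have [v' [x' [hv xx' [N NP]]]] := h _ d0.
have small (a b : R[i]) : a <= e / (c + `|y| + 1) -> 0 <= b -> b <= c + `|y| -> a * b <= e.
  move=> ha b0 hb'; apply: le_trans (ler_wpM2r b0 ha) _.
  by rewrite mulrAC ler_pdivrMr// ler_wpM2l ?(ltW e0)// (le_trans hb')// lerDl.
exists (fun n => <<v' n, u n>>), <<x', y>>; split=> //.
  rewrite -innerBl; apply: le_trans (cauchy_schwarz _ _) _; apply: small => //.
    by rewrite distrC.
  by rewrite lerDr.
exists (maxn N M) => n; rewrite geq_max => /andP[nN nM].
rewrite -innerBl; apply: le_trans (cauchy_schwarz _ _) _.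
by apply: small; [exact: NP|exact: normr_ge0|rewrite (le_trans (MP _ nM))// lerDl].
Qed.

Lemma pair_inner v x v' x' : pair_span v x -> pair_span v' x' ->
  tends (fun n => <<v n, v' n>>) <<x, x'>>.
Proof.
move=> hv hv'; have [c c0 cP] := pair_bounded hv'.
apply: (pair_inner_bounded c0 cP) hv => {}v {}x hb.
have [d d0 dP] := pair_bounded (pair_base hb).
have sw : tends (fun n => <<v' n, v n>>) <<x', x>>.
  apply: (pair_inner_bounded d0 dP) hv' => u y hu.
  exact: base_inner.
apply: (tends_dom ler01 _ sw); exists 0%N => n _; rewrite mul1r.
by rewrite inner_conj [<<x, x'>>]inner_conj -rmorphB norm_conjC.
Qed.

Lemma pair_norm_lt v x (e : R[i]) : pair_span v x -> `|x| < e ->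
  exists N, forall n, (N <= n)%N -> `|v n| <= e.
Proof.
by move=> h; apply: tends_inner_norm_lt; exact: pair_inner.
Qed.

Definition pair_map (S : 'B(H)) (T : 'B(K)) : Prop :=
  forall v x, pair_span v x -> pair_span (fun n => T (v n)) (S x).

Lemma pair_map_base (S : 'B(H)) (T : 'B(K)) :
  (forall v x, base v x -> pair_span (fun n => T (v n)) (S x)) -> pair_map S T.
Proof.
move=> hb; apply: pair_ind => // [k v x v' x' hv hv'|v x h].
  rewrite linearP; apply: (pair_eventually (pair_lin k hv hv')).
  by exists 0%N => n _; rewrite linearP.
apply: pair_approx => e e0.
have [c c0 cP] := bop_boundP S; have [d d0' dP] := bop_boundP T.
have k1 : 0 < c + d + 1 by rewrite ltr_wpDl// addr_ge0.
have [v' [x' [hv xx' [N NP]]]] := h _ (divr_gt0 e0 k1).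
have small (a b : R[i]) : 0 <= b -> a <= e / (c + d + 1) -> b <= c + d -> b * a <= e.
  move=> b0 ha hb'; apply: le_trans (ler_wpM2l b0 ha) _.
  by rewrite mulrCA ger_pMr// ler_pdivrMr// mul1r (le_trans hb')// lerDl.
exists (fun n => T (v' n)), (S x'); split=> //.
  by rewrite -linearB; apply: le_trans (cP _) _; apply: small => //; rewrite lerDl.
exists N => n /NP hn; rewrite -linearB; apply: le_trans (dP _) _.
by apply: small => //; rewrite lerDr.
Qed.

Lemma pair_map1 : pair_map 1 1.
Proof. by []. Qed.

Lemma pair_map_lin (k : R[i]) S T S' T' : pair_map S T -> pair_map S' T' ->
  pair_map (k *: S + S') (k *: T + T').
Proof. by move=> h h' v x hv; exact: pair_lin (h _ _ hv) (h' _ _ hv). Qed.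

Lemma pair_mapM S T S' T' : pair_map S T -> pair_map S' T' -> pair_map (S * S') (T * T').
Proof. by move=> h h' v x hv; exact: h (h' _ _ hv). Qed.

Lemma pair_map_limit (S : 'B(H)) (T : 'B(K)) : (forall e : R[i], 0 < e ->
    exists S' T', [/\ pair_map S' T', opnorm_le (S - S') e & opnorm_le (T - T') e]) ->
  pair_map S T.
Proof.
move=> h v x hv; apply: pair_approx => e e0.
have [c c0 [N NP]] := pair_bounded hv.
have k1 : 0 < c + `|x| + 1 by rewrite ltr_wpDl// addr_ge0.
have d0 := divr_gt0 e0 k1.
have [S' [T' [m SS' TT']]] := h _ d0.
have small (b : R[i]) : b <= c + `|x| -> e / (c + `|x| + 1) * b <= e.
  move=> hb'; rewrite mulrAC ler_pdivrMr// ler_wpM2l ?(ltW e0)// (le_trans hb')//.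
  by rewrite lerDl.
exists (fun n => T' (v n)), (S' x); split; first exact: m.
  by rewrite -bopB; apply: le_trans (SS' x) _; apply: small; rewrite lerDr.
exists N => n /NP hn; rewrite -bopB; apply: le_trans (TT' _) _.
by apply: small; rewrite (le_trans hn)// lerDl.
Qed.

(** An operator that is determined off a line by compatible maps, and maps the
    line compatibly, is compatible: what is missed, the image of the component
    of x orthogonal to the line, becomes small. *)
Lemma pair_map_off_line (X : 'B(H)) (Y : 'B(K)) (sH pH : nat -> 'B(H))
    (sK pK : nat -> 'B(K)) (e f : nat -> K) (z : H) :
  opnorm_le X 1 -> opnorm_le Y 1 ->
  (forall m, pair_map (sH m) (sK m)) -> (forall m, pair_map (pH m) (pK m)) ->
  (forall m, X = sH m + X * pH m) -> (forall m, Y = sK m + Y * pK m) ->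
  pair_span e z -> pair_span f (X z) -> <<z, z>> = 1 ->
  (forall n, Y (e n) = f n) -> (forall m n, (m <= n)%N -> pK m (e n) = e n) ->
  (forall x, tends (fun m => pH m x) (<<x, z>> *: z)) -> pair_map X Y.
Proof.
move=> X1 Y1 sP pP XE YE ez fz z1 ef pe plim v x hv.
apply: pair_approx => eps eps0; pose k := <<x, z>>.
have e2 : 0 < eps / 2 by rewrite divr_gt0.
have e2e : eps / 2 < eps.
  by rewrite ltr_pdivrMr// ltr_pMr// -[X in X < _]/(1%:R) ltr_nat.
have hu := pair_lin (- k) ez hv; set u := fun n => _ in hu; set y := _ + x in hu.
have yz : <<y, z>> = 0 by rewrite /y innerDl innerZl z1 mulr1 addNr.
have [m1 mP1] := plim y _ e2; have [m2 mP2] := plim x _ e2.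
pose m := maxn m1 m2.
have {}mP1 : `|pH m y| < eps.
  have := mP1 m (leq_maxl _ _); rewrite yz scale0r subr0 => /le_lt_trans; exact.
have {}mP2 : `|pH m x - k *: z| <= eps.
  by apply: le_trans (mP2 m (leq_maxr _ _)) _; exact: ltW.
exists (fun n => k *: f n + sK m (v n)), (k *: X z + sH m x); split.
- exact: pair_lin fz (sP m _ _ hv).
- have -> : X x - (k *: X z + sH m x) = X (pH m x - k *: z).
    have -> : X x = X (pH m x) + sH m x by rewrite {1}(XE m) addrC.
    by rewrite [k *: X z + _]addrC addrKA bop_subZ.
  by apply: le_trans (X1 _) _; rewrite mul1r.
have [N NP] := pair_norm_lt (pP m _ _ hu) mP1.
exists (maxn N m) => n; rewrite geq_max => /andP[nN nm].
have -> : Y (v n) - (k *: f n + sK m (v n)) = Y (pK m (u n)).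
  have -> : Y (v n) = Y (pK m (v n)) + sK m (v n) by rewrite {1}(YE m) addrC.
  rewrite [k *: f n + _]addrC addrKA /u addrC scaleNr [_ + v n]addrC.
  by rewrite !bop_subZ pe// ef addrC.
by apply: le_trans (Y1 _) _; rewrite mul1r NP.
Qed.

(** If the first components are dense, compatible operators satisfy the same
    bounds, the norm of S x being the limit of those of T (v n). *)
Lemma pair_map_opnorm (S : 'B(H)) (T : 'B(K)) (c : R[i]) : pair_map S T ->
  (forall (x : H) (e : R[i]), 0 < e -> exists v y, pair_span v y /\ `|x - y| < e) ->
  opnorm_le T c -> opnorm_le S c.
Proof.
move=> hm dns Tc; have c0 := opnorm_le_ge0 Tc.
have bd v y : pair_span v y -> `|S y| <= c * `|y|.
  move=> hv; rewrite norm_le_sqr//.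
  have h1 := pair_inner (hm _ _ hv) (hm _ _ hv); have h2 := pair_inner hv hv.
  have h3 : tends (fun n => c ^+ 2 * <<v n, v n>>) (c ^+ 2 * <<y, y>>).
    apply: (tends_dom (normr_ge0 (c ^+ 2)) _ h2); exists 0%N => n _.
    by rewrite -mulrBr normrM.
  apply: (tends_le h1 h3); rewrite ?ger0_real ?mulr_ge0 ?inner_ge0 ?exprn_ge0//.
  by exists 0%N => n _; rewrite -norm_le_sqr.
move=> x; apply/ler_addgt0Pl => e e0.
have [d d0 dP] := bop_boundP S.
have k1 : 0 < d + c + 1 by rewrite ltr_wpDl// addr_ge0.
have [v [y [hv xy]]] := dns x _ (divr_gt0 e0 k1).
rewrite -[x in S x](subrK y) linearD; apply: le_trans (ler_normD _ _) _.
have yx : `|y| <= `|x| + `|x - y|.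
  by rewrite -[y in X in X <= _](subKr x); exact: ler_normB.
apply: le_trans (_ : d * `|x - y| + (c * `|x - y| + c * `|x|) <= _).
  rewrite lerD ?dP// (le_trans (bd _ _ hv))// -mulrDr ler_wpM2l// addrC.
  exact: yx.
rewrite addrA lerD2r -mulrDl; apply: le_trans (_ : (d + c + 1) * `|x - y| <= _).
  by rewrite ler_wpM2r// lerDl.
by rewrite -ler_pdivlMl// mulrC ltW.
Qed.

End ApproximatePairs.

(** * The algebra generated by the CAR algebra and the unitaries *)

Lemma tends_norm_sqr0 (R : realType) (H : hilbertType R) (u : nat -> H) :
  tends (fun n => `|u n| ^+ 2) 0 -> tends u 0.
Proof.
move=> u0 e e0; have [N NP] := u0 _ (exprn_gt0 2 e0); exists N => n /NP.
by rewrite !subr0 normrX normr_id ler_pXn2r ?nnegrE ?normr_ge0 ?(ltW e0).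
Qed.

(** Every x is the limit of (1 - P n) x plus its component along z, and
    star X * X fixes both terms. *)
Lemma isometry_off_line (R : realType) (H : hilbertType R) (X : 'B(H))
    (P : nat -> 'B(H)) (z : H) :
  (forall x, tends (fun n => P n x) (<<x, z>> *: z)) ->
  (forall n, star X * (X * (1 - P n)) = 1 - P n) -> star X (X z) = z ->
  star X * X = 1.
Proof.
move=> Pz XP Xz; apply: bop_ext => x; rewrite bopM.
pose y n := (1 - P n) x + <<x, z>> *: z.
have yx : tends y x.
  have := tendsD (tendsB (tends_cst x) (Pz x)) (tends_cst (<<x, z>> *: z)).
  by rewrite subrK; apply: eq_tends => n; rewrite /y bopB.
apply: (tends_unique _ yx).
apply: (@eq_tends _ _ _ (fun n => star X (X (y n)))); last first.
  by apply: (@tends_bop _ _ _ (star X)); exact: tends_bop.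
move=> n; have lin (Y : 'B(H)) (k : R[i]) a b : Y (a + k *: b) = Y a + k *: Y b.
  by rewrite addrC linearP addrC.
have e1 : star X (X ((1 - P n) x)) = (1 - P n) x by rewrite -{2}XP.
by rewrite /y (lin X) (lin (star X)) Xz; congr (_ + _); exact: esym e1.
Qed.

Lemma commutant_closed (R : realType) (H : hilbertType R) (S : set 'B(H)) (X : 'B(H)) :
  (forall e : R[i], 0 < e -> exists2 Y, commutant S Y & opnorm_le (X - Y) e) ->
  commutant S X.
Proof.
move=> h y Sy; apply: bop_ext => v; apply/eqP; rewrite -subr_eq0 -normr_eq0.
rewrite eq_le normr_ge0 andbT; apply/ler_addgt0Pl => e e0; rewrite addr0.
have [c c0 cP] := bop_boundP y.
have c1 : 0 < `|y v| + c * `|v| + 1 by rewrite ltr_wpDl// addr_ge0// mulr_ge0.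
have [Y cY XY] := h _ (divr_gt0 e0 c1).
have -> : (X * y) v - (y * X) v = (X - Y) (y v) - y ((X - Y) v).
  rewrite !bopB linearB /= subrACA -[Y (y v)]/((Y * y) v) cY// -[y (Y v)]/((y * Y) v).
  by rewrite subrr subr0.
set d := e / _ in XY; have d0 : 0 <= d by rewrite ltW// divr_gt0.
apply: le_trans (ler_normB _ _) _.
apply: le_trans (_ : d * `|y v| + c * (d * `|v|) <= _).
  by rewrite lerD ?XY// (le_trans (cP _))// ler_wpM2l.
rewrite mulrCA -mulrDr /d mulrAC ler_pdivrMr// ler_wpM2l ?ltW//.
by rewrite ltrDl.
Qed.

Section Realization.
Variables (R : realType) (C : cstarAlgType R[i]).
Variables (iota : forall n, 'M[R[i]]_(car_dim n) -> C) (hC : is_CAR iota).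
Variables (tau : C -> R[i]) (htau : is_trace_state iota tau).
Variables (Htau : hilbertType R) (pitau : C -> 'B(Htau)) (Om : Htau).
Hypothesis gnstau : gns_triple tau pitau Om.
Variables (I : Type) (r : I) (phi : I -> C -> R[i]).
Hypothesis hphir : is_corner_state iota (phi r).
Variables (H_ : I -> hilbertType R) (pi_ : forall i, C -> 'B(H_ i)) (xi : forall i, H_ i).
Arguments pi_ : clear implicits.
Hypothesis gnsphi : forall i, gns_triple (phi i) (pi_ i) (xi i).
Hypothesis hclasses : forall (K : hilbertType R) (sigma : C -> 'B(K)),
  irreducible_rep sigma -> exists! i, unitarily_equivalent sigma (pi_ i).
Variable alpha : I -> C -> C.
Hypothesis halpha : forall i, star_automorphism (alpha i).
Hypothesis hasymp : forall i, asymptotically_inner (alpha i).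
Hypothesis hphialpha : forall i a, phi i (alpha i a) = phi r a.
Hypothesis halphar : forall a, alpha r a = a.
Variable w : I -> nat -> C.
Hypothesis hw : forall i n, star (w i n) * w i n =
  alpha i (corner_proj iota n) - alpha i (corner_proj iota n.+1).
Hypothesis hw' : forall i n, w i n * star (w i n) =
  corner_proj iota n - corner_proj iota n.+1.
Hypothesis hwr : forall n, w r n = corner_proj iota n - corner_proj iota n.+1.
Variables (H : hilbertType R) (inc : forall i, bop (H_ i) H).
Hypothesis hinc : hilbert_direct_sum inc.
Variable Pi : C -> 'B(H).
Hypothesis hPi : forall a i x, Pi a (inc i x) = inc i (pi_ i a x).
Variable S : I -> 'B(H).
Hypothesis hS : forall i x, tends (fun N => Pi (\sum_(n < N) w i n) x) (S i x).
Variable L : I -> 'B(H).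
Hypothesis hL : forall i, L i = S i + rank_one (inc r (xi r)) (inc i (xi i)).

Local Notation q := (corner_proj iota).
Local Notation p i n := (alpha i (q n)).
Local Notation s i N := (\sum_(n < N) w i n).
Local Notation zeta i := (inc i (xi i)).
Local Notation M := (bicommutant (range pitau)).

Let hP : star_hom Pi := direct_sum_rep gnsphi hinc hPi.
Let ht : star_hom pitau. Proof. by case: gnstau. Qed.
Let ahom i : star_hom (alpha i). Proof. by case: (halpha i). Qed.
Let zeta_norm := direct_sum_vector_norm hphir gnsphi halpha hphialpha hinc.
Let zeta_fix := Pi_p_fixed hC hphir gnsphi halpha hphialpha hPi.
Let qP := corner_projection hC.
Let pP := p_projection hC halpha.

Lemma corner_proj0 : q 0%N = 1.
Proof. exact: (iota1 hC 0). Qed.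

Let p0 i : p i 0%N = 1.
Proof. by rewrite corner_proj0 (star_hom1 (ahom i)). Qed.

Let qle m n := @corner_le _ _ _ hC m n.
Let ple i m n := @p_le _ _ _ hC _ _ halpha i m n.

Let s_p i m n : (m <= n)%N -> s i n * (1 - p i m) = s i m.
Proof. exact: (ladder_sump (pP i) (ple i) (hw i)). Qed.

Let s_q i m n : (m <= n)%N -> (1 - q m) * s i n = s i m.
Proof. exact: (ladder_sumq (pP i) (ple i) qle (hw i) (hw' i)). Qed.

Let s_isom i n : star (s i n) * s i n = 1 - p i n.
Proof. exact: (ladder_isometry (p0 i) (pP i) qP (ple i) qle (hw i) (hw' i)). Qed.

Let s_coisom i n : s i n * star (s i n) = 1 - q n.
Proof. exact: (ladder_coisometry corner_proj0 (pP i) (ple i) (hw i) (hw' i)). Qed.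

Let zetar_fix n : Pi (q n) (zeta r) = zeta r.
Proof. by have := zeta_fix r n; rewrite halphar. Qed.

Let zeta_inner i : <<zeta i, zeta i>> = 1.
Proof. by rewrite -normE zeta_norm expr1n. Qed.

Lemma limit_zeta i x : tends (fun n => Pi (p i n) x) (<<x, zeta i>> *: zeta i).
Proof. exact: (Pi_p_limit hC hphir gnsphi hclasses halpha hphialpha hinc hPi i x). Qed.

Lemma limit_zetar x : tends (fun n => Pi (q n) x) (<<x, zeta r>> *: zeta r).
Proof. by apply: eq_tends (limit_zeta r x) => n; rewrite halphar. Qed.

Let Pi1B a v : Pi (1 - a) v = v - Pi a v.
Proof. by rewrite (repB hP) (rep1 hP). Qed.

(** Cutting by 1 - p i m truncates the series of S i, and kills the rank-one
    part because the projection fixes its vector. *)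
Lemma L_initial i m : L i * Pi (1 - p i m) = Pi (s i m).
Proof.
apply: bop_ext => x; rewrite hL bopM.
have SE : S i (Pi (1 - p i m) x) = Pi (s i m) x.
  apply: tends_unique (hS i _) _.
  apply: (tends_eventually (v := fun=> Pi (s i m) x)); last exact: tends_cst.
  by exists m => n mn; rewrite -(repM hP) s_p.
rewrite -[LHS]/(S i _ + <<_, _>> *: _) SE -[<<_, _>>](rep_starr hP) starB star1.
by rewrite (pP i m).1 Pi1B zeta_fix subrr inner0r scale0r addr0.
Qed.

Lemma L_final i m : Pi (1 - q m) * L i = Pi (s i m).
Proof.
apply: bop_ext => x; rewrite hL bopM.
rewrite -[X in Pi _ X]/(S i x + <<_, _>> *: _) linearD linearZ /= Pi1B.
rewrite [X in _ *: X]Pi1B zetar_fix subrr scaler0 addr0 -Pi1B.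
apply: (@tends_unique _ _ (fun n => Pi (1 - q m) (Pi (s i n) x))).
  by apply: tends_bop; exact: hS.
apply: (tends_eventually (v := fun=> Pi (s i m) x)); last exact: tends_cst.
by exists m => n mn; rewrite -(repM hP) s_q.
Qed.

Lemma L_zeta i : L i (zeta i) = zeta r.
Proof.
rewrite hL -[LHS]/(S i _ + <<_, _>> *: _) zeta_inner scale1r.
have -> : S i (zeta i) = 0; last by rewrite add0r.
apply: tends_unique (hS i _) _.
apply: (@eq_tends _ _ _ (fun=> 0)); last exact: tends_cst.
move=> n; rewrite -(s_p i (leqnn n)) (repM hP) Pi1B zeta_fix subrr.
by rewrite linear0.
Qed.

Lemma L_star_zeta i : star (L i) (zeta r) = zeta i.
Proof.
apply: innerlI => x; rewrite star_bopl hL -[X in <<_, X>>]/(S i x + <<_, _>> *: _).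
rewrite innerDr innerZr zeta_inner mulr1 -inner_conj.
have -> : <<zeta r, S i x>> = 0; last by rewrite add0r.
apply: tends_unique (tends_inner (tends_cst (zeta r)) (hS i x)) _.
apply: (@eq_tends _ _ _ (fun=> 0)); last exact: tends_cst.
move=> n; rewrite -(s_q i (leqnn n)) (repM hP) -(rep_starl hP) starB star1 (qP n).1.
by rewrite Pi1B zetar_fix subrr inner0l.
Qed.

Let Pi1E a : Pi (1 - a) = 1 - Pi a.
Proof. by apply: bop_ext => x; rewrite Pi1B bopB. Qed.

Let star1B (a : C) : star a = a -> star (1 - a) = 1 - a.
Proof. by move=> sa; rewrite starB star1 sa. Qed.

Lemma L_star_final i m : star (L i) * Pi (1 - q m) = Pi (star (s i m)).
Proof.
rewrite (star_hom_star hP) -L_final starM -(star_hom_star hP) star1B//.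
exact: (qP m).1.
Qed.

Lemma L_isometry i : star (L i) * L i = 1.
Proof.
apply: (isometry_off_line (limit_zeta i)) => [n|]; last by rewrite L_zeta L_star_zeta.
rewrite -Pi1E L_initial -{1}(s_q i (leqnn n)) (star_homM hP) mulrA L_star_final.
by rewrite -(star_homM hP) s_isom.
Qed.

Lemma L_coisometry i : L i * star (L i) = 1.
Proof.
rewrite -[X in X * _]starK; apply: (isometry_off_line limit_zetar) => [n|]; last first.
  by rewrite L_star_zeta starK L_zeta.
rewrite starK -Pi1E L_star_final -(s_p i (leqnn n)) starM star1B; last exact: (pP i n).1.
by rewrite (star_homM hP) mulrA L_initial -(star_homM hP) s_coisom.
Qed.

Lemma L_conj i n : L i * Pi (p i n) = Pi (q n) * L i.
Proof.
have := L_initial i n; rewrite -(L_final i n) !Pi1E mulrBr mulrBl mulr1 mul1r.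
by move/addrI/oppr_inj.
Qed.

(** The distinguished unitary is trivial: its sum telescopes. *)
Lemma L_r : L r = 1.
Proof.
apply: bop_ext => x.
have tel N : s r N = 1 - q N.
  elim: N => [|N IH]; first by rewrite big_ord0 corner_proj0 subrr.
  by rewrite big_ord_recr /= IH hwr subrKA.
have SE : S r x = x - <<x, zeta r>> *: zeta r.
  apply: tends_unique (hS r x) _.
  apply: (@eq_tends _ _ _ (fun n => x - Pi (q n) x)); last first.
    by apply: tendsB; [exact: tends_cst|exact: limit_zetar].
  by move=> n; rewrite tel Pi1B.
by rewrite hL -[LHS]/(S r x + <<_, _>> *: _) SE subrK.
Qed.

(** Conjugation by a unitary preserves the trace, and so do the norm limits of
    such conjugations. *)
Lemma tau_alpha i a : tau (alpha i a) = tau a.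
Proof.
have traceC := car_traceC hC htau gnstau.
have tauE b : tau b = <<pitau b Om, Om>> by case: gnstau.
have [u [uU _ _ ual]] := hasymp i.
apply/eqP; rewrite -subr_eq0 -normr_eq0 eq_le normr_ge0 andbT.
apply/ler_addgt0Pl => e e0; rewrite addr0.
have e2 : 0 < e / 2 by rewrite divr_gt0.
have [t t0 /(_ t (lexx t)) ht'] := ual a _ e2.
have [uu _] := uU t t0.
have -> : tau a = tau (u t * a * star (u t)).
  by rewrite traceC mulrA uu mul1r.
rewrite !tauE -innerBl -(repB ht); apply: le_trans (cauchy_schwarz _ _) _.
rewrite (trace_vector_norm hC htau gnstau) mulr1.
apply: le_trans (rep_cnorm Om ht e2 (ltW ht')) _.
by rewrite (trace_vector_norm hC htau gnstau) mulr1 mulrC divfK.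
Qed.

Lemma p_trace_norm i n : `|pitau (p i n) Om| ^+ 2 = (2 ^+ n)^-1.
Proof.
have hp := star_hom_projection ht (pP i n).
rewrite -projection_inner//; have [_ _ <-] := gnstau; rewrite tau_alpha.
have [k E] := corner_delta R[i] n.
rewrite /corner_proj E (tau_iota htau) /mxtrace (bigD1 k)//= big1 => [|l lk].
  by rewrite mxE !eqxx addr0 mulr1.
by rewrite mxE (negPf lk).
Qed.

(** * The image of the extension lies in the factor *)

Local Notation A := (cstar_alg (range Pi `|` range L)).
Variables (j : C -> A) (hj : forall a, cstar_val (j a) = Pi a).
Variables (Theta : A -> 'B(Htau)) (hT : star_hom Theta).
Hypothesis Thetaj : forall a, Theta (j a) = pitau a.

Let L_gen i : L i \in cstar_gen_pred (range Pi `|` range L).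
Proof. by apply/asboolP => B _; apply; right; exists i. Qed.

Let l i : A := CstarAlg (L_gen i).

Let jhom : star_hom j.
Proof.
split.
- by move=> k a b; apply: val_inj; rewrite /= !hj (star_hom_linear hP).
- by apply: val_inj; rewrite /= hj (star_hom1 hP).
- by move=> a b; apply: val_inj; rewrite /= !hj (star_homM hP).
- by move=> a; apply: val_inj; rewrite /= !hj (star_hom_star hP).
Qed.

Let l_isometry i : star (l i) * l i = 1.
Proof. by apply: val_inj; exact: L_isometry. Qed.

Let l_coisometry i : l i * star (l i) = 1.
Proof. by apply: val_inj; exact: L_coisometry. Qed.

Let l_r : l r = 1.
Proof. by apply: val_inj; exact: L_r. Qed.

Let jB a b : j (a - b) = j a - j b.
Proof. by rewrite addrC -scaleN1r (star_hom_linear jhom) scaleN1r addrC. Qed.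

Let l_split i n : l i = j (s i n) + l i * j (p i n).
Proof.
apply/eqP; rewrite -subr_eq -[X in X - _]mulr1 -mulrBr -(star_hom1 jhom) -jB.
by apply/eqP/val_inj; rewrite /= !hj L_initial.
Qed.

Let l_conj i n : l i * j (p i n) = j (q n) * l i.
Proof. by apply: val_inj; rewrite /= !hj L_conj. Qed.

Let ThetaU i v : `|Theta (l i) v| = `|v|.
Proof.
apply/eqP; rewrite -(eqrXn2 (n := 2))// !normE -(rep_starl hT) -(repM hT).
by rewrite l_isometry (rep1 hT).
Qed.

(** On vectors b Om the error is the norm of p b Om, which is small because the
    trace of p is; bounds by one extend the convergence to all vectors. *)
Lemma Theta_L_limit i v : tends (fun n => pitau (s i n) v) (Theta (l i) v).
Proof.
have traceC := car_traceC hC htau gnstau.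
have sb n x : `|pitau (s i n) x| <= 1 * `|x|.
  rewrite norm_le_sqr// expr1n mul1r -(rep_starl ht) -(repM ht) s_isom (repB ht) (rep1 ht).
  rewrite innerBl projection_inner; last exact: star_hom_projection (pP i n).
  by rewrite lerBlDl lerDr exprn_ge0.
have tb : opnorm_le (Theta (l i)) 1 by move=> x; rewrite ThetaU mul1r.
have [_ cyc _] := gnstau.
apply: (tends_closure ler01 sb tb (V := range (fun b => pitau b Om))); last first.
  by move=> e e0; have /denseP/(_ v _ e0) := cyc.
move=> _ [b _ <-]; have [c c0 cP] := bop_boundP (pitau (star b)).
have plim : tends (fun n => pitau (p i n) Om) 0.
  apply: tends_norm_sqr0; apply: (@eq_tends _ _ _ (fun n => (2 ^+ n)^-1)).
    by move=> n; rewrite p_trace_norm.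
  exact: tends_expV2.
apply: (tends_dom c0 _ plim); exists 0%N => n _; rewrite subr0.
rewrite (l_split i n) (repD hT) Thetaj opprD addrA subrr add0r normrN (repM hT) ThetaU.
rewrite Thetaj -(repM ht) -(gns_norm_star gnstau traceC) starM (pP i n).1 (repM ht).
exact: cP.
Qed.

(** The factor is norm closed, so only the generators matter: the unitaries
    are strong limits of elements of C. *)
Lemma Theta_vn a : M (Theta a).
Proof.
have [M1 ML MM Ms] := vn_subalgebra gnstau.
move: a; apply: cstar_alg_ind.
- by rewrite (star_hom1 hT).
- by move=> k x y Mx My; rewrite (star_hom_linear hT); exact: ML.
- by move=> x y Mx My; rewrite (star_homM hT); exact: MM.
- by move=> x Mx; rewrite (star_hom_star hT); exact: Ms.
- move=> x h; apply: commutant_closed => e e0.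
  have e2 : 0 < e / 2 by rewrite divr_gt0.
  have [y My xy] := h _ e2; exists (Theta y) => // v.
  rewrite bopB -(repB hT); apply: le_trans (star_hom_bounded (opnorm_normed _) hT e2 xy v) _.
  by rewrite mulrCA divff ?mulr1// pnatr_eq0.
move=> x [[a _ ax]|[i _ ix]].
  have -> : x = j a by apply: val_inj; rewrite /= hj ax.
  by rewrite Thetaj; exact: vn_rep.
have -> : x = l i by apply: val_inj.
move=> T cT; apply: bop_ext => v; rewrite !bopM.
apply: tends_unique (Theta_L_limit i (T v)) _.
apply: (@eq_tends _ _ _ (fun n => T (pitau (s i n) v))).
  move=> n; have := cT (pitau (s i n)); rewrite /= => h.
  have {}h : T * pitau (s i n) = pitau (s i n) * T by apply: h; exists (s i n).
  by rewrite -[LHS]/((pitau (s i n) * T) v) -h.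
by apply: tends_bop; exact: Theta_L_limit.
Qed.

(** * The representation is isometric *)

Local Notation v_ n := (pitau (q n) Om).

(** Unit vectors whose vector states converge to the corner state on C. *)
Definition corner_vector n : Htau := `|v_ n|^-1 *: v_ n.

Let eta := corner_vector.

Let v_norm n : `|v_ n| ^+ 2 = (2 ^+ n)^-1.
Proof. by rewrite -(p_trace_norm r) halphar. Qed.

Let v_neq0 n : `|v_ n| != 0.
Proof. by rewrite -sqrf_eq0 v_norm invr_eq0 expf_neq0// pnatr_eq0. Qed.

Let eta_norm n : `|eta n| = 1.
Proof. by rewrite /eta normrZ ger0_norm ?invr_ge0// mulVf. Qed.

Let eta_fix m n : (m <= n)%N -> pitau (q m) (eta n) = eta n.
Proof. by move=> mn; rewrite /eta /corner_vector linearZ /= -(repM ht) (qle mn).2. Qed.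

Let Theta_star_norm i v : `|Theta (star (l i)) v| = `|v|.
Proof.
apply/eqP; rewrite -(eqrXn2 (n := 2))// !normE -(rep_starl hT) starK -(repM hT).
by rewrite l_coisometry (rep1 hT).
Qed.

Let l_star_conj i n : star (l i) * j (q n) = j (p i n) * star (l i).
Proof.
have := congr1 star (l_conj i n); rewrite !starM -!(star_hom_star jhom).
by rewrite (qP n).1 (pP i n).1.
Qed.

(** The vector Pi b (zeta k) is b * star (L k) applied to zeta r; the same word
    applied to the approximants of the corner state is its counterpart. *)
Definition corner_pair (v : nat -> Htau) (x : H) : Prop := exists k b,
  v = (fun n => Theta (j b * star (l k)) (eta n)) /\ x = Pi b (zeta k).

Lemma corner_pair_bounded v x : corner_pair v x ->
  exists c : R[i], exists N, forall n, (N <= n)%N -> `|v n| <= c.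
Proof.
move=> [k [b [-> _]]]; have [c c0 cP] := bop_boundP (Theta (j b * star (l k))).
by exists c, 0%N => n _; apply: le_trans (cP _) _; rewrite eta_norm mulr1.
Qed.

(** The excision error at the vector pitau (p k n) Om is proportional to its
    norm, which the normalization compensates exactly. *)
Lemma trace_excision k c :
  tends (fun n => `|v_ n| ^- 2 * <<pitau (p k n * c * p k n) Om, Om>>) (phi k c).
Proof.
have [a <-] := alpha_surj halpha k c; rewrite hphialpha => e e0.
have hs := star_hom_comp (ahom k) ht.
have [N NP] := excision hC hphir (gnsphi r) a hs e0.
exists N => n /NP/(_ (pitau (p k n) Om)) h.
pose y := pitau (p k n) Om.
have yn : `|y| ^+ 2 = `|v_ n| ^+ 2 by rewrite /y p_trace_norm v_norm.
have [ps pp] := pP k n.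
have yfix : pitau (p k n) y = y by rewrite /y -(repM ht) pp.
have -> : <<pitau (p k n * alpha k a * p k n) Om, Om>> =
    <<(pitau \o alpha k) (q n * a * q n) y, y>>.
  rewrite /= !(star_homM (ahom k)) /y -(rep_starl ht) ps -!(repM ht) !mulrA pp.
  by rewrite -!mulrA pp.
have -> : phi r a = `|v_ n| ^- 2 * <<phi r a *: (pitau \o alpha k) (q n) y, y>>.
  by rewrite /= yfix innerZl -normE yn mulrCA mulVf ?mulr1// expf_neq0.
rewrite -mulrBr -innerBl normrM ger0_norm ?invr_ge0 ?exprn_ge0//.
rewrite ler_pdivrMl ?exprn_gt0 ?lt0r ?v_neq0 ?normr_ge0//.
apply: le_trans (cauchy_schwarz _ _) _; rewrite -yn [X in _ <= X]mulrC expr2 mulrA.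
by rewrite ler_wpM2r.
Qed.

(* Right multiplication by the unitary Theta (star (l k)) preserves the trace
   form, so it disappears from the inner products. *)
Let corner_inner_same k b b' n :
  <<Theta (j b * star (l k)) (eta n), Theta (j b' * star (l k)) (eta n)>> =
  `|v_ n| ^- 2 * <<pitau (p k n * (star b' * b) * p k n) Om, Om>>.
Proof.
have traceC := car_traceC hC htau gnstau.
have [_ _ MM _] := vn_subalgebra gnstau.
have E c : Theta (j c * star (l k)) (eta n) =
    `|v_ n|^-1 *: pitau (c * p k n) (Theta (star (l k)) Om).
  rewrite /eta /corner_vector linearZ /=; congr (_ *: _).
  rewrite -(Thetaj (q n)) -(repM hT) -mulrA l_star_conj.
  by rewrite mulrA -(star_homM jhom) (repM hT) Thetaj.
rewrite !E innerZl innerZr mulrA.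
have -> : `|v_ n|^-1 * Num.conj `|v_ n|^-1 = `|v_ n| ^- 2.
  have /CrealP -> : `|v_ n|^-1 \is Num.real by rewrite ger0_real// invr_ge0.
  by rewrite -invfM -expr2.
congr (_ * _).
rewrite -(rep_starl ht) -(repM ht) starM (pP k n).1 (rep_starr hT).
have -> : p k n * star b' * (b * p k n) = p k n * (star b' * b) * p k n by rewrite !mulrA.
set z := _ * p k n.
have := vn_trace gnstau traceC (Theta_vn (l k)) (MM _ _ (vn_rep z) (Theta_vn (star (l k)))).
by rewrite !bopM => ->; rewrite -(repM hT) l_isometry (rep1 hT).
Qed.

Lemma corner_pair_inner_same k b b' :
  tends (fun n => <<Theta (j b * star (l k)) (eta n), Theta (j b' * star (l k)) (eta n)>>)
    <<Pi b (zeta k), Pi b' (zeta k)>>.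
Proof.
have -> : <<Pi b (zeta k), Pi b' (zeta k)>> = phi k (star b' * b).
  have [_ _ ->] := gnsphi k; have [isom _ _] := hinc.
  rewrite -(rep_starl hP) -(repM hP) -[X in _ = X]isom -hPi.
  by [].
apply: eq_tends (trace_excision k (star b' * b)) => n.
exact: corner_inner_same.
Qed.

(** For different states, inserting a projection p k' N between the two factors
    costs nothing on one side, and makes the other side small because p k' N
    tends to zero on the k-th component. *)
Lemma corner_pair_inner v x v' x' : corner_pair v x -> corner_pair v' x' ->
  tends (fun n => <<v n, v' n>>) <<x, x'>>.
Proof.
move=> [k [b [-> ->]]] [k' [b' [-> ->]]].
have [kk|kk] := EM (k = k'); first by subst k'; exact: corner_pair_inner_same.
have [_ orth _] := hinc.
have orth' c : <<Pi c (zeta k), zeta k'>> = 0 by rewrite hPi orth.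
have -> : <<Pi b (zeta k), Pi b' (zeta k')>> = 0.
  by rewrite -(rep_starl hP) -(repM hP) orth'.
move=> e e0; pose c := star b' * b.
have e2 : 0 < e / 2 by rewrite divr_gt0.
have [N /(_ N (leqnn _))] := limit_zeta k' (Pi c (zeta k)) e2.
rewrite orth' scale0r subr0 -(repM hP) => hN.
have hN' : `|Pi (p k' N * c) (zeta k)| < e.
  by apply: le_lt_trans hN _; rewrite ltr_pdivrMr// ltr_pMr// -[X in X < _]/(1%:R) ltr_nat.
have [m mP] := tends_inner_norm_lt (corner_pair_inner_same k (p k' N * c) (p k' N * c)) hN'.
exists (maxn N m) => n; rewrite geq_max => /andP[nN nm]; rewrite subr0.
have -> : <<Theta (j b * star (l k)) (eta n), Theta (j b' * star (l k')) (eta n)>> =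
    <<Theta (j (p k' N * c) * star (l k)) (eta n), Theta (star (l k')) (eta n)>>.
  rewrite -{2}(eta_fix nN) -(Thetaj (q N)) -(repM hT) -mulrA l_star_conj mulrA.
  rewrite -(star_homM jhom) (repM hT (j _)) -(rep_starl hT) -(star_hom_star jhom) starM.
  by rewrite (pP k' N).1 -(repM hT) mulrA -(star_homM jhom) -mulrA.
apply: le_trans (cauchy_schwarz _ _) _; rewrite Theta_star_norm eta_norm mulr1.
exact: mP.
Qed.

Local Notation cpair := (pair_span corner_pair).
Local Notation cmap := (pair_map corner_pair).

Lemma corner_map_j a : cmap (Pi a) (Theta (j a)).
Proof.
apply: pair_map_base => v x [k [b [-> ->]]]; apply: pair_base; exists k, (a * b).
rewrite (repM hP); split=> //; apply: funext => n.
by rewrite -(repM hT) mulrA -(star_homM jhom).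
Qed.

Let pair_e k : cpair (fun n => Theta (star (l k)) (eta n)) (zeta k).
Proof.
apply: pair_base; exists k, 1; rewrite (rep1 hP); split=> //; apply: funext => n.
by rewrite (star_hom1 jhom) mul1r.
Qed.

Let pair_eta : cpair eta (zeta r).
Proof.
apply: pair_eventually (pair_e r) _; exists 0%N => n _.
by rewrite l_r star1 (rep1 hT).
Qed.

Let val_l_split i n : L i = Pi (s i n) + L i * Pi (p i n).
Proof. by have := congr1 (@cstar_val _ _ _) (l_split i n); rewrite /= !hj. Qed.

Let ThetaD x y : Theta (x + y) = Theta x + Theta y.
Proof. by apply: bop_ext => v; rewrite (repD hT). Qed.

Let Theta_l_split i n : Theta (l i) = Theta (j (s i n)) + Theta (l i) * Theta (j (p i n)).
Proof. by rewrite -(star_homM hT) -ThetaD -l_split. Qed.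

Let l_star_split i n : star (l i) = j (star (s i n)) + star (l i) * j (q n).
Proof.
rewrite l_star_conj {1}(l_split i n) starD starM -!(star_hom_star jhom).
by rewrite (pP i n).1.
Qed.

(** Off the line of zeta i the unitary is a partial sum in C, by l_split; on
    that line it carries the approximants attached to i to eta. *)
Lemma corner_map_l i : cmap (L i) (Theta (l i)).
Proof.
apply: (pair_map_off_line (base := corner_pair) corner_pair_bounded corner_pair_inner
  (sH := fun m => Pi (s i m)) (pH := fun m => Pi (p i m))
  (sK := fun m => Theta (j (s i m))) (pK := fun m => Theta (j (p i m)))
  (e := fun n => Theta (star (l i)) (eta n)) (f := eta) (z := zeta i)).
- move=> x; rewrite norm_le_sqr// expr1n mul1r -star_bopl.
  by rewrite -[star (L i) (L i x)]/((star (L i) * L i) x) L_isometry.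
- by move=> x; rewrite ThetaU mul1r.
- by move=> m; exact: corner_map_j.
- by move=> m; exact: corner_map_j.
- by move=> m; exact: val_l_split.
- by move=> m; exact: Theta_l_split.
- exact: pair_e.
- by rewrite L_zeta; exact: pair_eta.
- exact: zeta_inner.
- by move=> n; rewrite -(repM hT) l_coisometry (rep1 hT).
- move=> m n mn; rewrite -(repM hT) -l_star_conj (repM hT) Thetaj.
  by rewrite eta_fix.
- exact: limit_zeta.
Qed.

Lemma corner_map_l_star i : cmap (star (L i)) (Theta (star (l i))).
Proof.
apply: (pair_map_off_line (base := corner_pair) corner_pair_bounded corner_pair_inner
  (sH := fun m => Pi (star (s i m))) (pH := fun m => Pi (q m))
  (sK := fun m => Theta (j (star (s i m)))) (pK := fun m => Theta (j (q m)))
  (e := eta) (f := fun n => Theta (star (l i)) (eta n)) (z := zeta r)).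
- move=> x; rewrite norm_le_sqr// expr1n mul1r star_bopl.
  by rewrite -[L i (star (L i) x)]/((L i * star (L i)) x) L_coisometry.
- by move=> x; rewrite Theta_star_norm mul1r.
- by move=> m; exact: corner_map_j.
- by move=> m; exact: corner_map_j.
- move=> m; have := congr1 (@cstar_val _ _ _) (l_star_split i m).
  by rewrite /= !hj.
- by move=> m; rewrite -(star_homM hT) -ThetaD -l_star_split.
- exact: pair_eta.
- by rewrite L_star_zeta; exact: pair_e.
- exact: zeta_inner.
- by [].
- by move=> m n mn; rewrite Thetaj eta_fix.
- exact: limit_zetar.
Qed.

Lemma corner_map (a : A) : cmap (cstar_val a) (Theta a).
Proof.
suff [] : cmap (cstar_val a) (Theta a) /\ cmap (cstar_val (star a)) (Theta (star a)) by [].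
move: a; apply: cstar_alg_ind.
- by rewrite star1 (star_hom1 hT); split; exact: pair_map1.
- move=> k x y [x1 x2] [y1 y2]; rewrite starD starZ !(star_hom_linear hT).
  by split; exact: pair_map_lin.
- move=> x y [x1 x2] [y1 y2]; rewrite starM !(star_homM hT).
  by split; exact: pair_mapM.
- by move=> x [x1 x2]; rewrite starK.
- have bd y (e : R[i]) : 0 < e -> opnorm_le (cstar_val y) (e / 2) ->
      opnorm_le (cstar_val y) e /\ opnorm_le (Theta y) e.
    move=> e0 ye; have e2 : 0 < e / 2 by rewrite divr_gt0.
    split; first by apply: opnorm_ler ye; rewrite ler_pdivrMr// ler_pMr// -[X in X <= _]/(1%:R) ler_nat.
    have := star_hom_bounded (opnorm_normed _) hT e2 ye.
    by rewrite mulrC divfK.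
  have ThetaB x y : Theta (x - y) = Theta x - Theta y.
    by apply: bop_ext => v; rewrite (repB hT) bopB.
  move=> x h; split; apply: (pair_map_limit corner_pair_bounded) => e e0.
    have e2 : 0 < e / 2 by rewrite divr_gt0.
    have [y [y1 y2] xy] := h _ e2; exists (cstar_val y), (Theta y).
    by have [] := bd _ _ e0 xy; rewrite ThetaB.
  have e2 : 0 < e / 2 by rewrite divr_gt0.
  have [y [y1 y2] xy] := h _ e2; exists (cstar_val (star y)), (Theta (star y)).
  have xy' : opnorm_le (cstar_val (star x - star y)) (e / 2).
    by rewrite -starB; exact: opnorm_le_adjoint.
  by have [] := bd _ _ e0 xy'; rewrite ThetaB.
move=> x [[a _ ax]|[i _ ix]].
  have -> : x = j a by apply: val_inj; rewrite /= hj ax.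
  by rewrite -(star_hom_star jhom) !hj; split; exact: corner_map_j.
have -> : x = l i by apply: val_inj.
by split; [exact: corner_map_l|exact: corner_map_l_star].
Qed.

Lemma corner_pair_dense (x : H) (e : R[i]) : 0 < e ->
  exists v y, cpair v y /\ `|x - y| < e.
Proof.
move: x e; apply: (direct_sum_closure hinc).
- move=> e e0; exists (fun n => - 1 *: eta n + eta n), (- 1 *: zeta r + zeta r).
  by split; [exact: pair_lin|rewrite scaleN1r addNr subrr normr0].
- move=> k x y hx hy e e0; have e2 : 0 < e / 2 by rewrite divr_gt0.
  have k1 : 0 < `|k| + 1 by rewrite ltr_wpDl.
  have [v [x' [hv xx']]] := hx _ (divr_gt0 e2 k1); have [v' [y' [hv' yy']]] := hy _ e2.
  exists (fun n => k *: v n + v' n), (k *: x' + y'); split; first exact: pair_lin.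
  rewrite opprD addrACA -scalerBr (splitr e).
  apply: le_lt_trans (ler_normD _ _) _; apply: ler_ltD => //.
  rewrite normrZ; apply: le_trans (_ : (`|k| + 1) * `|x - x'| <= _).
    by rewrite ler_wpM2r// lerDl.
  by rewrite -ler_pdivlMl// mulrC ltW.
- move=> x h e e0; have e2 : 0 < e / 2 by rewrite divr_gt0.
  have [y hy xy] := h _ e2; have [v [z [hv yz]]] := hy _ e2.
  exists v, z; split=> //; rewrite (splitr e) -(subrKA y).
  by apply: le_lt_trans (ler_normD _ _) _; rewrite ltrD.
move=> i x e e0; have [_ d _] := gnsphi i.
have /denseP/(_ x e e0)[_ [b _ <-] xb] := d.
have hb := corner_map_j b (pair_e i).
exists (fun n => Theta (j b) (Theta (star (l i)) (eta n))), (Pi b (zeta i)).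
split; first exact: hb.
rewrite hPi -linearB /=; have [isom _ _] := hinc.
have -> : `|inc i (x - pi_ i b (xi i))| = `|x - pi_ i b (xi i)| by
  apply/eqP; rewrite -(eqrXn2 (n := 2))// !normE isom.
exact: xb.
Qed.

Lemma Theta_bounded_below (a : A) (c : R[i]) :
  opnorm_le (Theta a) c -> opnorm_le (cstar_val a) c.
Proof.
exact: (pair_map_opnorm corner_pair_bounded corner_pair_inner (corner_map a)
  corner_pair_dense).
Qed.

Lemma Theta_injective : injective Theta.
Proof.
move=> a b ab; apply/eqP; rewrite -subr_eq0; apply/eqP.
apply: (nle_eq0 (opnorm_normed _)) => e e0; apply: Theta_bounded_below => v.
by rewrite (repB hT) ab subrr normr0 mulr_ge0// ltW.
Qed.

End Realization.

(** * Strong density of the extension in the factor *)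

Lemma star_hom_conj (R : realType) (A : starAlgType R[i]) (H K : hilbertType R)
    (rho : A -> 'B(K)) (T : bop H K) : star_hom rho -> unitary_op T ->
  star_hom (fun a => bop_comp (adjoint T) (bop_comp (rho a) T)).
Proof.
move=> hr [TT TT'].
have TTK x : T (adjoint T x) = x by have := congr1 (fun S : 'B(K) => S x) TT'.
have TK x : adjoint T (T x) = x by have := congr1 (fun S : 'B(H) => S x) TT.
split.
- by move=> k x y; apply: bop_ext => v /=; rewrite (repD hr) (repZ hr) bop_adj_linear.
- by apply: bop_ext => v /=; rewrite (rep1 hr); exact: TK.
- by move=> x y; apply: bop_ext => v /=; rewrite (repM hr) -[bop_adj T (_ (T v))]/(adjoint T _) TTK.
- move=> x; apply: bop_ext => v; apply: innerrI => z.
  by rewrite star_bopr /= bop_adjPC -(rep_starr hr) bop_adjP -[RHS]bop_adjP; symmetry; rewrite -bop_adjP.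
Qed.

Theorem corollary5p4 (R : realType)
  (* the CAR algebra, its trace, and the GNS triple of the trace *)
  (C : cstarAlgType R[i]) (iota : forall n, 'M[R[i]]_(car_dim n) -> C)
  (hC : is_CAR iota)
  (tau : C -> R[i]) (htau : is_trace_state iota tau)
  (Htau : hilbertType R) (pitau : C -> 'B(Htau)) (Omegatau : Htau)
  (gnstau : gns_triple tau pitau Omegatau)
  (* pure-state data *)
  (I : Type) (r : I) (phi : I -> C -> R[i])
  (hphi : forall i, pure_state (phi i))
  (hphir : is_corner_state iota (phi r))
  (H_ : I -> hilbertType R) (pi_ : forall i, C -> 'B(H_ i)) (xi : forall i, H_ i)
  (gnsphi : forall i, gns_triple (phi i) (pi_ i) (xi i))
  (hclasses : forall (K : hilbertType R) (sigma : C -> 'B(K)),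
     irreducible_rep sigma -> exists! i, unitarily_equivalent sigma (pi_ i))
  (alpha : I -> C -> C)
  (halpha : forall i, star_automorphism (alpha i) /\ asymptotically_inner (alpha i))
  (hphialpha : forall i a, phi i (alpha i a) = phi r a)
  (halphar : forall a, alpha r a = a)
  (w : I -> nat -> C)
  (hw : forall i n, star (w i n) * w i n =
     alpha i (corner_proj iota n) - alpha i (corner_proj iota n.+1))
  (hw' : forall i n, w i n * star (w i n) =
     corner_proj iota n - corner_proj iota n.+1)
  (hwr : forall n, w r n = corner_proj iota n - corner_proj iota n.+1)
  (* the algebra A *)
  (H : hilbertType R) (inc : forall i, bop (H_ i) H)
  (hinc : hilbert_direct_sum inc)
  (Pi : C -> 'B(H)) (hPi : forall a i x, Pi a (inc i x) = inc i (pi_ i a x))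
  (S : I -> 'B(H))
  (hS : forall i x, Pi (\sum_(n < N) w i n) x @[N --> \oo] --> S i x)
  (L : I -> 'B(H))
  (hL : forall i, L i = S i + rank_one (inc r (xi r)) (inc i (xi i)))
  (j : C -> cstar_alg (range Pi `|` range L))
  (hj : forall a, cstar_val (j a) = Pi a)
  (* the state extension of tau, its GNS triple, and the unitary T *)
  (tau' : cstar_alg (range Pi `|` range L) -> R[i])
  (htau' : is_state tau' /\ forall a, tau' (j a) = tau a)
  (K : hilbertType R) (rho : cstar_alg (range Pi `|` range L) -> 'B(K)) (Omega : K)
  (gnstau' : gns_triple tau' rho Omega)
  (T : bop Htau K) (hT : unitary_op T)
  (hTOmega : forall b, T (pitau b Omegatau) = rho (j b) Omega) :
  let Theta (a : cstar_alg (range Pi `|` range L)) : 'B(Htau) :=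
    bop_comp (adjoint T) (bop_comp (rho a) T) in
  let M : set 'B(Htau) := bicommutant (range pitau) in
  [/\ II1_factor M /\ hyperfinite M,
      range pitau `<=` range Theta,
      range Theta `<=` M,
      bicommutant (range Theta) = M
    & [/\ star_hom Theta, injective Theta, cstar_subalgebra (range Theta)
        & M `<=` sot_closure (range Theta)]].
Proof.
move=> Theta M.
have aut i : star_automorphism (alpha i) by case: (halpha i).
have asy i : asymptotically_inner (alpha i) by case: (halpha i).
have hS' i x : tends (fun N => Pi (\sum_(n < N) w i n) x) (S i x) by apply/cvg_tends/hS.
have hPi' := direct_sum_rep gnsphi hinc hPi.
have [hrho _ _] := gnstau'; have [hpit cyc _] := gnstau.
have hT' : star_hom Theta := star_hom_conj hrho hT.
have [TT TT'] := hT.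
have TK x : adjoint T (T x) = x by have := congr1 (fun S : 'B(Htau) => S x) TT.
have jM a b : j (a * b) = j a * j b.
  by apply: val_inj; rewrite /= !hj (star_homM hPi').
have Thetaj a : Theta (j a) = pitau a.
  apply: (bop_eq_dense cyc) => _ [b _ <-].
  rewrite -[LHS]/(adjoint T (rho (j a) (T (pitau b Omegatau)))) hTOmega.
  by rewrite -(repM hrho) -jM -hTOmega TK (repM hpit).
have sub : range pitau `<=` range Theta.
  by move=> _ [a _ <-]; exists (j a).
have ThetaM : range Theta `<=` M.
  move=> _ [a _ <-].
  exact: (Theta_vn hC htau gnstau hphir gnsphi hclasses aut asy hphialpha halphar hw hw'
    hinc hPi hS' hL hj hT' Thetaj).
have below : forall a (c : R[i]), opnorm_le (Theta a) c -> opnorm_le (cstar_val a) c.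
  exact: (Theta_bounded_below hC htau gnstau hphir gnsphi hclasses aut asy hphialpha halphar
    hw hw' hwr hinc hPi hS' hL hj hT' Thetaj).
split=> //.
- by split; [exact: (vn_II1_factor hC htau gnstau)|exact: (vn_hyperfinite hC gnstau)].
- apply/seteqP; split.
    by have := commutantS (commutantS ThetaM); rewrite /M /bicommutant !commutant3.
  exact: commutantS (commutantS sub).
split=> //.
- exact: (Theta_injective hC htau gnstau hphir gnsphi hclasses aut asy hphialpha halphar
    hw hw' hwr hinc hPi hS' hL hj hT' Thetaj).
- exact: closed_range.
- move=> m /(vn_sot_closure hC htau gnstau) h xs e e0.
  by have [X /sub SX Xx] := h xs e e0; exists X.
Qed.
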